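(* Let $V\in C^1(\mathbb{R})$ be a complex-valued periodic function of period $\pi$. Then for every $x\in\mathbb{R}$, $$V(x)=2\nu_0(x)-E_0+\sum_{m=1}^{\infty}\big(2\nu_m(x)-E_{2m-1}-E_{2m}\big).$$
   Context: For $\lambda\in\mathbb{C}$ and $x_0\in\mathbb{R}$, let $c(\lambda,x_0,\cdot)$ and $s(\lambda,x_0,\cdot)$ be the solutions of $-\psi''(x)+V(x)\psi(x)=\lambda\psi(x)$ on $\mathbb{R}$ with $c(\lambda,x_0,x_0)=1$, $c'(\lambda,x_0,x_0)=0$, $s(\lambda,x_0,x_0)=0$, $s'(\lambda,x_0,x_0)=1$, where $'$ denotes the derivative in the last variable. The Floquet discriminant is $\Delta(\lambda)=\tfrac12\big(c(\lambda,x_0,x_0+\pi)+s'(\lambda,x_0,x_0+\pi)\big)$ (independent of $x_0$). The numbers $E_m$, $m\in\mathbb{N}_0$, are the zeros of the entire function $\Delta(\lambda)^2-1$ (equivalently, the eigenvalues of $-d^2/dx^2+V$ with periodic boundary conditions at $0$ and $2\pi$). The Neumann eigenvalues $\nu_k(x)$, $k\in\mathbb{N}_0$, are the eigenvalues of $-d^2/dt^2+V$ on $[x,x+\pi]$ with boundary conditions $f'(x)=0=f'(x+\pi)$, i.e. the zeros of the entire function $\lambda\mapsto c'(\lambda,x,x+\pi)$. Both sequences are listed with multiplicity and numbered in order of non-decreasing modulus. *)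

(* Defs.v *)
From Stdlib Require Import Reals List ClassicalEpsilon.
From Coquelicot Require Import Coquelicot.
Open Scope R_scope.

Definition is_C1 (V : R -> C) : Prop :=
  exists V' : R -> C, forall t : R, is_derive V t (V' t) /\ continuous V' t.

(* (f, g) solves the first-order system equivalent to
   -psi'' + V psi = lam psi, i.e. f' = g, g' = (V - lam) f, with
   initial data f x0 = a, g x0 = b. *)
Definition is_ivp_sol (V : R -> C) (lam : C) (x0 : R) (a b : C)
    (fg : (R -> C) * (R -> C)) : Prop :=
  (forall t : R, is_derive (fst fg) t (snd fg t)) /\
  (forall t : R, is_derive (snd fg) t (((V t) - lam) * fst fg t)%C) /\
  fst fg x0 = a /\ snd fg x0 = b.

Definition ivp_sol (V : R -> C) (lam : C) (x0 : R) (a b : C)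
    : (R -> C) * (R -> C) :=
  epsilon (inhabits ((fun _ : R => RtoC 0), (fun _ : R => RtoC 0)) : inhabited ((R -> C) * (R -> C))) (is_ivp_sol V lam x0 a b).

Definition c_sol  V lam x0 x : C := fst (ivp_sol V lam x0 (RtoC 1) (RtoC 0)) x.
Definition c_solD V lam x0 x : C := snd (ivp_sol V lam x0 (RtoC 1) (RtoC 0)) x.
Definition s_sol  V lam x0 x : C := fst (ivp_sol V lam x0 (RtoC 0) (RtoC 1)) x.
Definition s_solD V lam x0 x : C := snd (ivp_sol V lam x0 (RtoC 0) (RtoC 1)) x.

Definition Delta (V : R -> C) (lam : C) : C :=
  ((c_sol V lam 0 PI + s_solD V lam 0 PI) / 2)%C.

Definition entire (g : C -> C) : Prop :=
  forall w : C, ex_derive (K := C_AbsRing) (V := C_NormedModule) g w.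

Definition zero_order (f : C -> C) (z : C) (n : nat) : Prop :=
  exists g : C -> C, entire g /\ g z <> RtoC 0 /\
    forall w : C, f w = Cmult (Cpow (w - z)%C n) (g w).

Definition enum_zeros (f : C -> C) (E : nat -> C) : Prop :=
  (forall m : nat, Cmod (E m) <= Cmod (E (S m))) /\
  (forall (z : C) (n : nat), zero_order f z n ->
     exists l : list nat, NoDup l /\ length l = n /\
       forall m : nat, In m l <-> E m = z).

Definition periodic_eigs (V : R -> C) (E : nat -> C) : Prop :=
  enum_zeros (fun lam => (Delta V lam * Delta V lam - 1)%C) E.

Definition neumann_eigs (V : R -> C) (x : R) (nu : nat -> C) : Prop :=
  enum_zeros (fun lam => c_solD V lam x (x + PI)) nu.

(* Main.v *)
(** The Neumann function N(lam) = c'(lam,x,x+pi) and the discriminant satisfy Delta^2 - 1 = u^2/4 + N s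
    with s = s(lam,x,x+pi) and u = c - s'. The function z(t) = c(t) - s'(t) solves
    z'' = (V - lam) z - V' s with zero initial data, and z(x+pi) = u, z'(x+pi) = N + (lam - V(x)) s; so with
    lam = k^2, Duhamel's formula, the Riemann-Lebesgue lemma for V' and the periodicity of V give
    N^2 / (lam (1 - Delta^2)) = 1 - V(x)/lam + o(1/lam) on the circles |lam| = (n + 1/2)^2.
    All functions involved are entire in lam. Integrating lam^j times the logarithmic derivative of this quotient
    along such a circle counts zeros (j = 0) and sums them (j = 1). The count is calibrated by the free
    function -k sin(pi k), whose n + 1 zeros (in lam) in the disc are the m^2, so the circle encloses exactly
    nu_0, ..., nu_n and E_0, ..., E_(2n); an integration by parts turns the sum into
    -1/pi times the integral of lam log(quotient), which tends to V(x). *)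

Require Import Defs.
From Stdlib Require Import Reals Lra Lia List ClassicalEpsilon ZArith FinFun.
From Coquelicot Require Import Coquelicot.
Import ListNotations.
Open Scope R_scope.

(** Two obstacles shape the development. The zeros are numbered through factorizations with a merely
    complex differentiable cofactor. Every function met here is therefore carried as an everywhere
    convergent power series in [lam] ([ent]) or as a finite product of such series ([entp]): zeros
    are divided out on the coefficients, cofactors stay in the class, and differentiability never
    has to be upgraded to analyticity. The only integral theorem is then the mean value property on
    circles; residues, the counting of zeros and their finiteness in a disc all follow from it.
    Secondly, an error o(1/lam) is all that the quotient may have. Since N is close to -lam s, the
    term u^2/4 is smaller than N s by a factor of order 1/lam^2, provided s is bounded below by its
    free counterpart. The radii (n + 1/2)^2 ensure this: there |sin(pi k)| is at least a fixed
    multiple of exp(pi Im k). Squaring N makes the leading factors sin(pi k)^2 cancel, so the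
    quotient stays near 1 and has a one-valued logarithm along the whole circle. *)

Notation ccontinuous := (continuous (U := C_UniformSpace)).

(** * Differentiation and integration of complex-valued functions *)

Lemma C_eq (z w : C) : Re z = Re w -> Im z = Im w -> z = w.
Proof. destruct z, w; simpl; intros -> ->; reflexivity. Qed.

Lemma RtoC_nz (r : R) : r <> 0 -> RtoC r <> 0.
Proof. intros H E; now apply RtoC_inj in E. Qed.

Lemma C2_nz : RtoC 2 <> 0.
Proof. apply RtoC_nz; lra. Qed.

Local Hint Resolve C2_nz Ci_nz Cmod_ge_0 : core.

Lemma im_le_Cmod (z : C) : Rabs (Im z) <= Cmod z.
Proof.
unfold Cmod, Im; rewrite <- sqrt_Rsqr_abs; apply sqrt_le_1_alt.
unfold Rsqr; simpl; nra.
Qed.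

Lemma Cmod_Ci : Cmod Ci = 1.
Proof.
unfold Cmod, Ci; simpl.
replace (0 * (0 * 1) + 1 * (1 * 1)) with 1 by ring; apply sqrt_1.
Qed.

Lemma Cmod_le_abs (z : C) : Cmod z <= Rabs (Re z) + Rabs (Im z).
Proof.
replace z with (RtoC (Re z) + Ci * RtoC (Im z))%C at 1.
2: destruct z; apply C_eq; simpl; ring.
eapply Rle_trans; [apply Cmod_triangle|].
rewrite Cmod_mult, !Cmod_R, Cmod_Ci; lra.
Qed.

Lemma Cmod_minus_le (z w : C) : Cmod (z - w) <= Cmod z + Cmod w.
Proof.
unfold Cminus; eapply Rle_trans; [apply Cmod_triangle|].
rewrite Cmod_opp; lra.
Qed.

Lemma Cmod_plus_bound (z w : C) (r : R) : Cmod z + Cmod w <= r -> Cmod (z + w) <= r.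
Proof. apply Rle_trans, Cmod_triangle. Qed.

Lemma Cmod_minus_bound (z w : C) (r : R) : Cmod z + Cmod w <= r -> Cmod (z - w) <= r.
Proof. apply Rle_trans, Cmod_minus_le. Qed.

Lemma Cmod_rev_triangle (z w : C) : Cmod z - Cmod w <= Cmod (z - w).
Proof.
pose proof (Cmod_triangle (z - w) w) as H.
replace (z - w + w)%C with z in H by ring; lra.
Qed.

Lemma Cmod_minus_sym (z w : C) : Cmod (z - w) = Cmod (w - z).
Proof. rewrite <- (Cmod_opp (w - z)); f_equal; ring. Qed.

(** Derivatives along the reals and along the complex plane unfold to the same epsilon estimate;
    starting from it, both chain rules get a common proof. *)
Lemma is_derive_eps_aux {K : AbsRing} {V : NormedModule K} (f : K -> V) (x : K) (l : V) :
  is_derive f x l <-> forall eps : posreal,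
   locally x (fun y => norm (minus (minus (f y) (f x)) (scal (minus y x) l)) <= eps * norm (minus y x)).
Proof.
split.
- intros [_ H] eps; apply (H x); now intros P HP.
- intros H; split; [apply is_linear_scal_l|].
  intros y Hy; rewrite <- (is_filter_lim_locally_unique _ _ Hy); exact H.
Qed.

Lemma is_derive_RC (f : R -> C) (t : R) (l : C) :
  is_derive f t l <-> forall eps, 0 < eps -> exists d, 0 < d /\
   forall s, Rabs (s - t) < d -> Cmod (f s - f t - RtoC (s - t) * l) <= eps * Rabs (s - t).
Proof.
rewrite is_derive_eps_aux; split; intros H.
- intros e He; destruct (H (mkposreal e He)) as [d Hd].
  exists d; split; [apply cond_pos|]; intros s Hs.
  specialize (Hd s Hs); rewrite <- scal_R_Cmult, Cmod_norm; exact Hd.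
- intros e; destruct (H e (cond_pos e)) as (d & Hd & Hs).
  exists (mkposreal d Hd); intros s Hb; specialize (Hs s Hb).
  rewrite <- scal_R_Cmult, Cmod_norm in Hs; exact Hs.
Qed.

Definition is_Cderive (f : C -> C) (z l : C) : Prop :=
  is_derive (K := C_AbsRing) (V := C_NormedModule) f z l.

Lemma is_derive_CC (f : C -> C) (z l : C) :
  is_Cderive f z l <-> forall eps, 0 < eps -> exists d, 0 < d /\
   forall w, Cmod (w - z) < d -> Cmod (f w - f z - (w - z) * l) <= eps * Cmod (w - z).
Proof.
unfold is_Cderive; rewrite (is_derive_eps_aux (K := C_AbsRing) (V := C_NormedModule)); split; intros H.
- intros e He; destruct (H (mkposreal e He)) as [d Hd].
  exists d; split; [apply cond_pos|]; intros s Hs; exact (Hd s Hs).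
- intros e; destruct (H e (cond_pos e)) as (d & Hd & Hs).
  exists (mkposreal d Hd); intros s Hb; exact (Hs s Hb).
Qed.

Lemma is_derive_RC_parts (f : R -> C) (t : R) (l : C) :
  is_derive f t l <->
  is_derive (fun s => Re (f s)) t (Re l) /\ is_derive (fun s => Im (f s)) t (Im l).
Proof.
rewrite is_derive_RC, !is_derive_eps_aux; split.
- intros H; split; intros e; destruct (H e (cond_pos e)) as (d & Hd & Hs);
  exists (mkposreal d Hd); intros s Hb; specialize (Hs s Hb);
  (eapply Rle_trans; [|exact Hs]).
  + eapply Rle_trans; [|apply re_le_Cmod]; right.
    unfold norm; simpl; unfold abs, minus, plus, opp, scal; simpl; unfold mult; simpl.
    f_equal; unfold Re, Im; ring.
  + eapply Rle_trans; [|apply im_le_Cmod]; right.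
    unfold norm; simpl; unfold abs, minus, plus, opp, scal; simpl; unfold mult; simpl.
    f_equal; unfold Re, Im; ring.
- intros [H1 H2] e He.
  assert (He2 : 0 < e / 2) by lra.
  destruct (H1 (mkposreal _ He2)) as [d1 Hd1], (H2 (mkposreal _ He2)) as [d2 Hd2].
  exists (Rmin d1 d2); split; [apply Rmin_pos; apply cond_pos|]; intros s Hs.
  specialize (Hd1 s (Rlt_le_trans _ _ _ Hs (Rmin_l _ _))).
  specialize (Hd2 s (Rlt_le_trans _ _ _ Hs (Rmin_r _ _))).
  eapply Rle_trans; [apply Cmod_le_abs|].
  replace (e * Rabs (s - t)) with (e / 2 * Rabs (s - t) + e / 2 * Rabs (s - t)) by field.
  unfold norm in Hd1, Hd2; simpl in Hd1, Hd2;
  unfold abs, minus, plus, opp, scal in Hd1, Hd2; simpl in Hd1, Hd2; unfold mult in Hd1, Hd2; simpl in Hd1, Hd2.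
  apply Rplus_le_compat; [eapply Rle_trans, Hd1|eapply Rle_trans, Hd2]; right;
  unfold Re, Im; simpl; f_equal; ring.
Qed.

Lemma continuous_RC_parts {T : UniformSpace} (f : T -> C) (t : T) :
  continuous (T := T) (U := C_UniformSpace) f t <->
  continuous (fun s => Re (f s)) t /\ continuous (fun s => Im (f s)) t.
Proof.
split.
- intros H; split; apply (continuous_comp f); try exact H.
  + destruct (f t); apply continuous_fst.
  + destruct (f t); apply continuous_snd.
- intros [H1 H2].
  apply (continuous_ext (T := T) (U := C_UniformSpace) (fun s => (Re (f s), Im (f s)))).
  + intros s; now destruct (f s).
  + apply (continuous_comp_2 (fun s => Re (f s)) (fun s => Im (f s)) (fun x y : R => (x, y) : C_UniformSpace) t H1 H2).
    apply (continuous_ext (fun x : R * R => x)); [now intros []|apply continuous_id].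
Qed.

Lemma is_derive_eq {K : AbsRing} {V : NormedModule K} (f : K -> V) (x : K) (l l' : V) :
  is_derive f x l -> l = l' -> is_derive f x l'.
Proof. now intros H <-. Qed.

Lemma is_derive_Ceq (f : R -> C) (t : R) (l l' : C) :
  is_derive f t l -> l = l' -> is_derive f t l'.
Proof. now intros H <-. Qed.

Lemma is_derive_Cext (f g : R -> C) (t : R) (l : C) :
  (forall s, f s = g s) -> is_derive f t l -> is_derive g t l.
Proof. exact (is_derive_ext (K := R_AbsRing) (V := C_R_NormedModule) f g t l). Qed.

Lemma is_derive_Cplus (f g : R -> C) t a b :
  is_derive f t a -> is_derive g t b -> is_derive (fun s => (f s + g s)%C) t (a + b)%C.
Proof. exact (is_derive_plus (K := R_AbsRing) (V := C_R_NormedModule) f g t a b). Qed.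

Lemma is_derive_Cmult (f g : R -> C) t a b :
  is_derive f t a -> is_derive g t b ->
  is_derive (fun s => (f s * g s)%C) t (a * g t + f t * b)%C.
Proof.
rewrite !is_derive_RC_parts; intros [Ha Ha'] [Hb Hb']; split.
- apply (is_derive_ext (fun s => Re (f s) * Re (g s) - Im (f s) * Im (g s))); [now intros s; rewrite re_mult|].
  eapply is_derive_eq.
  { apply (is_derive_minus (fun s => Re (f s) * Re (g s)) (fun s => Im (f s) * Im (g s)));
    apply (is_derive_mult (K := R_AbsRing)); eauto using Rmult_comm. }
  rewrite re_plus, !re_mult; unfold minus, plus, opp, mult; simpl; ring.
- apply (is_derive_ext (fun s => Re (f s) * Im (g s) + Im (f s) * Re (g s))); [now intros s; rewrite im_mult|].
  eapply is_derive_eq.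
  { apply (is_derive_plus (fun s => Re (f s) * Im (g s)) (fun s => Im (f s) * Re (g s)));
    apply (is_derive_mult (K := R_AbsRing)); eauto using Rmult_comm. }
  rewrite im_plus, !im_mult; unfold minus, plus, opp, mult; simpl; ring.
Qed.

Lemma is_derive_Cconst (c : C) (t : R) : is_derive (fun _ : R => c) t (RtoC 0).
Proof. exact (is_derive_const (K := R_AbsRing) (V := C_R_NormedModule) c t). Qed.

Lemma is_derive_Cscal (c : C) (f : R -> C) t a :
  is_derive f t a -> is_derive (fun s => (c * f s)%C) t (c * a)%C.
Proof.
intros H; eapply is_derive_Ceq; [apply (is_derive_Cmult _ _ _ _ _ (is_derive_Cconst c t) H)|].
ring.
Qed.

Lemma is_derive_Cminus (f g : R -> C) t a b :
  is_derive f t a -> is_derive g t b -> is_derive (fun s => (f s - g s)%C) t (a - b)%C.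
Proof. exact (is_derive_minus (K := R_AbsRing) (V := C_R_NormedModule) f g t a b). Qed.

Lemma is_derive_RtoC (t : R) : is_derive RtoC t (RtoC 1).
Proof.
apply is_derive_RC_parts; split; simpl.
- apply (is_derive_id (K := R_AbsRing)).
- apply (is_derive_const (K := R_AbsRing) (V := R_NormedModule)).
Qed.

Lemma is_derive_Ccomp_affine (f : R -> C) (a b t : R) (l : C) :
  is_derive f (a * t + b) l -> is_derive (fun s => f (a * s + b)) t (a * l)%C.
Proof.
intros H; eapply is_derive_Ceq.
- apply (is_derive_comp f (fun s => a * s + b)); [exact H|].
  assert (Hd : is_derive (fun s : R => a * s + b) t a) by (auto_derive; [easy|ring]).
  exact Hd.
- apply scal_R_Cmult.
Qed.

Lemma Cderive_bounded (f : C -> C) z l : is_Cderive f z l ->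
  exists d, 0 < d /\ forall w, Cmod (w - z) < d -> Cmod (f w - f z) <= (Cmod l + 1) * Cmod (w - z).
Proof.
rewrite is_derive_CC; intros H; destruct (H 1 Rlt_0_1) as (d & Hd & Hw).
exists d; split; [exact Hd|]; intros w Hwd; specialize (Hw w Hwd).
replace (f w - f z)%C with ((f w - f z - (w - z) * l) + (w - z) * l)%C by ring.
apply Cmod_plus_bound; rewrite Cmod_mult; nra.
Qed.

Lemma is_derive_translate (f : R -> C) (h t : R) (l : C) :
  is_derive f (t + h) l -> is_derive (fun s => f (s + h)) t l.
Proof.
intros H; apply (is_derive_Cext (fun s => f (1 * s + h))).
- intros s; now rewrite Rmult_1_l.
- eapply is_derive_Ceq; [apply is_derive_Ccomp_affine; rewrite Rmult_1_l; exact H|ring].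
Qed.

(** Common core of the two chain rules. [D s] stands for the increment of the argument, which is
    [s - t] for a real and [w - z] for a complex variable. *)
Lemma chain_eps {T : Type} (D f : T -> C) (f0 l m : C) (phi : C -> C) :
  is_Cderive phi f0 m ->
  (forall eps, 0 < eps -> exists d, 0 < d /\ forall s, Cmod (D s) < d ->
     Cmod (f s - f0 - D s * l) <= eps * Cmod (D s)) ->
  forall eps, 0 < eps -> exists d, 0 < d /\ forall s, Cmod (D s) < d ->
     Cmod (phi (f s) - phi f0 - D s * (l * m)) <= eps * Cmod (D s).
Proof.
intros Hphi Hf e He.
pose proof (Cmod_ge_0 l); pose proof (Cmod_ge_0 m).
(* [e1] pays for the remainder of [phi], taken over an increment of at most
   [(Cmod l + 1) * Cmod (D s)]; [e2] pays for the remainder of [f] after multiplication by [m], and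
   [e2 <= 1] yields that bound on the increment. *)
set (e1 := e / 2 / (Cmod l + 1)); set (e2 := Rmin 1 (e / 2 / (Cmod m + 1))).
assert (He1 : 0 < e1) by (apply Rdiv_lt_0_compat; lra).
assert (He2 : 0 < e2) by (apply Rmin_pos; [lra|apply Rdiv_lt_0_compat; lra]).
destruct (proj1 (is_derive_CC _ _ _) Hphi e1 He1) as (d1 & Hd1 & Hw).
destruct (Hf e2 He2) as (d2 & Hd2 & Hs).
assert (Hd3 : 0 < d1 / (Cmod l + 1)) by (apply Rdiv_lt_0_compat; lra).
exists (Rmin d2 (d1 / (Cmod l + 1))); split; [now apply Rmin_pos|]; intros s Hst.
specialize (Hs s (Rlt_le_trans _ _ _ Hst (Rmin_l _ _))).
assert (Hst' : Cmod (D s) < d1 / (Cmod l + 1)) by (eapply Rlt_le_trans; [exact Hst|apply Rmin_r]).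
pose proof (Cmod_ge_0 (D s)).
assert (Hle : Cmod (f s - f0) <= (Cmod l + 1) * Cmod (D s)).
{ replace (f s - f0)%C with ((f s - f0 - D s * l) + D s * l)%C by ring.
  apply Cmod_plus_bound; rewrite Cmod_mult.
  assert (e2 <= 1) by apply Rmin_l; nra. }
assert (Hlt : Cmod (f s - f0) < d1).
{ eapply Rle_lt_trans; [exact Hle|].
  apply (Rmult_lt_compat_l (Cmod l + 1)) in Hst'; [|lra].
  replace ((Cmod l + 1) * (d1 / (Cmod l + 1))) with d1 in Hst' by (field; lra); exact Hst'. }
specialize (Hw _ Hlt).
replace (phi (f s) - phi f0 - D s * (l * m))%C with
 ((phi (f s) - phi f0 - (f s - f0) * m) + (f s - f0 - D s * l) * m)%C by ring.
apply Cmod_plus_bound; rewrite Cmod_mult.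
assert (Ha : e1 * Cmod (f s - f0) <= e / 2 * Cmod (D s)).
{ apply (Rmult_le_compat_l e1) in Hle; [|lra].
  replace (e1 * ((Cmod l + 1) * Cmod (D s))) with (e / 2 * Cmod (D s)) in Hle
   by (unfold e1; field; lra); exact Hle. }
assert (Hb : e2 * Cmod m <= e / 2).
{ apply Rle_trans with (e / 2 / (Cmod m + 1) * (Cmod m + 1)).
  - apply Rmult_le_compat; [lra|lra|apply Rmin_r|lra].
  - right; field; lra. }
apply (Rmult_le_compat_r (Cmod m)) in Hs; [|lra].
nra.
Qed.

Lemma is_derive_Ccomp (phi : C -> C) (f : R -> C) t l m :
  is_Cderive phi (f t) m -> is_derive f t l ->
  is_derive (fun s => phi (f s)) t (l * m)%C.
Proof.
intros Hphi Hf; apply is_derive_RC; intros e He.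
destruct (chain_eps (fun s => RtoC (s - t)) f (f t) l m phi Hphi) with (eps := e) as (d & Hd & H).
- intros e' He'; destruct (proj1 (is_derive_RC _ _ _) Hf e' He') as (d & Hd & H).
  exists d; split; [exact Hd|]; intros s; rewrite Cmod_R; apply H.
- exact He.
- exists d; split; [exact Hd|]; intros s; specialize (H s); rewrite Cmod_R in H; exact H.
Qed.

Lemma is_Cderive_comp (phi f : C -> C) z l m :
  is_Cderive phi (f z) m -> is_Cderive f z l ->
  is_Cderive (fun w => phi (f w)) z (l * m)%C.
Proof.
intros Hphi Hf; apply is_derive_CC.
apply (chain_eps (fun w => w - z)%C f (f z) l m phi Hphi).
now apply is_derive_CC.
Qed.

Lemma is_Cderive_eq (f : C -> C) (z l l' : C) :
  is_Cderive f z l -> l = l' -> is_Cderive f z l'.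
Proof. now intros H <-. Qed.

Lemma is_Cderive_ext (f g : C -> C) z l :
  (forall w, f w = g w) -> is_Cderive f z l -> is_Cderive g z l.
Proof. exact (is_derive_ext (K := C_AbsRing) (V := C_NormedModule) f g z l). Qed.

Lemma is_Cderive_plus (f g : C -> C) z a b :
  is_Cderive f z a -> is_Cderive g z b -> is_Cderive (fun w => f w + g w)%C z (a + b)%C.
Proof. exact (is_derive_plus (K := C_AbsRing) (V := C_NormedModule) f g z a b). Qed.

Lemma is_Cderive_minus (f g : C -> C) z a b :
  is_Cderive f z a -> is_Cderive g z b -> is_Cderive (fun w => f w - g w)%C z (a - b)%C.
Proof. exact (is_derive_minus (K := C_AbsRing) (V := C_NormedModule) f g z a b). Qed.

Lemma is_Cderive_const (c z : C) : is_Cderive (fun _ => c) z 0%C.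
Proof. exact (is_derive_const (K := C_AbsRing) (V := C_NormedModule) c z). Qed.

Lemma is_Cderive_id (z : C) : is_Cderive (fun w => w) z 1%C.
Proof.
apply is_derive_CC; intros e He; exists 1; split; [lra|]; intros w _.
replace (w - z - (w - z) * 1)%C with (RtoC 0) by ring.
rewrite Cmod_0; pose proof (Cmod_ge_0 (w - z)); nra.
Qed.

Lemma is_Cderive_scal (c : C) (f : C -> C) z a :
  is_Cderive f z a -> is_Cderive (fun w => c * f w)%C z (c * a)%C.
Proof.
intros Hf; rewrite Cmult_comm; apply (is_Cderive_comp (fun w => c * w)%C f); [|exact Hf].
apply is_derive_CC; intros e He; exists 1; split; [lra|]; intros w _.
replace (c * w - c * f z - (w - f z) * c)%C with (RtoC 0) by ring.
rewrite Cmod_0; apply Rmult_le_pos; [lra|auto].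
Qed.

Lemma is_Cderive_sqr (f : C -> C) z a :
  is_Cderive f z a -> is_Cderive (fun w => f w * f w)%C z (a * (2 * f z))%C.
Proof.
intros Hf; apply (is_Cderive_comp (fun w => w * w)%C f); [|exact Hf].
apply is_derive_CC; intros e He; exists e; split; [exact He|]; intros w Hw.
replace (w * w - f z * f z - (w - f z) * (2 * f z))%C with ((w - f z) * (w - f z))%C by ring.
rewrite Cmod_mult; apply Rmult_le_compat_r; [auto|lra].
Qed.

(* Polarization: 4 f g = (f + g)^2 - (f - g)^2. *)
Lemma is_Cderive_mult (f g : C -> C) z a b :
  is_Cderive f z a -> is_Cderive g z b ->
  is_Cderive (fun w => f w * g w)%C z (a * g z + f z * b)%C.
Proof.
intros Hf Hg.
apply (is_Cderive_ext (fun w => / 4 * ((f w + g w) * (f w + g w) - (f w - g w) * (f w - g w)))%C).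
- intros w; field; apply RtoC_nz; lra.
- eapply is_Cderive_eq.
  + apply is_Cderive_scal, is_Cderive_minus; apply is_Cderive_sqr;
    [apply is_Cderive_plus|apply is_Cderive_minus]; eassumption.
  + cbv beta; field; apply RtoC_nz; lra.
Qed.

Lemma is_Cderive_inv (f : C -> C) z a : f z <> 0%C ->
  is_Cderive f z a -> is_Cderive (fun w => / f w)%C z (- a / (f z * f z))%C.
Proof.
intros Hz Hf.
assert (Hinv : is_Cderive Cinv (f z) (- / (f z * f z))%C).
{ set (v := f z) in *.
  assert (Hv : 0 < Cmod v) by now apply Cmod_gt_0.
  apply is_derive_CC; intros e He.
  (* For |w - v| < |v|/2 one has |w| >= |v|/2, so the remainder |w - v|^2 / (|w| |v|^2) is at most 2
     |w - v|^2 / |v|^3; [q] makes this at most e |w - v|. *)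
  set (q := e * (Cmod v * Cmod v * Cmod v) / 2).
  assert (Hq : 0 < q) by (unfold q; repeat (apply Rmult_lt_0_compat || apply Rdiv_lt_0_compat); lra).
  exists (Rmin (Cmod v / 2) q); split; [apply Rmin_pos; lra|]; intros w Hw.
  assert (Hw1 : Cmod (w - v) < Cmod v / 2) by (eapply Rlt_le_trans; [exact Hw|apply Rmin_l]).
  assert (Hw2 : Cmod (w - v) < q) by (eapply Rlt_le_trans; [exact Hw|apply Rmin_r]).
  assert (Hwv : Cmod v / 2 <= Cmod w).
  { pose proof (Cmod_rev_triangle v w); rewrite Cmod_minus_sym in Hw1; lra. }
  assert (Hw0 : w <> 0%C) by (apply Cmod_gt_0; lra).
  replace (/ w - / v - (w - v) * - / (v * v))%C with ((w - v) * (w - v) * / (w * (v * v)))%C by (field; auto).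
  rewrite !Cmod_mult, Cmod_inv, !Cmod_mult by (repeat apply Cmult_neq_0; auto).
  set (D := Cmod (w - v)) in *; assert (0 <= D) by apply Cmod_ge_0.
  assert (Hb : D * / (Cmod w * (Cmod v * Cmod v)) <= e).
  { assert (Hp : 0 < Cmod w * (Cmod v * Cmod v)) by (apply Rmult_lt_0_compat; nra).
    apply (Rmult_le_reg_r (Cmod w * (Cmod v * Cmod v))); [exact Hp|].
    rewrite Rmult_assoc, Rinv_l by lra.
    unfold q in Hw2.
    apply Rle_trans with (e * (Cmod v * Cmod v * Cmod v) / 2); [lra|].
    assert (0 <= e * (Cmod v * Cmod v)) by nra. nra. }
  rewrite Rmult_assoc, Rmult_comm; now apply Rmult_le_compat_r. }
eapply is_Cderive_eq.
- exact (is_Cderive_comp Cinv f z _ _ Hinv Hf).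
- field; auto.
Qed.

Lemma continuous_Cplus {T : UniformSpace} (f g : T -> C) (t : T) :
  ccontinuous f t -> ccontinuous g t ->
  ccontinuous (fun s => f s + g s)%C t.
Proof.
rewrite !continuous_RC_parts; intros [Hf Hf'] [Hg Hg']; split.
- exact (continuous_plus (V := R_NormedModule) _ _ t Hf Hg).
- exact (continuous_plus (V := R_NormedModule) _ _ t Hf' Hg').
Qed.

Lemma continuous_Copp {T : UniformSpace} (f : T -> C) (t : T) :
  ccontinuous f t -> ccontinuous (fun s => - f s)%C t.
Proof.
rewrite !continuous_RC_parts; intros [Hf Hf']; split.
- exact (continuous_opp (V := R_NormedModule) _ t Hf).
- exact (continuous_opp (V := R_NormedModule) _ t Hf').
Qed.

Lemma continuous_Cminus {T : UniformSpace} (f g : T -> C) (t : T) :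
  ccontinuous f t -> ccontinuous g t ->
  ccontinuous (fun s => f s - g s)%C t.
Proof. intros Hf Hg; apply continuous_Cplus; [exact Hf|now apply continuous_Copp]. Qed.

Lemma continuous_Cmult {T : UniformSpace} (f g : T -> C) (t : T) :
  ccontinuous f t -> ccontinuous g t ->
  ccontinuous (fun s => f s * g s)%C t.
Proof.
rewrite !continuous_RC_parts; intros [Hf Hf'] [Hg Hg']; split.
- apply (continuous_minus (V := R_NormedModule));
  apply (continuous_mult (K := R_AbsRing)); assumption.
- apply (continuous_plus (V := R_NormedModule));
  apply (continuous_mult (K := R_AbsRing)); assumption.
Qed.

Lemma continuous_Cconst {T : UniformSpace} (c : C) (t : T) :
  ccontinuous (fun _ => c) t.
Proof. exact (continuous_const (U := T) (V := C_UniformSpace) c t). Qed.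

Lemma is_derive_continuous (f : R -> C) (t : R) (l : C) :
  is_derive f t l -> ccontinuous f t.
Proof.
intros H; apply (ex_derive_continuous (K := R_AbsRing) (V := C_R_NormedModule)).
now exists l.
Qed.

Lemma is_derive_all_continuous (f f' : R -> C) :
  (forall t, is_derive f t (f' t)) -> forall t, ccontinuous f t.
Proof. intros H t; exact (is_derive_continuous f t _ (H t)). Qed.

Lemma continuous_Cmod (f : R -> C) (t : R) :
  ccontinuous f t -> continuous (fun s => Cmod (f s)) t.
Proof.
intros H; apply (continuous_ext (fun s => norm (V := C_R_NormedModule) (f s))).
- intros s; symmetry; apply Cmod_norm.
- apply (continuous_comp f (norm (V := C_R_NormedModule)) t H).
  apply (filterlim_norm (V := C_R_NormedModule)).
Qed.

(** * Integrals of complex-valued functions of a real variable *)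

Definition is_CInt (f : R -> C) (a b : R) (l : C) : Prop :=
  is_RInt (V := C_R_NormedModule) f a b l.

Definition CInt (f : R -> C) (a b : R) : C := RInt (V := C_R_CompleteNormedModule) f a b.

Lemma is_CInt_parts (f : R -> C) (a b : R) (l : C) :
  is_CInt f a b l <->
  is_RInt (fun t => Re (f t)) a b (Re l) /\ is_RInt (fun t => Im (f t)) a b (Im l).
Proof.
split.
- intros H; split.
  + exact (is_RInt_fct_extend_fst (U := R_NormedModule) (V := R_NormedModule) f a b l H).
  + exact (is_RInt_fct_extend_snd (U := R_NormedModule) (V := R_NormedModule) f a b l H).
- intros [H1 H2]; destruct l as [x y].
  exact (is_RInt_fct_extend_pair f a b x y H1 H2).
Qed.

Lemma CInt_correct (f : R -> C) (a b : R) :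
  (forall t, Rmin a b <= t <= Rmax a b -> ccontinuous f t) ->
  is_CInt f a b (CInt f a b).
Proof.
intros H; apply (RInt_correct (V := C_R_CompleteNormedModule)).
now apply (ex_RInt_continuous (V := C_R_CompleteNormedModule)).
Qed.

Lemma is_CInt_unique (f : R -> C) (a b : R) (l : C) : is_CInt f a b l -> CInt f a b = l.
Proof. exact (is_RInt_unique (V := C_R_CompleteNormedModule) f a b l). Qed.

Lemma is_CInt_eq (f : R -> C) (a b : R) (l l' : C) : is_CInt f a b l -> l = l' -> is_CInt f a b l'.
Proof. now intros H <-. Qed.

Lemma is_CInt_det (f : R -> C) (a b : R) (l l' : C) : is_CInt f a b l -> is_CInt f a b l' -> l = l'.
Proof. intros H H'; rewrite <- (is_CInt_unique _ _ _ _ H); now apply is_CInt_unique. Qed.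

Lemma is_CInt_ext (f g : R -> C) (a b : R) (l : C) :
  (forall t, Rmin a b <= t <= Rmax a b -> f t = g t) -> is_CInt f a b l -> is_CInt g a b l.
Proof.
intros H; apply (is_RInt_ext (V := C_R_NormedModule)); intros t Ht; apply H; lra.
Qed.

Lemma is_CInt_change (f g : R -> C) (a b : R) (l l' : C) :
  is_CInt f a b l -> (forall t, Rmin a b <= t <= Rmax a b -> f t = g t) -> l = l' -> is_CInt g a b l'.
Proof. intros H E <-; exact (is_CInt_ext f g a b l E H). Qed.

Lemma is_CInt_plus (f g : R -> C) (a b : R) (l m : C) :
  is_CInt f a b l -> is_CInt g a b m -> is_CInt (fun t => f t + g t)%C a b (l + m)%C.
Proof. exact (is_RInt_plus (V := C_R_NormedModule) f g a b l m). Qed.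

Lemma is_CInt_minus (f g : R -> C) (a b : R) (l m : C) :
  is_CInt f a b l -> is_CInt g a b m -> is_CInt (fun t => f t - g t)%C a b (l - m)%C.
Proof. exact (is_RInt_minus (V := C_R_NormedModule) f g a b l m). Qed.

Lemma is_CInt_scal (c : C) (f : R -> C) (a b : R) (l : C) :
  is_CInt f a b l -> is_CInt (fun t => c * f t)%C a b (c * l)%C.
Proof.
rewrite !is_CInt_parts; intros [H1 H2]; split.
- exact (is_RInt_minus (V := R_NormedModule) _ _ _ _ _ _
    (is_RInt_scal _ _ _ (Re c) _ H1) (is_RInt_scal _ _ _ (Im c) _ H2)).
- exact (is_RInt_plus (V := R_NormedModule) _ _ _ _ _ _
    (is_RInt_scal _ _ _ (Re c) _ H2) (is_RInt_scal _ _ _ (Im c) _ H1)).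
Qed.

Lemma is_CInt_const (c : C) (a b : R) : is_CInt (fun _ => c) a b (RtoC (b - a) * c)%C.
Proof. unfold is_CInt; rewrite <- scal_R_Cmult; apply (is_RInt_const (V := C_R_NormedModule)). Qed.

Lemma is_CInt_derive (f df : R -> C) (a b : R) :
  (forall t, Rmin a b <= t <= Rmax a b -> is_derive f t (df t)) ->
  (forall t, Rmin a b <= t <= Rmax a b -> ccontinuous df t) ->
  is_CInt df a b (f b - f a)%C.
Proof. exact (is_RInt_derive (V := C_R_CompleteNormedModule) f df a b). Qed.

Lemma is_CInt_norm (f : R -> C) (g : R -> R) (a b : R) (l : C) (m : R) : a <= b ->
  (forall t, a <= t <= b -> Cmod (f t) <= g t) ->
  is_CInt f a b l -> is_RInt g a b m -> Cmod l <= m.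
Proof.
intros Hab H Hf Hg; rewrite Cmod_norm.
apply (norm_RInt_le (V := C_R_NormedModule) f g a b l m Hab); [|exact Hf|exact Hg].
intros t Ht; specialize (H t Ht); now rewrite Cmod_norm in H.
Qed.

Lemma is_CInt_norm_const (f : R -> C) (M a b : R) (l : C) : a <= b ->
  (forall t, a <= t <= b -> Cmod (f t) <= M) -> is_CInt f a b l -> Cmod l <= (b - a) * M.
Proof.
intros Hab H Hf; apply (is_CInt_norm f (fun _ => M) a b l _ Hab H Hf).
apply (is_RInt_const (V := R_NormedModule)).
Qed.

Lemma is_derive_CInt (f : R -> C) (a t : R) :
  (forall s, ccontinuous f s) -> is_derive (fun s => CInt f a s) t (f t).
Proof.
intros H; apply (is_derive_RInt (V := C_R_NormedModule) f (fun s => CInt f a s) a t); [|apply H].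
exists (mkposreal 1 Rlt_0_1); intros s _; apply CInt_correct; intros; apply H.
Qed.

Lemma is_derive_zero_const (f : R -> C) (a b : R) :
  (forall t, Rmin a b <= t <= Rmax a b -> is_derive f t (RtoC 0)) -> f a = f b.
Proof.
intros H; symmetry; apply Ceq_minus.
apply (is_CInt_det (fun _ => RtoC 0) a b).
- apply is_CInt_derive; [exact H|intros; apply continuous_Cconst].
- eapply is_CInt_eq; [apply is_CInt_const|ring].
Qed.

(** * The complex exponential *)

Definition cexp (z : C) : C := (exp (Re z) * cos (Im z), exp (Re z) * sin (Im z)).

Lemma cexp_plus (z w : C) : cexp (z + w) = (cexp z * cexp w)%C.
Proof.
destruct z as [a b], w as [c d]; unfold cexp; apply C_eq; simpl;
rewrite exp_plus; [rewrite cos_plus|rewrite sin_plus]; ring.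
Qed.

Lemma cexp_0 : cexp 0 = 1.
Proof. unfold cexp; apply C_eq; simpl; rewrite exp_0, ?cos_0, ?sin_0; ring. Qed.

Lemma cexp_opp_mult (z : C) : (cexp z * cexp (- z))%C = 1.
Proof. rewrite <- cexp_plus, <- cexp_0; f_equal; ring. Qed.

Lemma Cmod_cexp (z : C) : Cmod (cexp z) = exp (Re z).
Proof.
unfold Cmod, cexp; simpl.
replace (_ + _) with (Rsqr (exp (Re z)) * (Rsqr (sin (Im z)) + Rsqr (cos (Im z)))) by (unfold Rsqr; ring).
rewrite sin2_cos2, Rmult_1_r; apply sqrt_Rsqr, Rlt_le, exp_pos.
Qed.

Lemma is_derive_cexp (z w : C) (t : R) :
  is_derive (fun s : R => cexp (z * RtoC s + w)) t (z * cexp (z * RtoC t + w))%C.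
Proof.
apply is_derive_RC_parts; destruct z as [a b], w as [c d]; unfold cexp; simpl; split.
- auto_derive; [easy|].
  replace (a * t - b * 0 + c) with (a * t + - (b * 0) + c) by ring.
  replace (a * 0 + b * t + d) with (b * t + d) by ring. ring.
- auto_derive; [easy|].
  replace (a * t - b * 0 + c) with (a * t + - (b * 0) + c) by ring.
  replace (a * 0 + b * t + d) with (b * t + d) by ring. ring.
Qed.

(** * The Helmholtz equation with large wave number *)

Lemma exp_mono (a b : R) : a <= b -> exp a <= exp b.
Proof. intros [H| ->]; [left; now apply exp_increasing|right; reflexivity]. Qed.

Lemma Cmod_attains_max (f : R -> C) (a b : R) : a <= b ->
  (forall t, a <= t <= b -> ccontinuous f t) ->
  exists t0, a <= t0 <= b /\ forall t, a <= t <= b -> Cmod (f t) <= Cmod (f t0).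
Proof.
intros Hab H.
destruct (continuity_ab_maj (fun t => Cmod (f t)) a b Hab) as (t0 & H1 & H2).
- intros t Ht; apply continuity_pt_filterlim, (continuous_Cmod f t (H t Ht)).
- now exists t0.
Qed.

Lemma Cmod_bounded (f : R -> C) (a b : R) :
  (forall t, ccontinuous f t) ->
  exists M, 0 < M /\ forall t, Rmin a b <= t <= Rmax a b -> Cmod (f t) <= M.
Proof.
intros H; destruct (Cmod_attains_max f (Rmin a b) (Rmax a b)) as (t0 & _ & Ht0).
- apply Rminmax.
- intros; apply H.
- exists (Cmod (f t0) + 1); split; [pose proof (Cmod_ge_0 (f t0)); lra|].
  intros t Ht; specialize (Ht0 t Ht); lra.
Qed.

(* [kcos k t] is cos(kt) and [ksin k t] is sin(kt)/k; the latter is a junk value at k = 0. *)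
Definition kcos (k : C) (t : R) : C := ((cexp (Ci * k * t) + cexp (- (Ci * k * t))) / 2)%C.
Definition ksin (k : C) (t : R) : C := ((cexp (Ci * k * t) - cexp (- (Ci * k * t))) / (2 * Ci * k))%C.

Lemma Ci_sqr : (Ci * Ci = - 1)%C.
Proof. apply C_eq; simpl; ring. Qed.

Lemma is_derive_cexp_lin (z : C) (t : R) :
  is_derive (fun s : R => cexp (z * s)) t (z * cexp (z * t))%C.
Proof.
apply (is_derive_Cext (fun s : R => cexp (z * s + 0))).
- intros s; f_equal; ring.
- eapply is_derive_Ceq; [apply is_derive_cexp|].
  do 2 f_equal; ring.
Qed.

Lemma is_derive_kcos (k : C) (t : R) : k <> 0 ->
  is_derive (kcos k) t (- (k * k) * ksin k t)%C.
Proof.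
intros Hk; unfold kcos, ksin.
apply (is_derive_Cext (fun s : R => (/ 2 * (cexp ((Ci * k) * s) + cexp ((- (Ci * k)) * s)))%C)).
- intros s; replace (- (Ci * k) * s)%C with (- (Ci * k * s))%C by ring.
  simpl; field; apply C2_nz.
- eapply is_derive_Ceq.
  + apply is_derive_Cscal, is_derive_Cplus; apply is_derive_cexp_lin.
  + replace (- (Ci * k) * t)%C with (- (Ci * k * t))%C by ring.
    replace (- (k * k))%C with ((Ci * Ci) * (k * k))%C by (rewrite Ci_sqr; ring).
    field; auto.
Qed.

Lemma is_derive_ksin (k : C) (t : R) : k <> 0 -> is_derive (ksin k) t (kcos k t).
Proof.
intros Hk; unfold kcos, ksin.
apply (is_derive_Cext (fun s : R => (/ (2 * Ci * k) * (cexp ((Ci * k) * s) - cexp ((- (Ci * k)) * s)))%C)).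
- intros s; replace (- (Ci * k) * s)%C with (- (Ci * k * s))%C by ring.
  simpl; field; auto.
- eapply is_derive_Ceq.
  + apply is_derive_Cscal, is_derive_Cminus; apply is_derive_cexp_lin.
  + replace (- (Ci * k) * t)%C with (- (Ci * k * t))%C by ring.
    field; auto.
Qed.

Lemma kcos_0 (k : C) : kcos k 0 = 1.
Proof.
unfold kcos; replace (- (Ci * k * 0))%C with (RtoC 0) by ring.
replace (Ci * k * 0)%C with (RtoC 0) by ring; rewrite cexp_0; field; apply C2_nz.
Qed.

Lemma ksin_0 (k : C) : k <> 0 -> ksin k 0 = 0.
Proof.
intros Hk; unfold ksin; replace (- (Ci * k * 0))%C with (RtoC 0) by ring.
replace (Ci * k * 0)%C with (RtoC 0) by ring; field; auto.
Qed.

Lemma Cmod_cexp_ik (k : C) (t : R) : 0 <= Im k ->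
  Cmod (cexp (Ci * k * t)) <= exp (Im k * Rabs t) /\
  Cmod (cexp (- (Ci * k * t))) <= exp (Im k * Rabs t).
Proof.
intros Hk; rewrite !Cmod_cexp.
replace (Re (Ci * k * t)) with (- (Im k * t)) by (destruct k; simpl; ring).
replace (Re (- (Ci * k * t))) with (Im k * t) by (destruct k; simpl; ring).
pose proof (Rle_abs t); pose proof (Rle_abs (- t)) as H1; rewrite Rabs_Ropp in H1.
split; apply exp_mono; nra.
Qed.

Lemma Cmod_kcos (k : C) (t : R) : 0 <= Im k -> Cmod (kcos k t) <= exp (Im k * Rabs t).
Proof.
intros Hk; destruct (Cmod_cexp_ik k t Hk) as [H1 H2].
unfold kcos; rewrite Cmod_div, Cmod_R, Rabs_pos_eq by (apply C2_nz || lra).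
apply (Rmult_le_reg_r 2); [lra|]; field_simplify.
apply Cmod_plus_bound; lra.
Qed.

Lemma Cmod_ksin (k : C) (t : R) : 0 <= Im k -> k <> 0 ->
  Cmod (ksin k t) <= exp (Im k * Rabs t) / Cmod k.
Proof.
intros Hk Hk0; destruct (Cmod_cexp_ik k t Hk) as [H1 H2].
assert (Hp : 0 < Cmod k) by now apply Cmod_gt_0.
unfold ksin; rewrite Cmod_div by (repeat apply Cmult_neq_0; auto).
rewrite !Cmod_mult, Cmod_Ci, Cmod_R, Rabs_pos_eq by lra.
replace (2 * 1 * Cmod k) with (2 * Cmod k) by ring.
apply (Rmult_le_reg_r (2 * Cmod k)); [lra|].
replace (Cmod (cexp (Ci * k * t) - cexp (- (Ci * k * t))) / (2 * Cmod k) * (2 * Cmod k))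
 with (Cmod (cexp (Ci * k * t) - cexp (- (Ci * k * t)))) by (field; lra).
replace (exp (Im k * Rabs t) / Cmod k * (2 * Cmod k)) with (2 * exp (Im k * Rabs t)) by (field; lra).
apply Cmod_minus_bound; lra.
Qed.

(** Product-to-sum formula. The first summand does not depend on [b] and is removed by the zero mean
    of V'; the second oscillates in [b] and is left to the Riemann-Lebesgue lemma. *)
Lemma kcos_ksin_product (k : C) (a b : R) : k <> 0 ->
  (kcos k (a - b) * ksin k b = (ksin k a + ksin k (2 * b - a)) / 2)%C.
Proof.
intros Hk; unfold kcos, ksin.
rewrite !RtoC_minus, RtoC_mult.
replace (Ci * k * (a - b))%C with (Ci * k * a + - (Ci * k * b))%C by ring.
replace (- (Ci * k * a + - (Ci * k * b)))%C with (- (Ci * k * a) + Ci * k * b)%C by ring.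
replace (Ci * k * (2 * b - a))%C with (- (Ci * k * a) + (Ci * k * b + Ci * k * b))%C by ring.
replace (- (- (Ci * k * a) + (Ci * k * b + Ci * k * b)))%C with (Ci * k * a + (- (Ci * k * b) + - (Ci * k * b)))%C by ring.
rewrite !cexp_plus.
pose proof (cexp_opp_mult (Ci * k * b)) as Hb.
set (A := cexp (Ci * k * a)); set (A' := cexp (- (Ci * k * a))).
set (B := cexp (Ci * k * b)) in *; set (B' := cexp (- (Ci * k * b))) in *.
transitivity (((A - A') * (B * B') + (A' * (B * B) - A * (B' * B'))) / (2 * (2 * Ci * k)))%C.
- field; auto.
- rewrite Hb; field; auto.
Qed.

Lemma is_derive_reflect (f : R -> C) (t s : R) (l : C) :
  is_derive f (t - s) l -> is_derive (fun r => f (t - r)) s (- l)%C.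
Proof.
intros H; apply (is_derive_Cext (fun r => f (-1 * r + t))).
- intros r; f_equal; ring.
- eapply is_derive_Ceq; [apply is_derive_Ccomp_affine|].
  + replace (-1 * s + t) with (t - s) by ring; exact H.
  + apply C_eq; simpl; ring.
Qed.

(** Continuing the data of [y] at [s] freely up to time [t] gives y(s) kcos(t - s) + y1(s) ksin(t -
    s). Its derivative in [s] is [F] times the kernel, because the free parts cancel. The second
    formula treats the velocity of the continued solution in the same way. *)
Lemma duhamel (k : C) (y y1 F : R -> C) (t : R) : k <> 0 ->
  (forall s, is_derive y s (y1 s)) ->
  (forall s, is_derive y1 s (F s - k * k * y s)%C) ->
  (forall s, ccontinuous F s) ->
  is_CInt (fun s => ksin k (t - s) * F s)%C 0 t (y t - y 0%R * kcos k t - y1 0%R * ksin k t)%C /\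
  is_CInt (fun s => kcos k (t - s) * F s)%C 0 t (y1 t + k * k * y 0%R * ksin k t - y1 0%R * kcos k t)%C.
Proof.
intros Hk Hy Hy1 HF.
assert (Hkc : forall s, is_derive (fun r => kcos k (t - r)) s (k * k * ksin k (t - s))%C).
{ intros s; eapply is_derive_Ceq; [apply is_derive_reflect, is_derive_kcos, Hk|ring]. }
assert (Hks : forall s, is_derive (fun r => ksin k (t - r)) s (- kcos k (t - s))%C).
{ intros s; eapply is_derive_Ceq; [apply is_derive_reflect, is_derive_ksin, Hk|ring]. }
assert (Ckc : forall s, ccontinuous (fun r => kcos k (t - r)) s)
 by exact (is_derive_all_continuous _ _ Hkc).
assert (Cks : forall s, ccontinuous (fun r => ksin k (t - r)) s)
 by exact (is_derive_all_continuous _ _ Hks).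
split.
- eapply is_CInt_eq.
  + apply (is_CInt_derive (fun s => y s * kcos k (t - s) + y1 s * ksin k (t - s))%C).
    * intros s _; eapply is_derive_Ceq.
      { apply is_derive_Cplus; apply is_derive_Cmult; eauto. }
      cbv beta; ring.
    * intros s _; apply continuous_Cmult; auto.
  + simpl; replace (t - t) with 0 by ring; replace (t - 0) with t by ring.
    rewrite kcos_0, ksin_0 by exact Hk; ring.
- eapply is_CInt_eq.
  + apply (is_CInt_derive (fun s => y1 s * kcos k (t - s) - k * k * y s * ksin k (t - s))%C).
    * intros s _; eapply is_derive_Ceq.
      { apply is_derive_Cminus; apply is_derive_Cmult; eauto; apply is_derive_Cscal; eauto. }
      cbv beta; ring.
    * intros s _; apply continuous_Cmult; auto.
  + simpl; replace (t - t) with 0 by ring; replace (t - 0) with t by ring.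
    rewrite kcos_0, ksin_0 by exact Hk; ring.
Qed.

(** For s between 0 and t the growth of the kernel over t - s and that of the solution up to s
    multiply to exactly exp(kap t), so Duhamel integrals reproduce the exponential weight. *)
Lemma kernel_exp_bound (kap a b t s : R) (u v : C) : 0 <= s <= t -> 
  Cmod u <= exp (kap * Rabs (t - s)) * a -> Cmod v <= b * exp (kap * s) ->
  Cmod (u * v) <= exp (kap * t) * (a * b).
Proof.
intros Hs Hu Hv; rewrite Cmod_mult.
replace (exp (kap * t)) with (exp (kap * Rabs (t - s)) * exp (kap * s)).
- replace (_ * _ * (a * b)) with (exp (kap * Rabs (t - s)) * a * (b * exp (kap * s))) by ring.
  apply Rmult_le_compat; auto.
- rewrite <- exp_plus; f_equal; rewrite Rabs_pos_eq by lra; ring.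
Qed.

(* The weighted maximum of |y| absorbs half of itself once |k| is large, so no Gronwall inequality is needed. *)
Lemma helmholtz_bound (k : C) (y y1 W r : R -> C) (T B rho : R) :
  0 <= Im k -> 0 < Cmod k -> 2 * T * B <= Cmod k -> 0 < T -> 0 < B -> 0 <= rho ->
  (forall s, is_derive y s (y1 s)) ->
  (forall s, is_derive y1 s ((W s - k * k) * y s + r s)%C) ->
  (forall s, ccontinuous W s) ->
  (forall s, ccontinuous r s) ->
  (forall s, 0 <= s <= T -> Cmod (W s) <= B) ->
  (forall s, 0 <= s <= T -> Cmod (r s) <= rho * exp (Im k * s)) ->
  forall t, 0 <= t <= T ->
  Cmod (y t) <= 2 * (Cmod (y 0%R) + Cmod (y1 0%R) / Cmod k + T * rho / Cmod k) * exp (Im k * t).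
Proof.
intros Hk Hk0 HkB HT HB Hrho Hy Hy1 CW Cr HW Hr.
assert (Hkn : k <> 0) by now apply Cmod_gt_0.
pose proof (is_derive_all_continuous y _ Hy) as Cy.
set (A := Cmod (y 0%R) + Cmod (y1 0%R) / Cmod k).
assert (Cg : forall s, ccontinuous (fun s => cexp (RtoC (- Im k) * RtoC s) * y s)%C s).
{ intros s; apply continuous_Cmult; [|apply Cy].
  eapply is_derive_continuous; apply is_derive_cexp_lin. }
assert (Hg : forall s, Cmod (cexp (RtoC (- Im k) * RtoC s) * y s) = exp (- (Im k * s)) * Cmod (y s)).
{ intros s; rewrite Cmod_mult, Cmod_cexp; do 2 f_equal; simpl; ring. }
destruct (Cmod_attains_max _ 0 T (Rlt_le _ _ HT) (fun s _ => Cg s)) as (t0 & Ht0 & Hmax).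
set (M := exp (- (Im k * t0)) * Cmod (y t0)).
assert (HyM : forall s, 0 <= s <= T -> Cmod (y s) <= M * exp (Im k * s)).
{ intros s Hs; specialize (Hmax s Hs); rewrite !Hg in Hmax; fold M in Hmax.
  replace (Cmod (y s)) with (exp (- (Im k * s)) * Cmod (y s) * exp (Im k * s)).
  - apply Rmult_le_compat_r; [apply Rlt_le, exp_pos|exact Hmax].
  - transitivity (exp (- (Im k * s) + Im k * s) * Cmod (y s)); [rewrite exp_plus; ring|].
    rewrite Rplus_opp_l, exp_0; ring. }
assert (HM0 : 0 <= M) by (apply Rmult_le_pos; [apply Rlt_le, exp_pos|apply Cmod_ge_0]).
assert (HM : M <= 2 * (A + T * rho / Cmod k)).
{ destruct (duhamel k y y1 (fun s => W s * y s + r s)%C t0 Hkn Hy) as [HD _].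
  - intros s; eapply is_derive_Ceq; [apply Hy1|ring].
  - intros s; apply continuous_Cplus; [apply continuous_Cmult|]; auto.
  - apply is_CInt_norm_const with (M := exp (Im k * t0) * (/ Cmod k * (B * M + rho))) in HD; [|lra|].
    + set (D := (y t0 - y 0%R * kcos k t0 - y1 0%R * ksin k t0)%C) in HD.
      assert (Hyt : Cmod (y t0) <= exp (Im k * t0) * (A + T * (/ Cmod k * (B * M + rho)))).
      { replace (y t0) with (D + (y 0%R * kcos k t0 + y1 0%R * ksin k t0))%C by (unfold D; ring).
        apply Cmod_plus_bound.
        assert (H1 : Cmod (y 0%R * kcos k t0 + y1 0%R * ksin k t0) <= exp (Im k * t0) * A).
        { apply Cmod_plus_bound; rewrite !Cmod_mult.
          pose proof (Cmod_kcos k t0 Hk) as Hc; pose proof (Cmod_ksin k t0 Hk Hkn) as Hs.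
          rewrite Rabs_pos_eq in Hc, Hs by lra.
          pose proof (Cmod_ge_0 (y 0%R)) as Hy0; pose proof (Cmod_ge_0 (y1 0%R)) as Hy10.
          apply (Rmult_le_compat_l _ _ _ Hy0) in Hc.
          apply (Rmult_le_compat_l _ _ _ Hy10) in Hs.
          unfold A; unfold Rdiv in *; lra. }
        assert (H2 : Cmod D <= exp (Im k * t0) * (T * (/ Cmod k * (B * M + rho)))).
        { eapply Rle_trans; [exact HD|].
          rewrite Rminus_0_r.
          replace (exp (Im k * t0) * (T * (/ Cmod k * (B * M + rho)))) with (T * (exp (Im k * t0) * (/ Cmod k * (B * M + rho)))) by ring.
          apply Rmult_le_compat_r; [|lra].
          apply Rmult_le_pos; [apply Rlt_le, exp_pos|].
          apply Rmult_le_pos; [apply Rlt_le, Rinv_0_lt_compat, Hk0|nra]. }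
        lra. }
      assert (HMle : M <= A + T * (/ Cmod k * (B * M + rho))).
      { unfold M at 1; apply (Rmult_le_reg_l (exp (Im k * t0))); [apply exp_pos|].
        rewrite <- Rmult_assoc, <- exp_plus, Rplus_opp_r, exp_0, Rmult_1_l; exact Hyt. }
      assert (Hhalf : T * (/ Cmod k * (B * M)) <= M / 2).
      { replace (T * (/ Cmod k * (B * M))) with ((2 * T * B) * (M / 2 * / Cmod k)) by (field; lra).
        replace (M / 2) with (Cmod k * (M / 2 * / Cmod k)) at 2 by (field; lra).
        apply Rmult_le_compat_r; [|exact HkB].
        apply Rmult_le_pos; [lra|apply Rlt_le, Rinv_0_lt_compat, Hk0]. }
      unfold Rdiv at 1; lra.
    + intros s Hs; apply (kernel_exp_bound _ _ _ _ s); [lra| |].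
      * apply Cmod_ksin; assumption.
      * apply Cmod_plus_bound; rewrite Cmod_mult.
        assert (Hs' : 0 <= s <= T) by lra.
        specialize (HyM s Hs'); specialize (HW s Hs'); specialize (Hr s Hs').
        pose proof (Cmod_ge_0 (y s)); pose proof (Cmod_ge_0 (W s)); pose proof (exp_pos (Im k * s)).
        assert (HWy : Cmod (W s) * Cmod (y s) <= B * (M * exp (Im k * s))).
        { apply Rmult_le_compat; assumption. }
        lra. }
intros t Ht; eapply Rle_trans; [apply HyM, Ht|].
apply Rmult_le_compat_r; [apply Rlt_le, exp_pos|exact HM].
Qed.

(* Replacing V' by difference quotients of V gives a C^1 approximation, to which integration by parts applies. *)
Lemma uniform_difference_quotient (W q : R -> C) (T eps : R) : 0 < T -> 0 < eps ->
  (forall t, is_derive W t (q t)) -> (forall t, ccontinuous q t) ->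
  exists h, 0 < h /\ forall t, 0 <= t <= T -> Cmod ((W (t + h)%R - W t) / h - q t) <= eps.
Proof.
intros HT He HW Hq.
assert (He2 : 0 < eps / 2) by lra.
assert (Hc : forall t, continuity_pt (fun t => Re (q t)) t /\ continuity_pt (fun t => Im (q t)) t).
{ intros t; destruct (proj1 (continuous_RC_parts q t) (Hq t)) as [H1 H2].
  split; apply continuity_pt_filterlim; assumption. }
(* Uniform continuity is taken up to [T + 1] because the quotient at [t] involves points up to
   [t + h] with [h <= 1]. *)
destruct (Heine_cor2 (a := 0) (b := T + 1) (fun t _ => proj1 (Hc t)) (mkposreal _ He2)) as [d1 Hd1].
destruct (Heine_cor2 (a := 0) (b := T + 1) (fun t _ => proj2 (Hc t)) (mkposreal _ He2)) as [d2 Hd2].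
set (h := Rmin 1 (Rmin (d1 / 2) (d2 / 2))).
pose proof (cond_pos d1); pose proof (cond_pos d2).
assert (Hh : 0 < h) by (unfold h; repeat apply Rmin_pos; lra).
assert (Hh1 : h <= 1) by apply Rmin_l.
assert (Hhd1 : h <= d1 / 2) by (eapply Rle_trans; [apply Rmin_r|apply Rmin_l]).
assert (Hhd2 : h <= d2 / 2) by (eapply Rle_trans; [apply Rmin_r|apply Rmin_r]).
exists h; split; [exact Hh|]; intros t Ht.
assert (HI : is_CInt (fun s => q s - q t)%C t (t + h) (W (t + h)%R - W t - RtoC (t + h - t) * q t)%C).
{ apply is_CInt_minus; [|apply is_CInt_const].
  apply is_CInt_derive; intros; [apply HW|apply Hq]. }
apply is_CInt_norm_const with (M := eps) in HI; [|lra|].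
- assert (Hh0 : RtoC h <> 0) by (apply RtoC_nz; lra).
  replace ((W (t + h)%R - W t) / h - q t)%C with ((W (t + h)%R - W t - RtoC (t + h - t) * q t) / h)%C
   by (replace (t + h - t) with h by ring; field; exact Hh0).
  rewrite Cmod_div, Cmod_R, Rabs_pos_eq by (exact Hh0 || lra).
  apply (Rmult_le_reg_r h); [exact Hh|].
  replace (Cmod (W (t + h)%R - W t - RtoC (t + h - t) * q t) / h * h)
   with (Cmod (W (t + h)%R - W t - RtoC (t + h - t) * q t)) by (field; lra); lra.
- intros s Hs; eapply Rle_trans; [apply Cmod_le_abs|].
  assert (Hst : Rabs (s - t) < Rmin d1 d2).
  { rewrite Rabs_pos_eq by lra; apply Rmin_glb_lt; lra. }
  assert (Ha := Hd1 s t ltac:(lra) ltac:(lra) (Rlt_le_trans _ _ _ Hst (Rmin_l _ _))).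
  assert (Hb := Hd2 s t ltac:(lra) ltac:(lra) (Rlt_le_trans _ _ _ Hst (Rmin_r _ _))).
  simpl in Ha, Hb; unfold Re, Im in *; simpl; unfold Rminus in *; lra.
Qed.

(** The size of the kernel alone gives exp(Im k T)/|k|; the point is the small factor [eps]. Half of
    it pays for replacing [q] by a difference quotient [g] of [W]; the integral against the C^1
    function [g] gains a further 1/|k| by parts. *)
Lemma riemann_lebesgue_ksin (W q : R -> C) (T eps : R) : 0 < T -> 0 < eps ->
  (forall t, is_derive W t (q t)) -> (forall t, ccontinuous q t) ->
  exists K, 0 < K /\ forall k l, 0 <= Im k -> K <= Cmod k ->
    is_CInt (fun t => q t * ksin k (2 * t - T))%C 0 T l ->
    Cmod l <= eps * exp (Im k * T) / Cmod k.
Proof.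
intros HT He HW Hq.
pose proof (is_derive_all_continuous W _ HW) as CW.
destruct (uniform_difference_quotient W q T (eps / (2 * T)) HT) as (h & Hh & Hhq); auto.
{ apply Rdiv_lt_0_compat; lra. }
assert (Hh0 : RtoC h <> 0) by (apply RtoC_nz; lra).
set (g := fun t => ((W (t + h)%R - W t) / h)%C).
set (g' := fun t => ((q (t + h)%R - q t) / h)%C).
assert (Hg : forall t, is_derive g t (g' t)).
{ intros t; apply (is_derive_Cext (fun s => / h * (W (s + h)%R - W s))%C).
  - intros s; unfold g; field; exact Hh0.
  - eapply is_derive_Ceq.
    + apply is_derive_Cscal, is_derive_Cminus; [apply is_derive_translate|]; apply HW.
    + unfold g'; field; exact Hh0. }
assert (Cqh : forall t, ccontinuous (fun s => q (s + h)) t).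
{ intros t; apply (continuous_comp (fun s : R => s + h) q); [|apply Hq].
  apply (continuous_plus (V := R_NormedModule)); [apply continuous_id|apply continuous_const]. }
assert (Cg' : forall t, ccontinuous g' t).
{ intros t; apply (continuous_Cmult (fun s => q (s + h)%R - q s)%C (fun _ => / h)%C).
  - now apply continuous_Cminus.
  - apply continuous_Cconst. }
pose proof (is_derive_all_continuous g _ Hg) as Cg.
destruct (Cmod_bounded g 0 T Cg) as (G & HG & HGb).
destruct (Cmod_bounded g' 0 T Cg') as (G' & HG' & HGb').
rewrite Rmin_left, Rmax_right in HGb, HGb' by lra.
(* The summands account for the boundary terms at [T] and at 0 and for the integral containing
   [g']. *)
set (A := G + G * 1 + T * G').
assert (HA : 0 < A) by (unfold A; nra).
exists (2 * A / eps); split; [apply Rdiv_lt_0_compat; lra|].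
intros k l Hk HkK Hl.
assert (HK0 : 0 < Cmod k) by (eapply Rlt_le_trans; [|exact HkK]; apply Rdiv_lt_0_compat; lra).
assert (Hk0 : k <> 0) by now apply Cmod_gt_0.
set (E := exp (Im k * T)); assert (HE : 0 < E) by apply exp_pos.
assert (Habs : forall t, 0 <= t <= T -> exp (Im k * Rabs (2 * t - T)) <= E).
{ intros t Ht; apply exp_mono, Rmult_le_compat_l; [exact Hk|]; apply Rabs_le; lra. }
assert (Hks : forall t, 0 <= t <= T -> Cmod (ksin k (2 * t - T)) <= E / Cmod k).
{ intros t Ht; eapply Rle_trans; [now apply Cmod_ksin|].
  apply Rmult_le_compat_r; [apply Rlt_le, Rinv_0_lt_compat, HK0|now apply Habs]. }
assert (Hkc : forall t, 0 <= t <= T -> Cmod (kcos k (2 * t - T)) <= E).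
{ intros t Ht; eapply Rle_trans; [now apply Cmod_kcos|now apply Habs]. }
assert (Dkc : forall t, is_derive (fun s => kcos k (2 * s - T)) t (2 * (- (k * k) * ksin k (2 * t - T)))%C).
{ intros t; apply (is_derive_Ccomp_affine (kcos k) 2 (- T) t), is_derive_kcos, Hk0. }
assert (Dks : forall t, is_derive (fun s => ksin k (2 * s - T)) t (2 * kcos k (2 * t - T))%C).
{ intros t; apply (is_derive_Ccomp_affine (ksin k) 2 (- T) t), is_derive_ksin, Hk0. }
assert (Cks : forall t, ccontinuous (fun s => ksin k (2 * s - T)) t)
 by exact (is_derive_all_continuous _ _ Dks).
assert (Ckc : forall t, ccontinuous (fun s => kcos k (2 * s - T)) t)
 by exact (is_derive_all_continuous _ _ Dkc).
(* Since kcos(2t - T) has derivative -2 k^2 ksin(2t - T), this is the boundary term of the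
   integration by parts. *)
set (P := fun t => (- / (2 * (k * k)) * (g t * kcos k (2 * t - T)))%C).
assert (HP : is_CInt (fun t => g t * ksin k (2 * t - T) + - / (2 * (k * k)) * (g' t * kcos k (2 * t - T)))%C 0 T (P T - P 0%R)%C).
{ apply is_CInt_derive.
  - intros t _; unfold P; eapply is_derive_Ceq.
    + apply is_derive_Cscal, is_derive_Cmult; [apply Hg|apply Dkc].
    + cbv beta; field; auto.
  - intros t _; apply continuous_Cplus; [|apply continuous_Cmult; [apply continuous_Cconst|]];
    apply continuous_Cmult; auto. }
assert (HJ := CInt_correct (fun t => - / (2 * (k * k)) * (g' t * kcos k (2 * t - T)))%C 0 T
  ltac:(intros t _; apply continuous_Cmult; [apply continuous_Cconst|apply continuous_Cmult; auto])).
set (J := CInt _ 0 T) in HJ.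
assert (HD : is_CInt (fun t => (g t - q t) * ksin k (2 * t - T))%C 0 T (P T - P 0%R - J - l)%C).
{ eapply is_CInt_ext; [|apply (is_CInt_minus _ _ _ _ _ _ (is_CInt_minus _ _ _ _ _ _ HP HJ) Hl)].
  intros t _; simpl; ring. }
assert (Hk2 : Cmod (- / (2 * (k * k))) = / (2 * (Cmod k * Cmod k))).
{ rewrite Cmod_opp, Cmod_inv, !Cmod_mult, Cmod_R, Rabs_pos_eq by
   (lra || (repeat apply Cmult_neq_0; auto)); reflexivity. }
set (b := / (2 * (Cmod k * Cmod k))) in *.
assert (Hb : 0 < b) by (apply Rinv_0_lt_compat; nra).
assert (HPb : forall t, 0 <= t <= T -> Cmod (P t) <= b * (G * E)).
{ intros t Ht; unfold P; rewrite Cmod_mult, Hk2; apply Rmult_le_compat_l; [lra|].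
  rewrite Cmod_mult; apply Rmult_le_compat; auto. }
apply is_CInt_norm_const with (M := b * (G' * E)) in HJ; [|lra|].
2: { intros t Ht; rewrite Cmod_mult, Hk2; apply Rmult_le_compat_l; [lra|].
     rewrite Cmod_mult; apply Rmult_le_compat; auto. }
apply is_CInt_norm_const with (M := eps / (2 * T) * (E / Cmod k)) in HD; [|lra|].
2: { intros t Ht; rewrite Cmod_mult; apply Rmult_le_compat; try apply Cmod_ge_0; [now apply Hhq|now apply Hks]. }
replace l with (P T - P 0%R - J - (P T - P 0%R - J - l))%C by ring.
apply Cmod_minus_bound.
assert (H1 : Cmod (P T - P 0%R - J) <= b * E * (2 * A)).
{ apply Cmod_minus_bound.
  eapply Rle_trans; [apply Rplus_le_compat_r, Cmod_minus_le|].
  pose proof (HPb T ltac:(lra)); pose proof (HPb 0 ltac:(lra)).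
  assert (0 <= b * E * (T * G')) by (repeat apply Rmult_le_pos; lra).
  assert (0 <= b * E * G) by (repeat apply Rmult_le_pos; lra).
  unfold A; rewrite Rminus_0_r in HJ; nra. }
assert (H2 : (T - 0) * (eps / (2 * T) * (E / Cmod k)) = eps / 2 * E / Cmod k) by (field; lra).
assert (H3 : b * E * (2 * A) <= eps / 2 * E / Cmod k).
{ replace (b * E * (2 * A)) with (E / Cmod k * (2 * A / eps * (eps / (2 * Cmod k)))) by (unfold b; field; lra).
  replace (eps / 2 * E / Cmod k) with (E / Cmod k * (Cmod k * (eps / (2 * Cmod k)))) by (field; lra).
  apply Rmult_le_compat_l; [apply Rlt_le, Rdiv_lt_0_compat; assumption|].
  apply Rmult_le_compat_r; [apply Rlt_le, Rdiv_lt_0_compat; lra|exact HkK]. }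
unfold Rdiv in *; lra.
Qed.

(* All bounds come from z = c - s1, which solves z'' = (W - k^2) z - q s with z(0) = z'(0) = 0. *)
Lemma hill_asymptotics (W q : R -> C) :
  (forall t, is_derive W t (q t)) -> (forall t, ccontinuous q t) ->
  W PI = W 0 ->
  exists B, 1 <= B /\
  (forall k c c1 s s1, 0 <= Im k -> B <= Cmod k ->
    is_ivp_sol W (k * k) 0 1 0 (c, c1) -> is_ivp_sol W (k * k) 0 0 1 (s, s1) ->
    Cmod (s PI - ksin k PI) <= B * exp (Im k * PI) / (Cmod k * Cmod k) /\
    Cmod (c PI - s1 PI) <= B * exp (Im k * PI) / (Cmod k * Cmod k)) /\
  forall eps, 0 < eps -> exists K, B <= K /\ forall k c c1 s s1, 0 <= Im k -> K <= Cmod k ->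
    is_ivp_sol W (k * k) 0 1 0 (c, c1) -> is_ivp_sol W (k * k) 0 0 1 (s, s1) ->
    Cmod (c1 PI + (k * k - W 0%R) * s PI) <= eps * exp (Im k * PI) / Cmod k.
Proof.
intros HW Hq Hper.
pose proof PI_RGT_0 as HPI.
pose proof (is_derive_all_continuous W _ HW) as CW.
destruct (Cmod_bounded W 0 PI CW) as (M & HM & HMb).
destruct (Cmod_bounded q 0 PI Hq) as (Q & HQ & HQb).
rewrite Rmin_left, Rmax_right in HMb, HQb by lra.
(* The 1 keeps k away from 0; 2 pi M is both the threshold of [helmholtz_bound] on [0, pi] and the
   constant for s - ksin; 4 pi Q is the constant for c - s1. *)
set (B := 1 + 2 * PI * M + 4 * PI * Q).
assert (HB : 1 <= B) by (unfold B; nra).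
assert (Hgen : forall k c c1 s s1, 0 <= Im k -> B <= Cmod k ->
    is_ivp_sol W (k * k) 0 1 0 (c, c1) -> is_ivp_sol W (k * k) 0 0 1 (s, s1) ->
    (forall t, 0 <= t <= PI -> Cmod (s t - ksin k t) <= 2 * PI * M / (Cmod k * Cmod k) * exp (Im k * t)) /\
    (forall t, 0 <= t <= PI -> Cmod (c t - s1 t) <= 4 * PI * Q / (Cmod k * Cmod k) * exp (Im k * t))).
{ intros k c c1 s s1 Hk HkB (Hc & Hc1 & Hc0 & Hc10) (Hs & Hs1 & Hs0 & Hs10); simpl in *.
  assert (HK : 0 < Cmod k) by lra.
  assert (Hk0 : k <> 0) by now apply Cmod_gt_0.
  pose proof (is_derive_all_continuous s _ Hs) as Cs.
  assert (HBM : 2 * PI * M <= Cmod k) by (unfold B in HkB; nra).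
  assert (Hsb : forall t, 0 <= t <= PI -> Cmod (s t) <= 2 / Cmod k * exp (Im k * t)).
  { intros t Ht; eapply Rle_trans.
    - apply (helmholtz_bound k s s1 W (fun _ => RtoC 0) PI M 0); try lra; auto.
      + intros r; eapply is_derive_Ceq; [apply Hs1|ring].
      + intros r; apply continuous_Cconst.
      + intros r _; rewrite Cmod_0; lra.
    - rewrite Hs0, Hs10, Cmod_0, Cmod_1; right; field; lra. }
  split; intros t Ht.
  - destruct (duhamel k s s1 (fun r => W r * s r)%C t Hk0 Hs) as [HD _].
    + intros r; eapply is_derive_Ceq; [apply Hs1|ring].
    + intros r; apply continuous_Cmult; auto.
    + rewrite Hs0, Hs10 in HD.
      apply is_CInt_norm_const with (M := exp (Im k * t) * (/ Cmod k * (M * (2 / Cmod k)))) in HD; [|lra|].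
      * replace (s t - ksin k t)%C with (s t - 0 * kcos k t - 1 * ksin k t)%C by ring.
        eapply Rle_trans; [exact HD|].
        replace (2 * PI * M / (Cmod k * Cmod k) * exp (Im k * t)) with
         ((PI - 0) * (exp (Im k * t) * (/ Cmod k * (M * (2 / Cmod k))))) by (field; lra).
        apply Rmult_le_compat_r; [|lra].
        pose proof (exp_pos (Im k * t)); pose proof (Rinv_0_lt_compat _ HK).
        unfold Rdiv; repeat apply Rmult_le_pos; lra.
      * intros r Hr; apply (kernel_exp_bound _ _ _ _ r); [lra|now apply Cmod_ksin|].
        rewrite Cmod_mult, Rmult_assoc.
        apply Rmult_le_compat; try apply Cmod_ge_0; [apply HMb|apply Hsb]; lra.
  - eapply Rle_trans.
    (* The source -q s is bounded through the crude estimate |s| <= 2 exp(Im k t)/|k|, which gives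
       rho = 2Q/|k| and hence the second power of 1/|k|. *)
    + apply (helmholtz_bound k (fun t => c t - s1 t)%C (fun t => c1 t - (W t - k * k) * s t)%C W
        (fun t => - q t * s t)%C PI M (Q * (2 / Cmod k))); try lra; auto.
      * apply Rmult_le_pos; [lra|]; apply Rlt_le, Rdiv_lt_0_compat; lra.
      * intros r; eapply is_derive_Ceq; [apply is_derive_Cminus; auto|reflexivity].
      * intros r; eapply is_derive_Ceq.
        { apply is_derive_Cminus; [apply Hc1|].
          apply is_derive_Cmult; [|apply Hs].
          apply is_derive_Cminus; [apply HW|apply is_derive_Cconst]. }
        cbv beta; ring.
      * intros r; apply continuous_Cmult; [apply continuous_Copp|]; auto.
      * intros r Hr; rewrite Cmod_mult, Cmod_opp, Rmult_assoc.
        apply Rmult_le_compat; try apply Cmod_ge_0; auto.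
    + simpl; rewrite Hc0, Hs0, Hc10, Hs10.
      replace (1 - 1)%C with (RtoC 0) by ring.
      replace (0 - (W 0%R - k * k) * 0)%C with (RtoC 0) by ring.
      rewrite Cmod_0; right; field; lra. }
exists B; split; [exact HB|]; split.
- intros k c c1 s s1 Hk HkB Hc Hs.
  destruct (Hgen k c c1 s s1 Hk HkB Hc Hs) as [H1 H2].
  assert (HKK : 0 < Cmod k * Cmod k) by nra.
  pose proof (exp_pos (Im k * PI)) as HE.
  specialize (H1 PI ltac:(lra)); specialize (H2 PI ltac:(lra)).
  split; [eapply Rle_trans; [exact H1|]|eapply Rle_trans; [exact H2|]];
  unfold Rdiv; rewrite 2!Rmult_assoc, (Rmult_comm (/ _)), <- !Rmult_assoc, Rmult_assoc;
  rewrite (Rmult_assoc B); (apply Rmult_le_compat_r; [apply Rmult_le_pos; [lra|apply Rlt_le, Rinv_0_lt_compat, HKK]|unfold B; nra]).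
- intros eps He.
  destruct (riemann_lebesgue_ksin W q PI eps HPI He HW Hq) as (K1 & HK1 & HRL).
  set (A := PI * (M * (4 * PI * Q) + Q * (2 * PI * M))).
  exists (Rmax B (Rmax K1 (2 * A / eps))); split; [apply Rmax_l|].
  intros k c c1 s s1 Hk HkK Hc Hs.
  assert (HkB : B <= Cmod k) by (eapply Rle_trans; [apply Rmax_l|exact HkK]).
  assert (HkK1 : K1 <= Cmod k) by (eapply Rle_trans; [|exact HkK]; eapply Rle_trans; [apply Rmax_l|apply Rmax_r]).
  assert (HkA : 2 * A / eps <= Cmod k) by (eapply Rle_trans; [|exact HkK]; eapply Rle_trans; [apply Rmax_r|apply Rmax_r]).
  destruct (Hgen k c c1 s s1 Hk HkB Hc Hs) as [H1 H2].
  destruct Hc as (Hc & Hc1 & Hc0 & Hc10); destruct Hs as (Hs & Hs1 & Hs0 & Hs10); simpl in *.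
  assert (HK : 0 < Cmod k) by lra.
  assert (Hk0 : k <> 0) by now apply Cmod_gt_0.
  assert (HKK : 0 < Cmod k * Cmod k) by nra.
  pose proof (is_derive_all_continuous s _ Hs) as Cs.
  pose proof (is_derive_all_continuous s1 _ Hs1) as Cs1.
  pose proof (is_derive_all_continuous c _ Hc) as Cc.
  set (z := fun t => (c t - s1 t)%C).
  assert (Cz : forall t, ccontinuous z t)
   by (intros t; apply continuous_Cminus; auto).
  destruct (duhamel k z (fun t => c1 t - (W t - k * k) * s t)%C (fun t => W t * z t - q t * s t)%C PI Hk0) as [_ HD].
  { intros r; unfold z; eapply is_derive_Ceq; [apply is_derive_Cminus; auto|reflexivity]. }
  { intros r; eapply is_derive_Ceq.
    - apply is_derive_Cminus; [apply Hc1|].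
      apply is_derive_Cmult; [|apply Hs].
      apply is_derive_Cminus; [apply HW|apply is_derive_Cconst].
    - unfold z; cbv beta; ring. }
  { intros r; apply continuous_Cminus; apply continuous_Cmult; auto. }
  (* The velocity formula at pi has the value c1(pi) - (W(pi) - k^2) s(pi); with W(pi) = W(0) this
     is the quantity to be estimated. *)
  cbv beta in HD; unfold z in HD at 2; rewrite Hc0, Hc10, Hs0, Hs10, Hper in HD.
  set (w := (c1 PI + (k * k - W 0%R) * s PI)%C).
  assert (Cks : forall t, ccontinuous (ksin k) t)
   by (intros t; eapply is_derive_continuous; now apply is_derive_ksin).
  assert (Ckr : forall t, ccontinuous (fun t => kcos k (PI - t)) t).
  { intros t; eapply is_derive_continuous; now apply is_derive_reflect, is_derive_kcos. }
  assert (Ckd : forall t, ccontinuous (fun t => ksin k (2 * t - PI)) t).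
  { intros t; eapply is_derive_continuous.
    apply (is_derive_Ccomp_affine (ksin k) 2 (- PI) t); now apply is_derive_ksin. }
  assert (HL := CInt_correct (fun t => q t * ksin k (2 * t - PI))%C 0 PI
    ltac:(intros t _; apply continuous_Cmult; auto)).
  set (L := CInt _ 0 PI) in HL.
  assert (Hq0 : is_CInt q 0 PI 0).
  { eapply is_CInt_eq; [apply (is_CInt_derive W); auto|rewrite Hper; ring]. }
  (* Replacing s by ksin in the source costs the term -q(t) kcos(pi - t) ksin(t). The product
     formula splits it into a multiple of q, whose integral is W(pi) - W(0) = 0, and the
     Riemann-Lebesgue integrand of [L]. What is left under the integral is of second order in
     1/|k|. *)
  assert (HG : is_CInt (fun t => kcos k (PI - t) * (W t * z t - q t * (s t - ksin k t)))%C 0 PI (w + / 2 * L)%C).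
  { eapply is_CInt_ext; [|eapply is_CInt_eq;
      [exact (is_CInt_plus _ _ _ _ _ _ (is_CInt_plus _ _ _ _ _ _ HD (is_CInt_scal (ksin k PI / 2) _ _ _ _ Hq0)) (is_CInt_scal (/ 2) _ _ _ _ HL))|]].
    - intros t _; cbv beta.
      transitivity (kcos k (PI - t) * (W t * z t - q t * s t) + q t * ((ksin k PI + ksin k (2 * t - PI)) / 2))%C.
      + field; apply C2_nz.
      + rewrite <- (kcos_ksin_product k PI t Hk0); ring.
    - unfold w; field; apply C2_nz. }
  apply is_CInt_norm_const with (M := exp (Im k * PI) * (1 * (A / PI / (Cmod k * Cmod k)))) in HG; [|lra|].
  + specialize (HRL k L Hk HkK1 HL).
    replace w with ((w + / 2 * L) - / 2 * L)%C by ring.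
    apply Cmod_minus_bound.
    rewrite Cmod_mult, Cmod_inv, Cmod_R, Rabs_pos_eq by (apply C2_nz || lra).
    set (E := exp (Im k * PI)) in *; assert (HE : 0 < E) by apply exp_pos.
    assert (H3 : (PI - 0) * (E * (1 * (A / PI / (Cmod k * Cmod k)))) <= eps * E / Cmod k / 2).
    { replace ((PI - 0) * (E * (1 * (A / PI / (Cmod k * Cmod k))))) with
       (2 * A / eps * (eps * E / Cmod k / 2 / Cmod k)) by (field; lra).
      replace (eps * E / Cmod k / 2) with (Cmod k * (eps * E / Cmod k / 2 / Cmod k)) at 2 by (field; lra).
      apply Rmult_le_compat_r; [|exact HkA].
      unfold Rdiv; pose proof (Rinv_0_lt_compat _ HK); repeat apply Rmult_le_pos; lra. }
    lra.
  + intros t Ht; apply (kernel_exp_bound _ _ _ _ t); [lra| |].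
    * rewrite Rmult_1_r; now apply Cmod_kcos.
    * apply Cmod_minus_bound; rewrite !Cmod_mult.
      specialize (H1 t Ht); specialize (H2 t Ht); specialize (HMb t Ht); specialize (HQb t Ht).
      apply Rle_trans with (M * (4 * PI * Q / (Cmod k * Cmod k) * exp (Im k * t)) +
        Q * (2 * PI * M / (Cmod k * Cmod k) * exp (Im k * t))).
      -- apply Rplus_le_compat; apply Rmult_le_compat; auto.
      -- right; unfold A; field; lra.
Qed.

(** * Everywhere convergent power series *)

Definition is_Cseries (u : nat -> C) (l : C) : Prop :=
  is_series (K := C_AbsRing) (V := C_NormedModule) u l.

Definition Csum (u : nat -> C) (n : nat) : C := sum_n (G := C_NormedModule) u n.

Lemma Csum_O (u : nat -> C) : Csum u 0 = u O.
Proof. exact (sum_O (G := C_NormedModule) u). Qed.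

Lemma Csum_S (u : nat -> C) (n : nat) : Csum u (S n) = (Csum u n + u (S n))%C.
Proof. exact (sum_Sn (G := C_NormedModule) u n). Qed.

Lemma is_Cseries_eps (u : nat -> C) (l : C) :
  is_Cseries u l <-> forall eps, 0 < eps ->
    exists N, forall n, (N <= n)%nat -> Cmod (Csum u n - l) < eps.
Proof.
split.
- intros H e He.
  destruct (proj1 (filterlim_locally_ball_norm (K := C_AbsRing) (U := C_NormedModule) _ _) H (mkposreal e He)) as [N HN].
  exists N; intros n Hn; exact (HN n Hn).
- intros H; apply (filterlim_locally_ball_norm (K := C_AbsRing) (U := C_NormedModule)).
  intros e; destruct (H e (cond_pos e)) as [N HN]; exists N; intros n Hn; exact (HN n Hn).
Qed.

Lemma is_Cseries_unique (u : nat -> C) (l l' : C) : is_Cseries u l -> is_Cseries u l' -> l = l'.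
Proof. exact (filterlim_locally_unique (K := C_AbsRing) (V := C_NormedModule) (Csum u) l l'). Qed.

Lemma is_Cseries_ext (u v : nat -> C) (l : C) :
  (forall n, u n = v n) -> is_Cseries u l -> is_Cseries v l.
Proof. exact (is_series_ext (K := C_AbsRing) (V := C_NormedModule) u v l). Qed.

Lemma is_Cseries_eq (u : nat -> C) (l l' : C) : is_Cseries u l -> l = l' -> is_Cseries u l'.
Proof. now intros H <-. Qed.

Lemma is_Cseries_plus (u v : nat -> C) (l m : C) :
  is_Cseries u l -> is_Cseries v m -> is_Cseries (fun n => u n + v n)%C (l + m)%C.
Proof. exact (is_series_plus (K := C_AbsRing) (V := C_NormedModule) u v l m). Qed.

Lemma is_Cseries_scal (c : C) (u : nat -> C) (l : C) :
  is_Cseries u l -> is_Cseries (fun n => c * u n)%C (c * l)%C.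
Proof. exact (is_series_scal (K := C_AbsRing) (V := C_NormedModule) c u l). Qed.

Lemma is_Cseries_minus (u v : nat -> C) (l m : C) :
  is_Cseries u l -> is_Cseries v m -> is_Cseries (fun n => u n - v n)%C (l - m)%C.
Proof. exact (is_series_minus (K := C_AbsRing) (V := C_NormedModule) u v l m). Qed.

Lemma is_Cseries_shift (u : nat -> C) (l : C) :
  is_Cseries (fun n => u (S n)) l <-> is_Cseries u (u O + l)%C.
Proof.
split; intros H.
- apply (is_series_decr_1 (K := C_AbsRing) (V := C_NormedModule)).
  eapply is_Cseries_eq; [exact H|].
  unfold plus, opp; simpl; ring.
- apply (is_series_incr_1 (K := C_AbsRing) (V := C_NormedModule)).
  eapply is_Cseries_eq; [exact H|].
  unfold plus; simpl; ring.
Qed.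

Lemma Csum_le (u : nat -> C) (v : nat -> R) (n : nat) :
  (forall k, Cmod (u k) <= v k) -> Cmod (Csum u n) <= sum_n v n.
Proof.
intros H; induction n as [|n IH].
- rewrite Csum_O, sum_O; apply H.
- rewrite Csum_S, sum_Sn; apply Cmod_plus_bound.
  unfold plus; simpl; specialize (H (S n)); lra.
Qed.

Lemma is_Cseries_norm (u : nat -> C) (v : nat -> R) (l : C) (m : R) :
  (forall k, Cmod (u k) <= v k) -> is_Cseries u l -> is_series v m -> Cmod l <= m.
Proof.
intros H Hu Hv; apply le_epsilon; intros e He.
destruct (proj1 (is_Cseries_eps u l) Hu e He) as [N HN].
specialize (HN N (le_n N)).
assert (Hm : sum_n v N <= m).
{ apply (is_lim_seq_incr_compare (sum_n v)).
  - exact Hv.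
  - intros n; rewrite sum_Sn; unfold plus; simpl.
    pose proof (H (S n)); pose proof (Cmod_ge_0 (u (S n))); lra. }
pose proof (Csum_le u v N H).
pose proof (Cmod_rev_triangle l (Csum u N)); rewrite Cmod_minus_sym in HN; lra.
Qed.

(* An arbitrary value unless the series converges. *)
Definition CSeries (u : nat -> C) : C := epsilon (inhabits (RtoC 0)) (is_Cseries u).

Lemma CSeries_correct (u : nat -> C) (v : nat -> R) :
  (forall k, Cmod (u k) <= v k) -> ex_series v -> is_Cseries u (CSeries u).
Proof.
intros H Hv; unfold CSeries; apply epsilon_spec.
apply (ex_series_le (K := C_AbsRing) (V := C_CompleteNormedModule) u v H Hv).
Qed.

Lemma geom_dominated (a : nat -> C) (M r sig : R) : 0 <= r -> 2 * r <= sig -> 0 < sig ->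
  (forall n, Cmod (a n) * sig ^ n <= M) ->
  forall n, Cmod (a n) * r ^ n <= M * (/ 2) ^ n.
Proof.
intros Hr Hs Hs0 H n; specialize (H n).
assert (Hp : r ^ n <= (sig / 2) ^ n) by (apply pow_incr; lra).
apply Rle_trans with (Cmod (a n) * (sig / 2) ^ n).
- apply Rmult_le_compat_l; [apply Cmod_ge_0|exact Hp].
- unfold Rdiv; rewrite Rpow_mult_distr, <- Rmult_assoc.
  apply Rmult_le_compat_r; [apply pow_le; lra|exact H].
Qed.

Lemma is_series_half (M : R) : is_series (fun n => M * (/ 2) ^ n) (M * 2).
Proof.
apply (is_series_scal M (fun n => (/ 2) ^ n)).
assert (H : is_series (fun n => (/ 2) ^ n) (/ (1 - / 2))) by (apply is_series_geom; rewrite Rabs_pos_eq; lra).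
now replace (/ (1 - / 2)) with 2 in H by field.
Qed.

(** Infinite radius of convergence, expressed by one bound per radius; this form is stable under
    index shifts and under factors of geometric growth. *)
Definition rapid (a : nat -> C) : Prop :=
  forall sig, 0 < sig -> exists M, forall n, Cmod (a n) * sig ^ n <= M.

Lemma rapid_series (a : nat -> C) (z : C) : rapid a ->
  is_Cseries (fun n => a n * Cpow z n)%C (CSeries (fun n => a n * Cpow z n)%C).
Proof.
intros Ha; pose proof (Cmod_ge_0 z).
destruct (Ha (2 * Cmod z + 1)) as [M HM]; [lra|].
apply (CSeries_correct _ (fun n => M * (/ 2) ^ n)).
- intros n; rewrite Cmod_mult, Cmod_pow.
  apply (geom_dominated a M (Cmod z) (2 * Cmod z + 1)); auto; lra.
- eexists; apply is_series_half.
Qed.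

(** Entire functions presented by their power series at 0. Asking for the series instead of
    differentiability makes the division by a zero a computation with coefficients. *)
Definition ent (f : C -> C) : Prop :=
  exists a, rapid a /\ forall z, is_Cseries (fun n => a n * Cpow z n)%C (f z).

Lemma ent_ext (f g : C -> C) : (forall z, f z = g z) -> ent f -> ent g.
Proof. intros H (a & Ha & Hs); exists a; split; [exact Ha|]; intros z; rewrite <- H; apply Hs. Qed.

Lemma ent_lin (c d : C) (f g : C -> C) : ent f -> ent g -> ent (fun z => c * f z + d * g z)%C.
Proof.
intros (a & Ha & Hf) (b & Hb & Hg).
exists (fun n => c * a n + d * b n)%C; split.
- intros sig Hs; destruct (Ha sig Hs) as [M HM], (Hb sig Hs) as [N HN].
  exists (Cmod c * M + Cmod d * N); intros n; specialize (HM n); specialize (HN n).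
  pose proof (Cmod_triangle (c * a n) (d * b n)) as Ht; rewrite !Cmod_mult in Ht.
  assert (Hp : 0 <= sig ^ n) by (apply pow_le; lra).
  apply (Rmult_le_compat_r _ _ _ Hp) in Ht.
  pose proof (Cmod_ge_0 c) as Hc; pose proof (Cmod_ge_0 d) as Hd.
  apply (Rmult_le_compat_l _ _ _ Hc) in HM; apply (Rmult_le_compat_l _ _ _ Hd) in HN; lra.
- intros z; eapply is_Cseries_ext; [|apply is_Cseries_plus; apply is_Cseries_scal; [apply Hf|apply Hg]].
  intros n; simpl; ring.
Qed.

Lemma ent_const (c : C) : ent (fun _ => c).
Proof.
exists (fun n => match n with O => c | S _ => RtoC 0 end); split.
- intros sig Hs; exists (Cmod c); intros [|n]; simpl; [lra|].
  rewrite Cmod_0; pose proof (Cmod_ge_0 c); lra.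
- intros z; apply is_Cseries_eps; intros e He; exists O; intros n _.
  replace (Csum _ n) with c; [unfold Cminus; rewrite Cplus_opp_r, Cmod_0; exact He|].
  induction n as [|n IH].
  + rewrite Csum_O; simpl; ring.
  + rewrite Csum_S, <- IH; ring.
Qed.

Lemma INR_le_pow2 (n : nat) : INR n <= 2 ^ n.
Proof.
induction n as [|n IH]; [simpl; lra|].
rewrite S_INR; simpl; assert (1 <= 2 ^ n) by (apply pow_R1_Rle; lra); lra.
Qed.

Lemma rapid_deriv (a : nat -> C) : rapid a -> rapid (fun n => RtoC (INR (S n)) * a (S n))%C.
Proof.
intros Ha sig Hs.
(* The factor 2 absorbs n + 1 <= 2^(n + 1); the added 1 makes the base exceed 1, so the index shift
   is harmless. *)
destruct (Ha (2 * (sig + 1))) as [M HM]; [lra|].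
exists M; intros n; eapply Rle_trans; [|apply (HM (S n))].
rewrite Cmod_mult, Cmod_R, Rabs_pos_eq by apply pos_INR.
replace (INR (S n) * Cmod (a (S n)) * sig ^ n) with (Cmod (a (S n)) * (INR (S n) * sig ^ n)) by ring.
apply Rmult_le_compat_l; [apply Cmod_ge_0|].
rewrite Rpow_mult_distr; apply Rmult_le_compat; [apply pos_INR|apply pow_le; lra|apply INR_le_pow2|].
apply Rle_trans with ((sig + 1) ^ n); [apply pow_incr; lra|].
simpl; assert (0 <= (sig + 1) ^ n) by (apply pow_le; lra); nra.
Qed.

(** Second-order Taylor remainder of a power, with a deliberately crude constant: r >= 1 allows all
    powers to be raised to r^n. At n = 0 the value of [pred] is irrelevant, since its coefficient is
    0. *)
Lemma pow_taylor2 (z w : C) (r : R) (n : nat) : 1 <= r -> Cmod z <= r -> Cmod w <= r ->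
  Cmod (Cpow w n - Cpow z n - (w - z) * (RtoC (INR n) * Cpow z (pred n)))
  <= INR n * INR n * r ^ n * (Cmod (w - z) * Cmod (w - z)).
Proof.
intros Hr Hz Hw.
pose proof (Cmod_ge_0 (w - z)) as HD; set (D := Cmod (w - z)) in *.
induction n as [|n IH].
- simpl; replace (1 - 1 - (w - z) * (0 * 1))%C with (RtoC 0) by ring; rewrite Cmod_0; lra.
- assert (Hrn : 0 <= r ^ n) by (apply pow_le; lra).
  assert (Hn : 0 <= INR n) by apply pos_INR.
  replace (Cpow w (S n) - Cpow z (S n) - (w - z) * (RtoC (INR (S n)) * Cpow z (pred (S n))))%C with
   (w * (Cpow w n - Cpow z n - (w - z) * (RtoC (INR n) * Cpow z (pred n))) +
    RtoC (INR n) * Cpow z (pred n) * ((w - z) * (w - z)))%C.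
  2: { rewrite S_INR, RtoC_plus; destruct n as [|n]; simpl; ring. }
  apply Cmod_plus_bound; rewrite !Cmod_mult; fold D.
  rewrite Cmod_R, Rabs_pos_eq, Cmod_pow by exact Hn.
  assert (H1 : Cmod w * Cmod (Cpow w n - Cpow z n - (w - z) * (RtoC (INR n) * Cpow z (pred n)))
    <= r * (INR n * INR n * r ^ n * (D * D))).
  { apply Rmult_le_compat; auto. }
  assert (H2 : Cmod z ^ pred n <= r ^ S n).
  { apply Rle_trans with (r ^ pred n); [apply pow_incr; split; [apply Cmod_ge_0|exact Hz]|].
    apply Rle_pow; [exact Hr|lia]. }
  assert (H3 : INR n * Cmod z ^ pred n * (D * D) <= INR n * r ^ S n * (D * D)).
  { apply Rmult_le_compat_r; [nra|]; apply Rmult_le_compat_l; assumption. }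
  rewrite S_INR; simpl in *.
  assert (0 <= r * r ^ n * (D * D)) by (repeat apply Rmult_le_pos; lra).
  assert (0 <= INR n * (r * r ^ n * (D * D))) by (apply Rmult_le_pos; lra).
  nra.
Qed.

Lemma ent_derive (f : C -> C) : ent f -> exists f', ent f' /\ forall z, is_Cderive f z (f' z).
Proof.
intros (a & Ha & Hf).
pose proof (rapid_deriv a Ha) as Hb.
set (b := fun n => (RtoC (INR (S n)) * a (S n))%C) in Hb.
set (f' := fun z => CSeries (fun n => b n * Cpow z n)%C).
assert (Hf' : forall z, is_Cseries (fun n => b n * Cpow z n)%C (f' z)) by (intros z; now apply rapid_series).
exists f'; split; [now exists b|].
intros z.
set (r := Cmod z + 1); pose proof (Cmod_ge_0 z).
(* The factor n^2 of the remainder is at most 4^n, which moves the radius from r to 4r; a last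
   doubling makes the series geometric with ratio 1/2. *)
destruct (Ha (8 * r)) as [M HM]; [unfold r; lra|].
assert (HM0 : 0 <= M) by (eapply Rle_trans; [apply (Cmod_ge_0 (a O))|]; specialize (HM O); simpl in HM; lra).
assert (Hq : forall w, Cmod w <= r -> Cmod (f w - f z - (w - z) * f' z) <= M * 2 * (Cmod (w - z) * Cmod (w - z))).
{ intros w Hw.
  set (D := Cmod (w - z) * Cmod (w - z)); assert (HD : 0 <= D) by (apply Rmult_le_pos; apply Cmod_ge_0).
  apply (is_Cseries_norm (fun n => a n * (Cpow w n - Cpow z n - (w - z) * (RtoC (INR n) * Cpow z (pred n))))%C
    (fun n => M * D * (/ 2) ^ n)).
  - intros n; rewrite Cmod_mult.
    apply Rle_trans with (Cmod (a n) * (INR n * INR n * r ^ n * D)).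
    + apply Rmult_le_compat_l; [apply Cmod_ge_0|].
      apply pow_taylor2; unfold r in *; lra.
    + replace (M * D * (/ 2) ^ n) with (D * (M * (/ 2) ^ n)) by ring.
      replace (Cmod (a n) * (INR n * INR n * r ^ n * D)) with (D * (Cmod (a n) * (INR n * INR n * r ^ n))) by ring.
      apply Rmult_le_compat_l; [exact HD|].
      eapply Rle_trans; [|apply (geom_dominated a M (4 * r) (8 * r))]; auto; try (unfold r; lra).
      apply Rmult_le_compat_l; [apply Cmod_ge_0|].
      rewrite Rpow_mult_distr; apply Rmult_le_compat_r; [apply pow_le; unfold r; lra|].
      replace 4 with (2 * 2) by ring; rewrite Rpow_mult_distr.
      apply Rmult_le_compat; auto using pos_INR, INR_le_pow2.
  - eapply is_Cseries_ext; [|apply is_Cseries_minus; [apply (is_Cseries_minus _ _ _ _ (Hf w) (Hf z))|]].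
    2: apply (is_Cseries_scal (w - z)%C (fun n => a n * (RtoC (INR n) * Cpow z (pred n)))%C).
    2: { replace (f' z) with ((fun n => a n * (RtoC (INR n) * Cpow z (pred n)))%C O + f' z)%C by (simpl; ring).
         apply is_Cseries_shift; eapply is_Cseries_ext; [|apply Hf'].
         intros n; unfold b; simpl pred; ring. }
    intros n; simpl; ring.
  - replace (M * 2 * D) with (M * D * 2) by ring; apply is_series_half. }
apply is_derive_CC; intros e He.
exists (Rmin 1 (e / (M * 2 + 1))); split.
{ apply Rmin_pos; [lra|]; apply Rdiv_lt_0_compat; lra. }
intros w Hw.
apply Rmin_Rgt_l in Hw; destruct Hw as [Hw1 Hw2].
pose proof (Cmod_rev_triangle w z) as Hrev.
eapply Rle_trans; [apply Hq; unfold r; lra|].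
rewrite <- Rmult_assoc; apply Rmult_le_compat_r; [apply Cmod_ge_0|].
apply (Rmult_lt_compat_l (M * 2 + 1)) in Hw2; [|lra].
replace ((M * 2 + 1) * (e / (M * 2 + 1))) with e in Hw2 by (field; lra).
pose proof (Cmod_ge_0 (w - z)); nra.
Qed.

(** Horner division carried to infinite length: b_n is the sum over k of a_(n+1+k) z0^k, so that b_n
    = a_(n+1) + z0 b_(n+1), while a_0 + z0 b_0 = f(z0) = 0. Comparing coefficients gives f = (w -
    z0) g everywhere, including at z0. *)
Lemma ent_div (f : C -> C) (z0 : C) : ent f -> f z0 = 0 ->
  exists g, ent g /\ forall w, f w = ((w - z0) * g w)%C.
Proof.
intros (a & Ha & Hf) Hz0; pose proof (Cmod_ge_0 z0).
set (b := fun n => CSeries (fun k => a (S n + k)%nat * Cpow z0 k)%C).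
assert (Hrs : forall n, rapid (fun k => a (S n + k)%nat)).
{ intros n sig Hs; destruct (Ha (sig + 1)) as [M HM]; [lra|].
  exists M; intros k; eapply Rle_trans; [|apply (HM (S n + k)%nat)].
  apply Rmult_le_compat_l; [apply Cmod_ge_0|].
  apply Rle_trans with ((sig + 1) ^ k); [apply pow_incr; lra|].
  apply Rle_pow; [lra|lia]. }
assert (Hb : forall n, is_Cseries (fun k => a (S n + k)%nat * Cpow z0 k)%C (b n))
 by (intros n; apply (rapid_series (fun k => a (S n + k)%nat)), Hrs).
assert (Hrec : forall n, b n = (a (S n) + z0 * b (S n))%C).
{ intros n; eapply is_Cseries_unique; [apply Hb|].
  eapply is_Cseries_eq.
  - apply is_Cseries_shift.
    eapply is_Cseries_ext; [|apply (is_Cseries_scal z0), (Hb (S n))].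
    intros k; simpl; replace (n + S k)%nat with (S n + k)%nat by lia; simpl; ring.
  - simpl; rewrite Nat.add_0_r; ring. }
assert (H0 : (a O + z0 * b O = 0)%C).
{ rewrite <- Hz0; eapply is_Cseries_unique; [|apply Hf].
  eapply is_Cseries_eq.
  - apply is_Cseries_shift.
    eapply is_Cseries_ext; [|apply (is_Cseries_scal z0), (Hb O)].
    intros k; simpl; ring.
  - simpl; ring. }
assert (Rb : rapid b).
{ intros sig Hs.
  (* [tau] must be at least twice |z0| for the geometric sum over k, at least [sig] for the power
     sig^n, and at least 1 to drop one exponent. *)
  set (tau := 2 * (Cmod z0 + sig + 1)).
  destruct (Ha tau) as [M HM]; [unfold tau; lra|].
  assert (Ht : 1 <= tau) by (unfold tau; lra).
  exists (M * 2); intros n.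
  assert (Hsn : 0 < sig ^ n) by (apply pow_lt; lra).
  apply (Rmult_le_reg_r (/ sig ^ n)); [now apply Rinv_0_lt_compat|].
  rewrite Rmult_assoc, Rinv_r, Rmult_1_r by lra.
  replace (M * 2 * / sig ^ n) with (M * / sig ^ n * 2) by ring.
  apply (is_Cseries_norm (fun k => a (S n + k)%nat * Cpow z0 k)%C (fun k => M * / sig ^ n * (/ 2) ^ k)); [|apply Hb|apply is_series_half].
  intros k; rewrite Cmod_mult, Cmod_pow.
  apply (geom_dominated (fun k => a (S n + k)%nat) (M * / sig ^ n) (Cmod z0) tau); try (unfold tau; lra).
  intros j; apply (Rmult_le_reg_r (sig ^ n)); [exact Hsn|].
  rewrite !Rmult_assoc, Rinv_l, Rmult_1_r by lra.
  eapply Rle_trans; [|apply (HM (S n + j)%nat)].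
  apply Rmult_le_compat_l; [apply Cmod_ge_0|].
  rewrite pow_add, Rmult_comm; apply Rmult_le_compat_r; [apply pow_le; lra|].
  apply Rle_trans with (tau ^ n); [apply pow_incr; unfold tau; lra|apply Rle_pow; [lra|lia]]. }
set (g := fun w => CSeries (fun n => b n * Cpow w n)%C).
assert (Hg : forall w, is_Cseries (fun n => b n * Cpow w n)%C (g w)) by (intros w; now apply rapid_series).
exists g; split; [now exists b|]; intros w.
assert (Hsh : is_Cseries (fun n => b (S n) * Cpow w (S n))%C (g w - b O)%C).
{ apply (proj2 (is_Cseries_shift (fun n => b n * Cpow w n)%C (g w - b O)%C)).
  eapply is_Cseries_eq; [apply Hg|simpl; ring]. }
eapply is_Cseries_unique; [apply Hf|].
eapply is_Cseries_eq.
- apply is_Cseries_shift.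
  eapply is_Cseries_ext; [|exact (is_Cseries_minus _ _ _ _ (is_Cseries_scal w _ _ (Hg w)) (is_Cseries_scal z0 _ _ Hsh))].
  intros n; cbv beta; rewrite (Hrec n); simpl; ring.
- simpl.
  replace (a O * 1)%C with (- (z0 * b O) + (a O + z0 * b O))%C by ring; rewrite H0; ring.
Qed.

(** * Volterra series and entire dependence of solutions on the spectral parameter *)

Lemma CInt_swap (f : R -> C) (a b : R) (l : C) : is_CInt f a b l -> is_CInt f b a (- l)%C.
Proof. exact (is_RInt_swap (V := C_R_NormedModule) f b a l). Qed.

Lemma is_RInt_exp_scaled (K L a b : R) : L <> 0 ->
  is_RInt (fun t => K * exp (L * (t - a))) a b (K / L * exp (L * (b - a)) - K / L).
Proof.
intros HL.
replace (K / L * exp (L * (b - a)) - K / L) with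
  (minus (G := R_NormedModule) (K / L * exp (L * (b - a))) (K / L * exp (L * (a - a)))).
- apply (is_RInt_derive (V := R_CompleteNormedModule) (fun t => K / L * exp (L * (t - a)))).
  + intros t _; auto_derive; [easy|]; unfold Rminus; field; exact HL.
  + intros t _; apply (ex_derive_continuous (K := R_AbsRing) (V := R_NormedModule)); auto_derive; easy.
- unfold minus, plus, opp; simpl; rewrite Rminus_diag, Rmult_0_r, exp_0; ring.
Qed.

(** Integrating against exp(L |s - x0|) gains a factor 1/L on either side of x0. With L proportional
    to a prescribed radius, this makes the Picard iterates decay at any geometric rate. *)
Lemma CInt_exp_weight (f : R -> C) (K L x0 t : R) : 0 < L -> 0 <= K ->
  (forall s, ccontinuous f s) ->
  (forall s, Rabs (s - x0) <= Rabs (t - x0) -> Cmod (f s) <= K * exp (L * Rabs (s - x0))) ->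
  Cmod (CInt f x0 t) <= K / L * exp (L * Rabs (t - x0)).
Proof.
intros HL HK Cf Hf.
assert (HKL : 0 <= K / L) by (apply Rdiv_le_0_compat; assumption).
assert (HI := CInt_correct f x0 t (fun s _ => Cf s)).
destruct (Rle_dec x0 t) as [Hle|Hle].
- apply Rle_trans with (K / L * exp (L * (t - x0)) - K / L).
  + refine (is_CInt_norm f (fun s => K * exp (L * (s - x0))) x0 t _ _ Hle _ HI _).
    * intros s Hs; rewrite <- (Rabs_pos_eq (s - x0)) by lra; apply Hf; rewrite !Rabs_pos_eq; lra.
    * apply is_RInt_exp_scaled; lra.
  + rewrite Rabs_pos_eq by lra; lra.
- apply CInt_swap in HI; rewrite <- Cmod_opp.
  apply Rle_trans with (K / L * exp (L * (x0 - t)) - K / L).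
  + refine (is_CInt_norm f (fun s => K * exp (L * (x0 - s))) t x0 _ _ ltac:(lra) _ HI _).
    * intros s Hs; replace (x0 - s) with (Rabs (s - x0)) by (rewrite Rabs_left1; lra).
      apply Hf; rewrite !Rabs_left1; lra.
    * replace (K / L * exp (L * (x0 - t)) - K / L) with
       (minus (G := R_NormedModule) (- (K / L) * exp (L * (x0 - x0))) (- (K / L) * exp (L * (x0 - t)))).
      -- apply (is_RInt_derive (V := R_CompleteNormedModule) (fun s => - (K / L) * exp (L * (x0 - s)))).
         ++ intros s _; auto_derive; [easy|]; unfold Rminus; field; lra.
         ++ intros s _; apply (ex_derive_continuous (K := R_AbsRing) (V := R_NormedModule)); auto_derive; easy.
      -- unfold minus, plus, opp; simpl; rewrite Rminus_diag, Rmult_0_r, exp_0; ring.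
  + rewrite Rabs_left1 by lra; rewrite Ropp_minus_distr; lra.
Qed.

Lemma continuous_RC_eps (f : R -> C) (t : R) :
  (forall eps, 0 < eps -> exists d, 0 < d /\ forall s, Rabs (s - t) < d -> Cmod (f s - f t) < eps) ->
  ccontinuous f t.
Proof.
intros H; apply (filterlim_locally_ball_norm (K := R_AbsRing) (U := C_R_NormedModule)).
intros e; destruct (H e (cond_pos e)) as (d & Hd & Hs).
exists (mkposreal d Hd); intros s Hb; specialize (Hs s Hb).
rewrite Cmod_norm in Hs; exact Hs.
Qed.

Lemma continuous_RC_eps_inv (f : R -> C) (t : R) :
  ccontinuous f t ->
  forall eps, 0 < eps -> exists d, 0 < d /\ forall s, Rabs (s - t) < d -> Cmod (f s - f t) < eps.
Proof.
intros H e He.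
destruct (proj1 (filterlim_locally_ball_norm (K := R_AbsRing) (U := C_R_NormedModule) f (f t)) H (mkposreal e He)) as [d Hd].
exists d; split; [apply cond_pos|]; intros s Hs; specialize (Hd s Hs).
rewrite Cmod_norm; exact Hd.
Qed.

Lemma continuous_Csum (u : nat -> R -> C) (n : nat) (t : R) :
  (forall k, ccontinuous (u k) t) ->
  ccontinuous (fun s => Csum (fun k => u k s) n) t.
Proof.
intros H; induction n as [|n IH].
- apply (continuous_ext (T := R_UniformSpace) (U := C_UniformSpace) (u O)); [intros; now rewrite Csum_O|apply H].
- apply (continuous_ext (T := R_UniformSpace) (U := C_UniformSpace) (fun s => Csum (fun k => u k s) n + u (S n) s)%C);
  [intros; now rewrite Csum_S|now apply continuous_Cplus].
Qed.

Lemma geometric_tail (u : nat -> C) (M : R) (l : C) (n : nat) :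
  (forall k, Cmod (u k) <= M * (/ 2) ^ k) -> is_Cseries u l ->
  Cmod (l - Csum u n) <= M * (/ 2) ^ n.
Proof.
intros H Hu; revert u M l H Hu; induction n as [|n IH]; intros u M l H Hu.
- rewrite Csum_O; replace (M * (/ 2) ^ 0) with (M * / 2 * 2) by (simpl; field).
  apply (is_Cseries_norm (fun k => u (S k)) (fun k => M * / 2 * (/ 2) ^ k)).
  + intros k; eapply Rle_trans; [apply H|simpl; lra].
  + apply is_Cseries_shift; eapply is_Cseries_eq; [exact Hu|ring].
  + apply is_series_half.
- replace (l - Csum u (S n))%C with ((l - u O) - Csum (fun k => u (S k)) n)%C.
  + replace (M * (/ 2) ^ S n) with (M * / 2 * (/ 2) ^ n) by (simpl; ring).
    apply IH.
    * intros k; eapply Rle_trans; [apply H|simpl; lra].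
    * apply is_Cseries_shift; eapply is_Cseries_eq; [exact Hu|ring].
  + clear; induction n as [|n IH]; rewrite ?Csum_S, ?Csum_O; [ring|].
    rewrite Csum_S in IH.
    transitivity (l - (Csum u n + u (S n)) - u (S (S n)))%C; [|ring].
    rewrite <- IH; ring.
Qed.

Lemma half_pow_small (M eps : R) : 0 < eps -> exists N, forall n, (N <= n)%nat -> M * (/ 2) ^ n < eps.
Proof.
intros He.
assert (Hl : is_lim_seq (fun n => M * (/ 2) ^ n) 0).
{ replace (Finite 0) with (Rbar_mult M (Finite 0)) by (simpl; f_equal; ring).
  apply is_lim_seq_scal_l, is_lim_seq_geom; rewrite Rabs_pos_eq; lra. }
apply is_lim_seq_spec in Hl; destruct (Hl (mkposreal eps He)) as [N HN].
exists N; intros n Hn; specialize (HN n Hn); simpl in HN.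
rewrite Rminus_0_r in HN; apply Rabs_def2 in HN; lra.
Qed.

Definition locally_rapid (u : nat -> R -> C) (x0 : R) : Prop :=
  forall T sig, 0 < T -> 0 < sig -> exists M, forall n t, Rabs (t - x0) <= T -> Cmod (u n t) * sig ^ n <= M.

Lemma locally_rapid_at (u : nat -> R -> C) (x0 t : R) : locally_rapid u x0 -> rapid (fun n => u n t).
Proof.
intros H sig Hs; pose proof (Rabs_pos (t - x0)).
destruct (H (Rabs (t - x0) + 1) sig) as [M HM]; [lra|exact Hs|].
exists M; intros n; apply HM; lra.
Qed.

Definition ysum (u : nat -> R -> C) (mu : C) (t : R) : C := CSeries (fun n => u n t * Cpow mu n)%C.

Lemma ysum_spec (u : nat -> R -> C) (x0 : R) (mu : C) (t : R) : locally_rapid u x0 ->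
  is_Cseries (fun n => u n t * Cpow mu n)%C (ysum u mu t).
Proof. intros H; apply (rapid_series (fun n => u n t)), (locally_rapid_at u x0 t H). Qed.

Lemma ysum_tail (u : nat -> R -> C) (x0 : R) (mu : C) (T : R) : locally_rapid u x0 -> 0 < T ->
  exists M, forall n t, Rabs (t - x0) <= T ->
    Cmod (ysum u mu t - Csum (fun n => u n t * Cpow mu n)%C n) <= M * (/ 2) ^ n.
Proof.
intros H HT; pose proof (Cmod_ge_0 mu).
destruct (H T (2 * Cmod mu + 1) HT) as [M HM]; [lra|].
exists M; intros n t Ht; apply geometric_tail; [|now apply (ysum_spec u x0)].
intros k; rewrite Cmod_mult, Cmod_pow.
apply (geom_dominated (fun k => u k t) M (Cmod mu) (2 * Cmod mu + 1)); try lra.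
intros j; now apply HM.
Qed.

Lemma continuous_ysum (u : nat -> R -> C) (x0 : R) (mu : C) (t : R) : locally_rapid u x0 ->
  (forall n s, ccontinuous (u n) s) ->
  ccontinuous (ysum u mu) t.
Proof.
intros H Cu; apply continuous_RC_eps; intros e He.
pose proof (Rabs_pos (t - x0)) as Hp.
destruct (ysum_tail u x0 mu (Rabs (t - x0) + 1) H) as [M HM]; [lra|].
destruct (half_pow_small M (e / 3)) as [N HN]; [lra|].
specialize (HN N (le_n N)).
destruct (continuous_RC_eps_inv _ _ (continuous_Csum (fun n s => u n s * Cpow mu n)%C N t
  (fun k => continuous_Cmult (T := R_UniformSpace) _ _ _ (Cu k t) (continuous_Cconst _ _))) (e / 3)) as (d & Hd & Hs); [lra|].
exists (Rmin 1 d); split; [apply Rmin_pos; lra|]; intros s Hst.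
assert (Hs1 : Rabs (s - t) < 1) by (eapply Rlt_le_trans; [exact Hst|apply Rmin_l]).
specialize (Hs s (Rlt_le_trans _ _ _ Hst (Rmin_r _ _))).
assert (Hsx : Rabs (s - x0) <= Rabs (t - x0) + 1).
{ replace (s - x0) with ((t - x0) + (s - t)) by ring; eapply Rle_trans; [apply Rabs_triang|lra]. }
pose proof (HM N s Hsx) as H1; pose proof (HM N t ltac:(lra)) as H2.
set (Ss := Csum (fun n => u n s * Cpow mu n)%C N) in *; set (St := Csum (fun n => u n t * Cpow mu n)%C N) in *.
replace (ysum u mu s - ysum u mu t)%C with ((ysum u mu s - Ss) + (Ss - St) - (ysum u mu t - St))%C by ring.
eapply Rle_lt_trans; [apply Cmod_minus_le|].
eapply Rle_lt_trans; [apply Rplus_le_compat_r, Cmod_triangle|lra].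
Qed.

Lemma is_CInt_Csum (f : nat -> R -> C) (I : nat -> C) (a b : R) (n : nat) :
  (forall k, is_CInt (f k) a b (I k)) -> is_CInt (fun t => Csum (fun k => f k t) n) a b (Csum I n).
Proof.
intros H; induction n as [|n IH].
- rewrite Csum_O; eapply is_CInt_ext; [|apply H]; intros; now rewrite Csum_O.
- rewrite Csum_S; eapply is_CInt_ext; [|apply (is_CInt_plus _ _ _ _ _ _ IH (H (S n)))].
  intros; now rewrite Csum_S.
Qed.

Lemma Csum_scal (c : C) (u : nat -> C) (n : nat) : Csum (fun k => c * u k)%C n = (c * Csum u n)%C.
Proof. induction n as [|n IH]; rewrite ?Csum_O, ?Csum_S, ?IH; ring. Qed.

Lemma Csum_ext (u v : nat -> C) (n : nat) : (forall k, u k = v k) -> Csum u n = Csum v n.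
Proof. intros H; induction n as [|n IH]; rewrite ?Csum_O, ?Csum_S, ?IH, H; ring. Qed.

(** Termwise integration: [ysum_tail] bounds the tail of the series uniformly between x0 and t. *)
Lemma CInt_ysum (u : nat -> R -> C) (g : R -> C) (x0 : R) (mu : C) (t : R) : locally_rapid u x0 ->
  (forall n s, ccontinuous (u n) s) ->
  (forall s, ccontinuous g s) ->
  is_Cseries (fun n => CInt (fun s => g s * u n s)%C x0 t * Cpow mu n)%C (CInt (fun s => g s * ysum u mu s)%C x0 t).
Proof.
intros H Cu Cg; apply is_Cseries_eps; intros e He.
pose proof (Rabs_pos (t - x0)) as Hp.
destruct (ysum_tail u x0 mu (Rabs (t - x0) + 1) H) as [M HM]; [lra|].
destruct (Cmod_bounded g x0 t Cg) as (G & HG & HGb).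
destruct (half_pow_small ((Rabs (t - x0) + 1) * (G * M)) e He) as [N HN].
exists N; intros n Hn; specialize (HN n Hn).
assert (Cy : forall s, ccontinuous (ysum u mu) s)
 by (intros s; now apply (continuous_ysum u x0)).
assert (HI : is_CInt (fun s => g s * (ysum u mu s - Csum (fun n => u n s * Cpow mu n)%C n))%C x0 t
  (CInt (fun s => g s * ysum u mu s)%C x0 t - Csum (fun n => CInt (fun s => g s * u n s)%C x0 t * Cpow mu n)%C n)%C).
{ eapply is_CInt_ext; [|apply is_CInt_minus;
    [apply CInt_correct; intros s _; apply continuous_Cmult; [apply Cg|apply Cy]|
     apply (is_CInt_Csum (fun k s => Cpow mu k * (g s * u k s))%C)]].
  - intros s _; cbv beta.
    rewrite (Csum_ext (fun k => Cpow mu k * (g s * u k s))%C (fun k => g s * (u k s * Cpow mu k))%C) by (intros; ring).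
    rewrite Csum_scal; ring.
  - intros k; rewrite Cmult_comm; apply is_CInt_scal, CInt_correct.
    intros s _; apply continuous_Cmult; [apply Cg|apply Cu]. }
rewrite Cmod_minus_sym; eapply Rle_lt_trans; [|exact HN].
assert (HM0 : 0 <= M).
{ specialize (HM O x0); eapply Rle_trans; [apply Cmod_ge_0|].
  eapply Rle_trans; [apply HM; rewrite Rminus_diag, Rabs_R0; lra|simpl; lra]. }
assert (Hpw : 0 <= (/ 2) ^ n) by (apply pow_le; lra).
(* The estimate is stated for an ordered interval, since t may lie on either side of x0. *)
assert (Hfin : forall a b l, a <= b -> b - a <= Rabs (t - x0) -> (forall s, a <= s <= b -> Rmin x0 t <= s <= Rmax x0 t) ->
  is_CInt (fun s => g s * (ysum u mu s - Csum (fun n => u n s * Cpow mu n)%C n))%C a b l ->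
  Cmod l <= (Rabs (t - x0) + 1) * (G * M) * (/ 2) ^ n).
{ intros a b l Hab Hba Hin Hl.
  apply is_CInt_norm_const with (M := G * (M * (/ 2) ^ n)) in Hl; [|exact Hab|].
  - eapply Rle_trans; [exact Hl|].
    rewrite Rmult_assoc, (Rmult_assoc G); apply Rmult_le_compat_r; [|lra].
    repeat apply Rmult_le_pos; lra.
  - intros s Hs; specialize (Hin s Hs); rewrite Cmod_mult.
    apply Rmult_le_compat; try apply Cmod_ge_0; [now apply HGb|apply HM].
    unfold Rmin, Rmax in Hin; destruct (Rle_dec x0 t).
    + rewrite !Rabs_pos_eq; lra.
    + rewrite !Rabs_left1; lra. }
destruct (Rle_dec x0 t) as [Hle|Hle].
- apply (Hfin x0 t); [lra|apply Rle_abs| |exact HI].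
  intros s Hs; rewrite Rmin_left, Rmax_right; lra.
- rewrite <- Cmod_opp; apply (Hfin t x0); [lra|rewrite Rabs_left1; lra| |now apply CInt_swap].
  intros s Hs; rewrite Rmin_right, Rmax_left; lra.
Qed.

(** * Linear second-order equations and their Volterra series *)

Definition solves (W : R -> C) (y y1 : R -> C) : Prop :=
  (forall t, is_derive y t (y1 t)) /\ (forall t, is_derive y1 t (W t * y t)%C).

Lemma solves_continuous (W y y1 : R -> C) (t : R) : solves W y y1 ->
  ccontinuous y t /\ ccontinuous y1 t.
Proof. intros [H1 H2]; split; eapply is_derive_continuous; eauto. Qed.

Lemma wronskian_const (W y y1 z z1 : R -> C) (a b : R) :
  solves W y y1 -> solves W z z1 ->
  (y a * z1 a - y1 a * z a = y b * z1 b - y1 b * z b)%C.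
Proof.
intros [Hy Hy1] [Hz Hz1].
apply (is_derive_zero_const (fun t => y t * z1 t - y1 t * z t)%C).
intros t _; eapply is_derive_Ceq; [apply is_derive_Cminus; apply is_derive_Cmult; auto|].
cbv beta; ring.
Qed.

(* Picard iterates for u'' = (W + mu U) u as a perturbation of u'' = W u, by variation of constants. *)
Fixpoint viter (U p q p1 q1 y0 y01 : R -> C) (x0 : R) (n : nat) : (R -> C) * (R -> C) :=
  match n with
  | O => (y0, y01)
  | S m => let y := fst (viter U p q p1 q1 y0 y01 x0 m) in
    (fun t => q t * CInt (fun s => p s * U s * y s) x0 t - p t * CInt (fun s => q s * U s * y s) x0 t,
     fun t => q1 t * CInt (fun s => p s * U s * y s) x0 t - p1 t * CInt (fun s => q s * U s * y s) x0 t)%C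
  end.

Lemma viter_continuous (W U p q p1 q1 y0 y01 : R -> C) (x0 : R) (n : nat) (t : R) :
  (forall t, ccontinuous U t) ->
  solves W p p1 -> solves W q q1 -> solves W y0 y01 ->
  ccontinuous (fst (viter U p q p1 q1 y0 y01 x0 n)) t /\
  ccontinuous (snd (viter U p q p1 q1 y0 y01 x0 n)) t.
Proof.
intros CU Hp Hq Hy; revert t; induction n as [|n IH]; intros t; [exact (solves_continuous W y0 y01 t Hy)|].
destruct (solves_continuous W p p1 t Hp) as [Cp Cp1], (solves_continuous W q q1 t Hq) as [Cq Cq1].
assert (Ci : forall r r1, solves W r r1 -> ccontinuous
  (fun t => CInt (fun s => r s * U s * fst (viter U p q p1 q1 y0 y01 x0 n) s)%C x0 t) t).
{ intros r r1 Hr; eapply is_derive_continuous.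
  apply (is_derive_CInt (fun s => r s * U s * fst (viter U p q p1 q1 y0 y01 x0 n) s)%C).
  intros s; apply continuous_Cmult; [apply continuous_Cmult; [apply (solves_continuous W r r1 s Hr)|apply CU]|apply IH]. }
simpl; split; apply continuous_Cminus; apply continuous_Cmult; auto; eapply Ci; eauto.
Qed.

(** In the norm weighted by exp(L |t - x0|) one iteration has norm at most b/L, where [b] bounds the
    kernel. The choice L = b sig makes this 1/sig, and [sig] is arbitrary; only the weight, not the
    rate, depends on it. *)
Lemma viter_rapid (W U p q p1 q1 y0 y01 : R -> C) (x0 : R) :
  (forall t, ccontinuous U t) ->
  solves W p p1 -> solves W q q1 -> solves W y0 y01 ->
  locally_rapid (fun n => fst (viter U p q p1 q1 y0 y01 x0 n)) x0 /\
  locally_rapid (fun n => snd (viter U p q p1 q1 y0 y01 x0 n)) x0.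
Proof.
intros CU Hp Hq Hy.
assert (Hmain : forall T sig, 0 < T -> 0 < sig -> exists M, forall n t, Rabs (t - x0) <= T ->
  Cmod (fst (viter U p q p1 q1 y0 y01 x0 n) t) * sig ^ n <= M /\
  Cmod (snd (viter U p q p1 q1 y0 y01 x0 n) t) * sig ^ n <= M).
{ intros T sig HT Hs.
  assert (Hbd : forall f : R -> C, (forall t, ccontinuous f t) ->
    exists M, 0 < M /\ forall t, Rabs (t - x0) <= T -> Cmod (f t) <= M).
  { intros f Cf; destruct (Cmod_bounded f (x0 - T) (x0 + T) Cf) as (M & HM & HMb).
    exists M; split; [exact HM|]; intros t Ht; apply HMb.
    rewrite Rmin_left, Rmax_right by lra; apply Rabs_le_between in Ht; lra. }
  destruct (Hbd U CU) as (u & Hu & HU).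
  destruct (Hbd p (fun t => proj1 (solves_continuous W p p1 t Hp))) as (bp & Hbp & Hp').
  destruct (Hbd p1 (fun t => proj2 (solves_continuous W p p1 t Hp))) as (bp1 & Hbp1 & Hp1').
  destruct (Hbd q (fun t => proj1 (solves_continuous W q q1 t Hq))) as (bq & Hbq & Hq').
  destruct (Hbd q1 (fun t => proj2 (solves_continuous W q q1 t Hq))) as (bq1 & Hbq1 & Hq1').
  destruct (Hbd y0 (fun t => proj1 (solves_continuous W y0 y01 t Hy))) as (A & HA & Hy').
  destruct (Hbd y01 (fun t => proj2 (solves_continuous W y0 y01 t Hy))) as (A1 & HA1 & Hy1').
  (* Bounds for the kernels (q(t) p(s) - p(t) q(s)) U(s) and (q1(t) p(s) - p1(t) q(s)) U(s) of the
     function and of its derivative. *)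
  set (b := 2 * bp * bq * u); set (b1 := (bq1 * bp + bp1 * bq) * u).
  assert (Hb : 0 < b) by (unfold b; repeat apply Rmult_lt_0_compat; lra).
  assert (Hb1 : 0 < b1) by (unfold b1; apply Rmult_lt_0_compat; [nra|lra]).
  set (L := b * sig).
  assert (HL : 0 < L) by (unfold L; nra).
  assert (Hint : forall r n t K, (forall t, ccontinuous r t) ->
     0 <= K -> (forall s, Rabs (s - x0) <= T -> Cmod (r s) <= K) -> Rabs (t - x0) <= T ->
     (forall s, Rabs (s - x0) <= T -> Cmod (fst (viter U p q p1 q1 y0 y01 x0 n) s) <= A * (/ sig) ^ n * exp (L * Rabs (s - x0))) ->
     Cmod (CInt (fun s => r s * U s * fst (viter U p q p1 q1 y0 y01 x0 n) s)%C x0 t) <=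
       K * u * (A * (/ sig) ^ n) / L * exp (L * Rabs (t - x0))).
  { intros r n t K Cr HK Hr Ht IH.
    assert (Hsn : 0 <= (/ sig) ^ n) by (apply pow_le, Rlt_le, Rinv_0_lt_compat, Hs).
    apply CInt_exp_weight; [exact HL|repeat apply Rmult_le_pos; lra| |].
    - intros s; apply continuous_Cmult; [apply continuous_Cmult; auto|].
      apply (viter_continuous W U p q p1 q1 y0 y01 x0 n s CU Hp Hq Hy).
    - intros s Hst; rewrite !Cmod_mult, !Rmult_assoc.
      assert (Hs' : Rabs (s - x0) <= T) by lra.
      specialize (IH s Hs'); rewrite Rmult_assoc in IH.
      apply Rmult_le_compat; [apply Cmod_ge_0|apply Rmult_le_pos; apply Cmod_ge_0|now apply Hr|].
      apply Rmult_le_compat; auto. }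
  assert (Hfst : forall n t, Rabs (t - x0) <= T ->
     Cmod (fst (viter U p q p1 q1 y0 y01 x0 n) t) <= A * (/ sig) ^ n * exp (L * Rabs (t - x0))).
  { induction n as [|n IH]; intros t Ht.
    - simpl; rewrite Rmult_1_r; eapply Rle_trans; [now apply Hy'|].
      pose proof (exp_mono 0 (L * Rabs (t - x0)) ltac:(apply Rmult_le_pos; [lra|apply Rabs_pos])) as He.
      rewrite exp_0 in He; nra.
    - simpl fst; apply Cmod_minus_bound; rewrite !Cmod_mult.
      pose proof (Hint p n t bp (fun t => proj1 (solves_continuous W p p1 t Hp)) ltac:(lra) Hp' Ht IH) as I1.
      pose proof (Hint q n t bq (fun t => proj1 (solves_continuous W q q1 t Hq)) ltac:(lra) Hq' Ht IH) as I2.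
      set (E := exp (L * Rabs (t - x0))) in *; assert (HE : 0 < E) by apply exp_pos.
      apply Rle_trans with (bq * (bp * u * (A * (/ sig) ^ n) / L * E) + bp * (bq * u * (A * (/ sig) ^ n) / L * E)).
      + apply Rplus_le_compat; apply Rmult_le_compat; auto.
      + right; simpl; unfold L, b; field; repeat split; lra. }
  set (E := exp (L * T)).
  (* The three entries serve the function, the derivative at index 0, where nothing has been
     iterated yet, and the derivative at later indices, which is estimated from the preceding
     function. *)
  exists (Rmax (A * E) (Rmax A1 (b1 * sig * A / L * E))); intros n t Ht.
  assert (HE : exp (L * Rabs (t - x0)) <= E) by (apply exp_mono, Rmult_le_compat_l; lra).
  assert (Hsg : forall n, 0 < (/ sig) ^ n) by (intros; apply pow_lt, Rinv_0_lt_compat, Hs).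
  assert (Hss : forall n, (/ sig) ^ n * sig ^ n = 1).
  { intros m; rewrite <- Rpow_mult_distr, Rinv_l, pow1 by lra; reflexivity. }
  split.
  - eapply Rle_trans; [|apply Rmax_l].
    apply Rle_trans with (A * (/ sig) ^ n * E * sig ^ n).
    + apply Rmult_le_compat_r; [apply pow_le; lra|].
      eapply Rle_trans; [now apply Hfst|]; apply Rmult_le_compat_l; [|exact HE].
      specialize (Hsg n); apply Rmult_le_pos; lra.
    + replace (A * (/ sig) ^ n * E * sig ^ n) with (A * E * ((/ sig) ^ n * sig ^ n)) by ring; rewrite Hss; lra.
  - eapply Rle_trans; [|apply Rmax_r]; destruct n as [|n].
    + eapply Rle_trans; [|apply Rmax_l]; simpl; rewrite Rmult_1_r; auto.
    + eapply Rle_trans; [|apply Rmax_r].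
      apply Rle_trans with ((b1 * (A * (/ sig) ^ n) / L * E) * sig ^ S n).
      * apply Rmult_le_compat_r; [apply pow_le; lra|].
        simpl snd; apply Cmod_minus_bound; rewrite !Cmod_mult.
        pose proof (Hint p n t bp (fun t => proj1 (solves_continuous W p p1 t Hp)) ltac:(lra) Hp' Ht (Hfst n)) as I1.
        pose proof (Hint q n t bq (fun t => proj1 (solves_continuous W q q1 t Hq)) ltac:(lra) Hq' Ht (Hfst n)) as I2.
        set (e := exp (L * Rabs (t - x0))) in *; assert (He : 0 < e) by apply exp_pos.
        apply Rle_trans with (bq1 * (bp * u * (A * (/ sig) ^ n) / L * e) + bp1 * (bq * u * (A * (/ sig) ^ n) / L * e)).
        -- apply Rplus_le_compat; apply Rmult_le_compat; auto.
        -- replace (_ + _) with (b1 * (A * (/ sig) ^ n) / L * e) by (unfold b1; field; lra).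
           apply Rmult_le_compat_l; [|exact HE].
           specialize (Hsg n); apply Rdiv_le_0_compat; [|exact HL].
           apply Rmult_le_pos; [lra|]; apply Rmult_le_pos; lra.
      * replace (b1 * (A * (/ sig) ^ n) / L * E * sig ^ S n) with (b1 * sig * A / L * E * ((/ sig) ^ n * sig ^ n)) by (simpl; field; lra).
        rewrite Hss; lra. }
split; intros T sig HT Hs; destruct (Hmain T sig HT Hs) as [M HM]; exists M; intros n t Ht; apply HM, Ht.
Qed.

Lemma CInt_point (f : R -> C) (a : R) : CInt f a a = 0.
Proof. apply (is_CInt_unique f a a 0), (is_RInt_point (V := C_R_NormedModule)). Qed.

(** The summed iteration satisfies y = y0 + mu (q Ip - p Iq). On differentiation the terms with Ip'
    and Iq' cancel once, and the second time they produce mu U y times the Wronskian of p and q,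
    which is 1. The lemma serves twice: over y'' = 0 it gives existence, over y'' = V y with U = -1
    it gives entire dependence on the spectral parameter. *)
Lemma volterra (W U p q p1 q1 y0 y01 : R -> C) (x0 : R) :
  (forall t, ccontinuous U t) ->
  solves W p p1 -> solves W q q1 -> solves W y0 y01 ->
  (forall t, p t * q1 t - p1 t * q t = 1)%C ->
  exists y y1 : C -> R -> C,
   (forall mu, solves (fun t => W t + mu * U t)%C (y mu) (y1 mu) /\ y mu x0 = y0 x0 /\ y1 mu x0 = y01 x0) /\
   (forall t, ent (fun mu => y mu t) /\ ent (fun mu => y1 mu t)).
Proof.
intros CU Hp Hq Hy HW.
destruct (viter_rapid W U p q p1 q1 y0 y01 x0 CU Hp Hq Hy) as [R0 R1].
set (v := fun n => fst (viter U p q p1 q1 y0 y01 x0 n)) in R0.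
set (v1 := fun n => snd (viter U p q p1 q1 y0 y01 x0 n)) in R1.
assert (Cv : forall n t, ccontinuous (v n) t)
 by (intros n t; apply (viter_continuous W U p q p1 q1 y0 y01 x0 n t CU Hp Hq Hy)).
exists (ysum v), (ysum v1); split.
2: { intros t; split.
     - exists (fun n => v n t); split; [apply (locally_rapid_at v x0 t R0)|intros mu; apply (ysum_spec v x0 mu t R0)].
     - exists (fun n => v1 n t); split; [apply (locally_rapid_at v1 x0 t R1)|intros mu; apply (ysum_spec v1 x0 mu t R1)]. }
intros mu.
assert (Cy : forall t, ccontinuous (ysum v mu) t)
 by (intros t; now apply (continuous_ysum v x0)).
assert (CpU : forall t, ccontinuous (fun s => p s * U s)%C t)
 by (intros t; apply continuous_Cmult; [apply (solves_continuous W p p1 t Hp)|apply CU]).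
assert (CqU : forall t, ccontinuous (fun s => q s * U s)%C t)
 by (intros t; apply continuous_Cmult; [apply (solves_continuous W q q1 t Hq)|apply CU]).
set (Ip := fun t => CInt (fun s => p s * U s * ysum v mu s)%C x0 t).
set (Iq := fun t => CInt (fun s => q s * U s * ysum v mu s)%C x0 t).
assert (SIp : forall t, is_Cseries (fun n => CInt (fun s => p s * U s * v n s)%C x0 t * Cpow mu n)%C (Ip t))
 by (intros t; now apply (CInt_ysum v (fun s => p s * U s)%C)).
assert (SIq : forall t, is_Cseries (fun n => CInt (fun s => q s * U s * v n s)%C x0 t * Cpow mu n)%C (Iq t))
 by (intros t; now apply (CInt_ysum v (fun s => q s * U s)%C)).
assert (Ey : forall t, ysum v mu t = (y0 t + mu * (q t * Ip t - p t * Iq t))%C).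
{ intros t; eapply is_Cseries_unique; [apply (ysum_spec v x0 mu t R0)|].
  eapply is_Cseries_eq.
  - apply is_Cseries_shift.
    eapply is_Cseries_ext; [|apply (is_Cseries_scal mu), is_Cseries_minus;
      [exact (is_Cseries_scal (q t) _ _ (SIp t))|exact (is_Cseries_scal (p t) _ _ (SIq t))]].
    intros n; change (v (S n) t) with (q t * CInt (fun s => p s * U s * v n s) x0 t - p t * CInt (fun s => q s * U s * v n s) x0 t)%C.
    cbv beta; rewrite Cpow_S; ring.
  - unfold v; simpl; ring. }
assert (Ey1 : forall t, ysum v1 mu t = (y01 t + mu * (q1 t * Ip t - p1 t * Iq t))%C).
{ intros t; eapply is_Cseries_unique; [apply (ysum_spec v1 x0 mu t R1)|].
  eapply is_Cseries_eq.
  - apply is_Cseries_shift.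
    eapply is_Cseries_ext; [|apply (is_Cseries_scal mu), is_Cseries_minus;
      [exact (is_Cseries_scal (q1 t) _ _ (SIp t))|exact (is_Cseries_scal (p1 t) _ _ (SIq t))]].
    intros n; change (v1 (S n) t) with (q1 t * CInt (fun s => p s * U s * v n s) x0 t - p1 t * CInt (fun s => q s * U s * v n s) x0 t)%C.
    cbv beta; rewrite Cpow_S; ring.
  - unfold v1; simpl; ring. }
assert (DIp : forall t, is_derive Ip t (p t * U t * ysum v mu t)%C).
{ intros t; apply (is_derive_CInt (fun s => p s * U s * ysum v mu s)%C); intros; apply continuous_Cmult; auto. }
assert (DIq : forall t, is_derive Iq t (q t * U t * ysum v mu t)%C).
{ intros t; apply (is_derive_CInt (fun s => q s * U s * ysum v mu s)%C); intros; apply continuous_Cmult; auto. }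
destruct Hp as [Hp Hp1], Hq as [Hq Hq1], Hy as [Hy Hy1].
split; [split|].
- intros t; apply (is_derive_Cext (fun t => y0 t + mu * (q t * Ip t - p t * Iq t))%C); [now intros; rewrite Ey|].
  eapply is_derive_Ceq.
  + apply is_derive_Cplus; [apply Hy|]; apply is_derive_Cscal, is_derive_Cminus; apply is_derive_Cmult; auto.
  + cbv beta; rewrite Ey1; ring.
- intros t; apply (is_derive_Cext (fun t => y01 t + mu * (q1 t * Ip t - p1 t * Iq t))%C); [now intros; rewrite Ey1|].
  eapply is_derive_Ceq.
  + apply is_derive_Cplus; [apply Hy1|]; apply is_derive_Cscal, is_derive_Cminus; apply is_derive_Cmult; auto.
  + cbv beta.
    transitivity (W t * (y0 t + mu * (q t * Ip t - p t * Iq t)) + mu * U t * ysum v mu t * (p t * q1 t - p1 t * q t))%C; [ring|].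
    rewrite HW, <- Ey; ring.
- rewrite Ey, Ey1; unfold Ip, Iq; rewrite !CInt_point; split; ring.
Qed.

Lemma solves_ext (W W' y y1 : R -> C) : (forall t, W t = W' t) -> solves W y y1 -> solves W' y y1.
Proof. intros H [H1 H2]; split; [exact H1|]; intros t; rewrite <- H; apply H2. Qed.

Lemma solves_lin (W y y1 z z1 : R -> C) (a b : C) : solves W y y1 -> solves W z z1 ->
  solves W (fun t => a * y t + b * z t)%C (fun t => a * y1 t + b * z1 t)%C.
Proof.
intros [Hy Hy1] [Hz Hz1]; split; intros t.
- apply is_derive_Cplus; apply is_derive_Cscal; auto.
- eapply is_derive_Ceq; [apply is_derive_Cplus; apply is_derive_Cscal; auto|cbv beta; ring].
Qed.

Lemma solution_exists (W : R -> C) (x0 : R) (a b : C) :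
  (forall t, ccontinuous W t) ->
  exists y y1, solves W y y1 /\ y x0 = a /\ y1 x0 = b.
Proof.
intros CW.
(* The whole potential is treated as a perturbation of y'' = 0, with base solutions 1 and t - x0 and
   the parameter set to 1. *)
assert (H1 : solves (fun _ => 0) (fun _ => 1) (fun _ => 0)).
{ split; intros t; [apply is_derive_Cconst|].
  eapply is_derive_Ceq; [apply is_derive_Cconst|ring]. }
assert (H2 : solves (fun _ => 0) (fun t => RtoC t - x0)%C (fun _ => 1)).
{ split; intros t.
  - eapply is_derive_Ceq; [apply is_derive_Cminus; [apply is_derive_RtoC|apply is_derive_Cconst]|ring].
  - eapply is_derive_Ceq; [apply is_derive_Cconst|cbv beta; ring]. }
destruct (volterra (fun _ => 0) W _ _ _ _ _ _ x0 CW H1 H2 (solves_lin _ _ _ _ _ a b H1 H2)) as (y & y1 & Hy & _).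
{ intros t; ring. }
destruct (Hy 1) as (Hs & Ha & Hb).
exists (y 1), (y1 1); split; [|split].
- eapply solves_ext; [|exact Hs]; intros t; simpl; ring.
- rewrite Ha; ring.
- rewrite Hb; ring.
Qed.

(* Both components come from the Wronskians of y with c and s. *)
Lemma solution_basis (W c c1 s s1 y y1 : R -> C) (x0 t : R) :
  solves W c c1 -> solves W s s1 -> solves W y y1 ->
  c x0 = 1 -> c1 x0 = 0 -> s x0 = 0 -> s1 x0 = 1 ->
  (c t * s1 t - c1 t * s t = 1)%C /\
  y t = (y x0 * c t + y1 x0 * s t)%C /\ y1 t = (y x0 * c1 t + y1 x0 * s1 t)%C.
Proof.
intros Hc Hs Hy Ec Ec1 Es Es1.
pose proof (wronskian_const W c c1 s s1 t x0 Hc Hs) as Wcs.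
pose proof (wronskian_const W y y1 s s1 t x0 Hy Hs) as Wys.
pose proof (wronskian_const W y y1 c c1 t x0 Hy Hc) as Wyc.
rewrite Ec, Ec1, Es, Es1 in *.
assert (Hcs : (c t * s1 t - c1 t * s t = 1)%C) by (rewrite Wcs; ring).
split; [exact Hcs|]; split.
- transitivity (y t * (c t * s1 t - c1 t * s t))%C; [rewrite Hcs; ring|].
  transitivity (c t * (y t * s1 t - y1 t * s t) - s t * (y t * c1 t - y1 t * c t))%C; [ring|].
  rewrite Wys, Wyc; ring.
- transitivity (y1 t * (c t * s1 t - c1 t * s t))%C; [rewrite Hcs; ring|].
  transitivity (c1 t * (y t * s1 t - y1 t * s t) - s1 t * (y t * c1 t - y1 t * c t))%C; [ring|].
  rewrite Wys, Wyc; ring.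
Qed.

Lemma is_ivp_sol_solves (V : R -> C) (lam : C) (x0 : R) (a b : C) (fg : (R -> C) * (R -> C)) :
  is_ivp_sol V lam x0 a b fg <->
  solves (fun t => V t - lam)%C (fst fg) (snd fg) /\ fst fg x0 = a /\ snd fg x0 = b.
Proof. unfold is_ivp_sol, solves; tauto. Qed.

Lemma solution_unique (W y y1 z z1 : R -> C) (x0 t : R) :
  (forall t, ccontinuous W t) ->
  solves W y y1 -> solves W z z1 -> y x0 = z x0 -> y1 x0 = z1 x0 -> y t = z t /\ y1 t = z1 t.
Proof.
intros CW Hy Hz E E1.
destruct (solution_exists W x0 1 0 CW) as (c & c1 & Hc & Ec & Ec1).
destruct (solution_exists W x0 0 1 CW) as (s & s1 & Hs & Es & Es1).
destruct (solution_basis W c c1 s s1 y y1 x0 t) as (_ & A & A1); auto.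
destruct (solution_basis W c c1 s s1 z z1 x0 t) as (_ & B & B1); auto.
rewrite A, A1, B, B1, E, E1; auto.
Qed.

Lemma ivp_sol_spec (V : R -> C) (lam : C) (x0 : R) (a b : C) :
  (forall t, ccontinuous V t) ->
  is_ivp_sol V lam x0 a b (ivp_sol V lam x0 a b).
Proof.
intros CV; unfold ivp_sol; apply epsilon_spec.
destruct (solution_exists (fun t => V t - lam)%C x0 a b) as (y & y1 & H).
- intros t; apply continuous_Cminus; [apply CV|apply continuous_Cconst].
- exists (y, y1); now apply is_ivp_sol_solves.
Qed.

Lemma ivp_sol_solves (V : R -> C) (lam : C) (x0 : R) (a b : C) :
  (forall t, ccontinuous V t) ->
  solves (fun t => V t - lam)%C (fst (ivp_sol V lam x0 a b)) (snd (ivp_sol V lam x0 a b)) /\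
  fst (ivp_sol V lam x0 a b) x0 = a /\ snd (ivp_sol V lam x0 a b) x0 = b.
Proof. intros CV; now apply is_ivp_sol_solves, ivp_sol_spec. Qed.

(** With U = -1 the perturbation parameter is [lam] itself, so the Volterra series is a power series
    in [lam]. Uniqueness identifies the solution picked by [epsilon], separately for each [lam],
    with its sum. *)
Lemma ivp_sol_entire (V : R -> C) (x0 : R) (a b : C) (t : R) :
  (forall t, ccontinuous V t) ->
  ent (fun lam => fst (ivp_sol V lam x0 a b) t) /\ ent (fun lam => snd (ivp_sol V lam x0 a b) t).
Proof.
intros CV.
destruct (solution_exists V x0 1 0 CV) as (c & c1 & Hc & Ec & Ec1).
destruct (solution_exists V x0 0 1 CV) as (s & s1 & Hs & Es & Es1).
destruct (volterra V (fun _ => - 1)%C c s c1 s1 _ _ x0 (fun _ => continuous_Cconst _ _) Hc Hs (solves_lin _ _ _ _ _ a b Hc Hs)) as (y & y1 & Hy & He).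
{ intros r; apply (solution_basis V c c1 s s1 c c1 x0 r); auto. }
assert (E : forall lam, fst (ivp_sol V lam x0 a b) t = y lam t /\ snd (ivp_sol V lam x0 a b) t = y1 lam t).
{ intros lam; destruct (ivp_sol_solves V lam x0 a b CV) as (H & Ha & Hb).
  destruct (Hy lam) as (H' & Ha' & Hb').
  rewrite Ec, Es in Ha'; rewrite Ec1, Es1 in Hb'.
  apply (solution_unique (fun t => V t - lam)%C _ _ _ _ x0 t); auto.
  - intros r; apply continuous_Cminus; [apply CV|apply continuous_Cconst].
  - eapply solves_ext; [|exact H']; intros r; simpl; ring.
  - rewrite Ha, Ha'; ring.
  - rewrite Hb, Hb'; ring. }
destruct (He t) as [H1 H2]; split; [eapply ent_ext; [|exact H1]|eapply ent_ext; [|exact H2]]; intros lam; symmetry; apply E.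
Qed.

(** * Mean value property and residues on circles *)

(* n-fold complex differentiability on U; [holn 0] is no condition at all. *)
Fixpoint holn (n : nat) (U : C -> Prop) (f : C -> C) : Prop :=
  match n with
  | O => True
  | S m => exists f', (forall w, U w -> is_Cderive f w (f' w)) /\ holn m U f'
  end.

Lemma holn_mono (n : nat) (U : C -> Prop) (f : C -> C) : holn (S n) U f -> holn n U f.
Proof.
revert f; induction n as [|n IH]; intros f; [easy|].
intros (f' & H1 & H2); exists f'; split; [exact H1|apply IH, H2].
Qed.

Lemma holn_plus (n : nat) (U : C -> Prop) (f g : C -> C) :
  holn n U f -> holn n U g -> holn n U (fun w => f w + g w)%C.
Proof.
revert f g; induction n as [|n IH]; intros f g; [easy|].
intros (f' & H1 & H2) (g' & H3 & H4).
exists (fun w => f' w + g' w)%C; split; [|now apply IH].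
intros w Hw; apply is_Cderive_plus; auto.
Qed.

Lemma holn_mult (n : nat) (U : C -> Prop) (f g : C -> C) :
  holn n U f -> holn n U g -> holn n U (fun w => f w * g w)%C.
Proof.
revert f g; induction n as [|n IH]; intros f g; [easy|].
intros Hf Hg; pose proof (holn_mono _ _ _ Hf) as Hf0; pose proof (holn_mono _ _ _ Hg) as Hg0.
destruct Hf as (f' & H1 & H2), Hg as (g' & H3 & H4).
exists (fun w => f' w * g w + f w * g' w)%C; split; [|apply holn_plus; now apply IH].
intros w Hw; apply is_Cderive_mult; auto.
Qed.

Lemma holn_const (n : nat) (U : C -> Prop) (c : C) : holn n U (fun _ => c).
Proof.
revert c; induction n as [|n IH]; intros c; [easy|].
exists (fun _ => 0); split; [intros; apply is_Cderive_const|apply IH].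
Qed.

Lemma holn_id (n : nat) (U : C -> Prop) : holn n U (fun w => w).
Proof.
destruct n; [easy|].
exists (fun _ => 1); split; [intros; apply is_Cderive_id|apply holn_const].
Qed.

Lemma holn_pow (n : nat) (U : C -> Prop) (j : nat) : holn n U (fun w => Cpow w j).
Proof.
induction j as [|j IH]; [exact (holn_const n U 1)|].
apply (holn_mult n U (fun w => w) (fun w => Cpow w j)); [apply holn_id|exact IH].
Qed.

Lemma holn_inv (n : nat) (U : C -> Prop) (f : C -> C) :
  (forall w, U w -> f w <> 0) -> holn n U f -> holn n U (fun w => / f w)%C.
Proof.
intros Hn; induction n as [|n IH]; [easy|].
intros Hf; specialize (IH (holn_mono _ _ _ Hf)); destruct Hf as (f' & H1 & H2).
exists (fun w => (-1 * f' w) * (/ f w * / f w))%C; split.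
- intros w Hw; eapply is_Cderive_eq; [apply is_Cderive_inv; auto|].
  field; auto.
- apply holn_mult; apply holn_mult; auto using holn_const.
Qed.

Lemma holn_comp_affine (n : nat) (U : C -> Prop) (c a : C) (f : C -> C) :
  holn n U f -> holn n (fun w => U (c + a * w)%C) (fun w => f (c + a * w)%C).
Proof.
revert f; induction n as [|n IH]; intros f; [easy|].
intros (f' & H1 & H2).
exists (fun w => a * f' (c + a * w))%C; split.
- intros w Hw; eapply is_Cderive_eq.
  + apply (is_Cderive_comp f (fun w => c + a * w)%C); [now apply H1|].
    apply is_Cderive_plus; [apply is_Cderive_const|apply is_Cderive_mult; [apply is_Cderive_const|apply is_Cderive_id]].
  + cbv beta; ring.
- apply (holn_mult n _ (fun _ => a)); [apply holn_const|now apply IH].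
Qed.

Lemma holn_ext (n : nat) (U : C -> Prop) (f g : C -> C) :
  (forall w, f w = g w) -> holn n U f -> holn n U g.
Proof.
intros H; destruct n; [easy|].
intros (f' & H1 & H2); exists f'; split; [|exact H2].
intros w Hw; apply (is_Cderive_ext f); auto.
Qed.

Lemma holn_subset (n : nat) (U U' : C -> Prop) (f : C -> C) :
  (forall w, U' w -> U w) -> holn n U f -> holn n U' f.
Proof.
intros H; revert f; induction n as [|n IH]; intros f; [easy|].
intros (f' & H1 & H2); exists f'; auto.
Qed.

Lemma ent_holn (n : nat) (U : C -> Prop) (f : C -> C) : ent f -> holn n U f.
Proof.
revert f; induction n as [|n IH]; intros f Hf; [easy|].
destruct (ent_derive f Hf) as (f' & H1 & H2).
exists f'; auto.
Qed.

(** For sig = 2 or sig = -2 the interval from 0 to [PI] runs exactly once around the unit circle;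
    the negative sign is needed for the reciprocal of a point on the circle. *)
Definition circ (sig t : R) : C := cexp (Ci * sig * t).

Lemma Cmod_circ (sig t : R) : Cmod (circ sig t) = 1.
Proof.
unfold circ; rewrite Cmod_cexp, <- exp_0; f_equal; simpl; ring.
Qed.

Lemma Cmod_Rcirc (r sig t : R) : 0 <= r -> Cmod (r * circ sig t) = r.
Proof. intros H; rewrite Cmod_mult, Cmod_circ, Cmod_R, Rabs_pos_eq; lra. Qed.

Lemma is_derive_circ (sig t : R) : is_derive (circ sig) t (Ci * sig * circ sig t)%C.
Proof. apply (is_derive_cexp_lin (Ci * sig)%C t). Qed.

Lemma circ_0 (sig : R) : circ sig 0 = 1.
Proof. unfold circ; rewrite <- cexp_0; f_equal; ring. Qed.

Lemma Cderive_continuous (f : C -> C) (z l : C) : is_Cderive f z l ->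
  continuous (T := C_UniformSpace) (U := C_UniformSpace) f z.
Proof.
intros H; destruct (Cderive_bounded f z l H) as (d & Hd & Hb).
pose proof (Cmod_ge_0 l).
apply (filterlim_locally_ball_norm (K := C_AbsRing) (U := C_NormedModule)).
intros e.
assert (Hm : 0 < Rmin d (e / (Cmod l + 1))).
{ apply Rmin_pos; [exact Hd|apply Rdiv_lt_0_compat; [apply cond_pos|lra]]. }
apply (filter_imp (ball_norm (K := C_AbsRing) (V := C_NormedModule) z (mkposreal _ Hm))).
2: apply (locally_ball_norm (K := C_AbsRing) (V := C_NormedModule)).
intros w Hw.
assert (Hw' : Cmod (w - z) < Rmin d (e / (Cmod l + 1))) by exact Hw.
change (Cmod (f w - f z) < e).
eapply Rle_lt_trans; [apply Hb; eapply Rlt_le_trans; [exact Hw'|apply Rmin_l]|].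
assert (Hw2 : Cmod (w - z) < e / (Cmod l + 1)) by (eapply Rlt_le_trans; [exact Hw'|apply Rmin_r]).
apply (Rmult_lt_compat_l (Cmod l + 1)) in Hw2; [|lra].
replace ((Cmod l + 1) * (e / (Cmod l + 1))) with (pos e) in Hw2 by (field; lra); exact Hw2.
Qed.

Notation R2 := (prod_UniformSpace R_UniformSpace R_UniformSpace).

(* d/ds of the integral over the circle of radius s is a full-turn integral of a theta-derivative. *)
Lemma mean_value_Re (phi : C -> C) (r r' sig : R) : sig <> 0 -> circ sig PI = 1 -> 0 < r < r' ->
  holn 2 (fun w => Cmod w < r') phi ->
  is_RInt (fun t => Re (phi (r * circ sig t)%C)) 0 PI (PI * Re (phi 0)).
Proof.
(* The second derivative is used only for the continuity of [phi'], which differentiation under the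
   integral sign requires. *)
intros Hsig Hper Hr (phi' & Hphi & phi'' & Hphi' & _).
pose proof PI_RGT_0 as HPI.
assert (Hmod : forall (s t : R), Cmod (s * circ sig t) = Rabs s).
{ intros s t; rewrite Cmod_mult, Cmod_circ, Cmod_R; ring. }
assert (Ds : forall (s t : R), Rabs s < r' ->
  is_derive (fun s : R => Re (phi (s * circ sig t)%C)) s (Re (circ sig t * phi' (s * circ sig t)))%C).
{ intros s t Hs.
  apply (is_derive_RC_parts (fun s : R => phi (s * circ sig t)%C) s (circ sig t * phi' (s * circ sig t))%C).
  apply (is_derive_Ccomp phi (fun s : R => (s * circ sig t)%C)).
  - apply Hphi; rewrite Hmod; exact Hs.
  - eapply is_derive_Ceq; [apply is_derive_Cmult; [apply is_derive_RtoC|apply is_derive_Cconst]|cbv beta; ring]. }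
assert (Dt : forall (s t : R), Rabs s < r' ->
  is_derive (fun t => phi (s * circ sig t)%C) t (Ci * sig * s * (circ sig t * phi' (s * circ sig t)))%C).
{ intros s t Hs; eapply is_derive_Ceq.
  - apply (is_derive_Ccomp phi (fun t : R => (s * circ sig t)%C)).
    + apply Hphi; rewrite Hmod; exact Hs.
    + apply is_derive_Cscal, is_derive_circ.
  - ring. }
assert (Dc : forall t, ccontinuous (circ sig) t)
 by exact (is_derive_all_continuous _ _ (is_derive_circ sig)).
assert (Cpsi2 : forall (s t : R), Rabs s < r' ->
  continuous (T := R2) (U := C_UniformSpace)
   (fun z => circ sig (snd z) * phi' (RtoC (fst z) * circ sig (snd z)))%C (s, t)).
{ intros s t Hs.
  assert (C1 : continuous (T := R2) (U := C_UniformSpace) (fun z => circ sig (snd z)) (s, t)).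
  { apply (continuous_comp (snd (A := R) (B := R)) (circ sig)); [apply continuous_snd|apply Dc]. }
  apply continuous_Cmult; [exact C1|].
  apply (continuous_comp (U := R2) (V := C_UniformSpace) (W := C_UniformSpace)
    (fun z => RtoC (fst z) * circ sig (snd z))%C phi').
  - apply continuous_Cmult; [|exact C1].
    apply (continuous_comp (fst (A := R) (B := R)) RtoC); [apply continuous_fst|].
    apply (is_derive_continuous _ _ _ (is_derive_RtoC s)).
  - simpl; eapply Cderive_continuous; apply Hphi'; rewrite Hmod; exact Hs. }
assert (Cpsi : forall (s t : R), Rabs s < r' -> ccontinuous (fun t => circ sig t * phi' (s * circ sig t))%C t).
{ intros s t Hs; apply continuous_Cmult; [apply Dc|].
  apply (continuous_comp (U := R_UniformSpace) (V := C_UniformSpace) (W := C_UniformSpace) (fun t => s * circ sig t)%C phi').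
  - apply continuous_Cmult; [apply continuous_Cconst|apply Dc].
  - eapply Cderive_continuous; apply Hphi'; rewrite Hmod; exact Hs. }
(* For s <> 0 the integrand is the t-derivative of phi(s circ) / (i sig s), a function taking equal
   values at both ends; at s = 0 this division is impossible, but there the integrand is a constant
   multiple of the derivative of [circ]. *)
assert (I0 : forall s : R, Rabs s < r' -> is_CInt (fun t => circ sig t * phi' (s * circ sig t))%C 0 PI 0).
{ intros s Hs.
  assert (Hsg : RtoC sig <> 0) by now apply RtoC_nz.
  destruct (Req_dec s 0) as [->|Hs0].
  - eapply is_CInt_change; [apply (is_CInt_scal (phi' 0 / (Ci * sig))%C), (is_CInt_derive (circ sig) (fun t => Ci * sig * circ sig t)%C)| |].
    + intros t _; apply is_derive_circ.
    + intros t _; apply continuous_Cmult; [apply continuous_Cconst|apply Dc].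
    + intros t _; cbv beta; replace (0 * circ sig t)%C with (RtoC 0) by ring; field; auto.
    + rewrite Hper, circ_0; ring.
  - assert (Hss : RtoC s <> 0) by now apply RtoC_nz.
    eapply is_CInt_change; [apply (is_CInt_scal (/ (Ci * sig * s))%C), (is_CInt_derive (fun t => phi (s * circ sig t)%C)
      (fun t => Ci * sig * s * (circ sig t * phi' (s * circ sig t)))%C)| |].
    + intros t _; now apply Dt.
    + intros t _; apply continuous_Cmult; [apply continuous_Cconst|now apply Cpsi].
    + intros t _; cbv beta; field; auto.
    + rewrite Hper, circ_0; ring. }
set (f := fun s t : R => Re (phi (s * circ sig t)%C)).
assert (Hloc : forall s : R, Rabs s < r' -> locally s (fun s => Rabs s < r')).
{ intros s Hs; exists (mkposreal (r' - Rabs s) ltac:(lra)); intros u Hu.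
  assert (Hu' : Rabs (u - s) < r' - Rabs s) by exact Hu.
  replace u with ((u - s) + s) by ring; eapply Rle_lt_trans; [apply Rabs_triang|lra]. }
assert (Ef : forall s : R, Rabs s < r' -> ex_RInt (f s) 0 PI).
{ intros s Hs; apply (ex_RInt_continuous (V := R_CompleteNormedModule)); intros t _.
  apply (continuous_RC_parts (fun t => phi (s * circ sig t)%C) t).
  eapply is_derive_continuous; now apply Dt. }
assert (DI : forall s : R, Rabs s < r' -> is_derive (fun s => RInt (f s) 0 PI) s 0).
{ intros s Hs.
  assert (Hd : is_derive (fun s => RInt (f s) 0 PI) s (RInt (fun t => Derive (fun u => f u t) s) 0 PI)).
  { apply (is_derive_RInt_param f 0 PI s).
    - generalize (Hloc s Hs); apply filter_imp; intros u Hu t _.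
      eexists; apply Ds, Hu.
    - intros t _.
      apply (continuity_2d_pt_ext_loc (fun u v : R => Re (circ sig v * phi' (u * circ sig v)))%C).
      + destruct (Hloc s Hs) as [d Hd]; exists d; intros u v Hu _.
        symmetry; apply is_derive_unique, Ds, Hd, Hu.
      + apply continuity_2d_pt_filterlim.
        apply (continuous_RC_parts (T := R2)
          (fun z => circ sig (snd z) * phi' (RtoC (fst z) * circ sig (snd z)))%C (s, t)), Cpsi2, Hs.
    - generalize (Hloc s Hs); apply filter_imp; exact Ef. }
  eapply is_derive_eq; [exact Hd|].
  rewrite (RInt_ext _ (fun t => Re (circ sig t * phi' (s * circ sig t))%C)).
  - apply (is_RInt_unique (V := R_CompleteNormedModule)).
    apply (proj1 (is_CInt_parts _ _ _ _) (I0 s Hs)).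
  - intros t _; apply is_derive_unique, Ds, Hs. }
assert (Hconst : RInt (f 0) 0 PI = RInt (f r) 0 PI).
{ apply (eq_is_derive (V := R_NormedModule) (fun s => RInt (f s) 0 PI)); [|lra].
  intros s Hs; apply DI; rewrite Rabs_pos_eq; lra. }
assert (Hr' : Rabs r < r') by (rewrite Rabs_pos_eq; lra).
pose proof (RInt_correct (V := R_CompleteNormedModule) _ _ _ (Ef r Hr')) as H.
rewrite <- Hconst in H.
replace (PI * Re (phi 0)) with (RInt (f 0) 0 PI); [exact H|].
apply (is_RInt_unique (V := R_CompleteNormedModule)).
apply (is_RInt_ext (V := R_NormedModule) (fun _ => Re (phi 0))).
- intros t _; unfold f; do 2 f_equal; ring.
- replace (PI * Re (phi 0)) with (scal (PI - 0) (Re (phi 0))) by (unfold scal; simpl; unfold mult; simpl; ring).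
  apply (is_RInt_const (V := R_NormedModule)).
Qed.

(** The imaginary part of phi is the real part of -i phi, so the real version is applied twice. *)
Lemma mean_value (phi : C -> C) (r r' sig : R) : sig <> 0 -> circ sig PI = 1 -> 0 < r < r' ->
  holn 2 (fun w => Cmod w < r') phi ->
  is_CInt (fun t => phi (r * circ sig t)%C) 0 PI (PI * phi 0)%C.
Proof.
intros Hsig Hper Hr Hphi; apply is_CInt_parts; rewrite re_scal_l, im_scal_l; split.
- now apply (mean_value_Re phi r r').
- assert (H : holn 2 (fun w => Cmod w < r') (fun w => (- Ci) * phi w)%C)
   by (apply (holn_mult 2 _ (fun _ => - Ci)%C); [apply holn_const|exact Hphi]).
  pose proof (mean_value_Re _ r r' sig Hsig Hper Hr H) as HI.
  assert (E : forall w, Re (- Ci * w) = Im w) by (intros [a b]; simpl; ring).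
  cbv beta in HI; rewrite E in HI.
  eapply (is_RInt_ext (V := R_NormedModule)); [|exact HI].
  intros t _; apply E.
Qed.

Lemma circ_period (sig : R) : sig = 2 \/ sig = - 2 -> circ sig PI = 1.
Proof.
intros H; unfold circ, cexp.
replace (Re (Ci * sig * PI)) with 0 by (simpl; ring).
replace (Im (Ci * sig * PI)) with (sig * PI) by (simpl; ring).
rewrite exp_0; destruct H as [-> | ->]; apply C_eq; simpl.
- rewrite cos_2PI; ring.
- rewrite sin_2PI; ring.
- replace (- 2 * PI) with (- (2 * PI)) by ring; rewrite cos_neg, cos_2PI; ring.
- replace (- 2 * PI) with (- (2 * PI)) by ring; rewrite sin_neg, sin_2PI; ring.
Qed.

(** Delta^2 - 1 = (Delta - 1)(Delta + 1), N^2 and lam (Delta^2 - 1) are products of entire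
    functions. Closing the class under products formally dispenses with multiplying series, and a
    zero of a product is divided out of a vanishing factor. *)
Inductive entp : (C -> C) -> Prop :=
| entp_ent f : ent f -> entp f
| entp_mult f g h : entp f -> entp g -> (forall z, h z = f z * g z)%C -> entp h.

Lemma entp_holn (n : nat) (U : C -> Prop) (f : C -> C) : entp f -> holn n U f.
Proof.
induction 1 as [f Hf|f g h _ IHf _ IHg E]; [now apply ent_holn|].
eapply holn_ext; [intros w; symmetry; apply E|now apply holn_mult].
Qed.

Lemma entp_div (f : C -> C) (z0 : C) : entp f -> f z0 = 0 ->
  exists g, entp g /\ forall w, f w = ((w - z0) * g w)%C.
Proof.
induction 1 as [f Hf|f g h Hf IHf Hg IHg E]; intros H0.
- destruct (ent_div f z0 Hf H0) as (g & Hg & Eg); exists g; split; [now constructor|exact Eg].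
- rewrite E in H0.
  destruct (Ceq_dec (f z0) 0) as [Hz|Hz].
  + destruct (IHf Hz) as (f1 & Hf1 & E1).
    exists (fun w => f1 w * g w)%C; split; [now apply (entp_mult f1 g)|].
    intros w; rewrite E, E1; ring.
  + destruct (Ceq_dec (g z0) 0) as [Hz'|Hz']; [|now destruct (Cmult_neq_0 _ _ Hz Hz')].
    destruct (IHg Hz') as (g1 & Hg1 & E1).
    exists (fun w => f w * g1 w)%C; split; [now apply (entp_mult f g1)|].
    intros w; rewrite E, E1; ring.
Qed.

Lemma ent_id : ent (fun w => w).
Proof.
exists (fun n => match n with 1%nat => RtoC 1 | _ => RtoC 0 end); split.
- intros sig Hs; exists sig; intros [|[|n]]; simpl; rewrite ?Cmod_0, ?Cmod_1; lra.
- intros z; apply is_Cseries_eps; intros e He; exists 1%nat; intros n Hn.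
  replace (Csum _ n) with z; [unfold Cminus; rewrite Cplus_opp_r, Cmod_0; exact He|].
  destruct n as [|n]; [lia|]; clear Hn; induction n as [|n IH].
  + rewrite Csum_S, Csum_O; simpl; ring.
  + rewrite Csum_S, <- IH; ring.
Qed.

Lemma entp_derivative (f : C -> C) : entp f -> exists f', forall w, is_Cderive f w (f' w).
Proof.
intros H; destruct (entp_holn 1 (fun _ => True) f H) as (f' & H1 & _).
exists f'; intros w; now apply H1.
Qed.

Fixpoint Pol (zs : list C) (w : C) : C :=
  match zs with
  | [] => 1
  | z :: zs' => ((w - z) * Pol zs' w)%C
  end.

Lemma Pol_app (zs ws : list C) (w : C) : Pol (zs ++ ws) w = (Pol zs w * Pol ws w)%C.
Proof. induction zs as [|z zs IH]; simpl; [ring|rewrite IH; ring]. Qed.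

Lemma ent_Pol (zs : list C) : entp (Pol zs).
Proof.
induction zs as [|z zs IH]; [apply entp_ent, ent_const|].
apply (entp_mult (fun w => w - z)%C (Pol zs)); [|exact IH|reflexivity].
apply entp_ent; eapply ent_ext; [|apply (ent_lin 1 (- z)%C (fun w => w) (fun _ => 1) ent_id (ent_const 1))].
intros w; simpl; ring.
Qed.

Lemma Pol_eq_0 (zs : list C) (w : C) : Pol zs w = 0 <-> In w zs.
Proof.
induction zs as [|z zs IH]; simpl; [split; [intros H; now apply C1_nz in H|easy]|].
rewrite <- IH; split.
- intros H; destruct (Ceq_dec (w - z) 0) as [Hz|Hz].
  + left; symmetry; now apply Ceq_minus.
  + right; destruct (Ceq_dec (Pol zs w) 0) as [|Hp]; [assumption|now destruct (Cmult_neq_0 _ _ Hz Hp)].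
- intros [->|H]; [ring|rewrite H; ring].
Qed.

(* On a circle around c of radius more than three times the distance to all roots z_i, each |w - z_i|
   exceeds 2|c - z_i|, so every root halves the bound that the mean value property gives for |f(c)|. *)
Lemma roots_bounded (f : C -> C) (c : C) (r0 : R) : entp f -> f c <> 0 -> 0 <= r0 ->
  exists N, forall zs F, (forall z, In z zs -> Cmod z <= r0) -> entp F ->
    (forall w, f w = Pol zs w * F w)%C -> (length zs < N)%nat.
Proof.
intros Hf Hc Hr0; pose proof PI_RGT_0 as HPI.
pose proof (Cmod_ge_0 c).
set (a := Cmod c + r0); set (rho := 3 * a + 1).
assert (Ha : 0 <= a) by (unfold a; lra).
assert (Dc : forall t, is_derive (fun t => c + rho * circ 2 t)%C t (0 + rho * (Ci * 2 * circ 2 t))%C).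
{ intros t; apply is_derive_Cplus; [apply is_derive_Cconst|apply is_derive_Cscal, is_derive_circ]. }
destruct (entp_derivative f Hf) as [f' Hf'].
destruct (Cmod_bounded (fun t => f (c + rho * circ 2 t)%C) 0 PI) as (M & HM & HMb).
{ intros t; eapply is_derive_continuous; apply (is_derive_Ccomp f (fun t => c + rho * circ 2 t)%C); [apply Hf'|apply Dc]. }
rewrite Rmin_left, Rmax_right in HMb by lra.
(* With [N] or more roots the estimate |f c| <= M 2^(-N) would contradict this choice of [N]. *)
destruct (half_pow_small M (Cmod (f c))) as [N HN]; [now apply Cmod_gt_0|].
exists N; intros zs F Hzs HF E.
apply Nat.nle_gt; intros Hle; specialize (HN (length zs) Hle).
apply (Rlt_irrefl (Cmod (f c))); eapply Rle_lt_trans; [|exact HN].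
assert (Hup : Cmod (Pol zs c) <= a ^ length zs).
{ clear - Hzs; induction zs as [|z zs IH]; simpl; [rewrite Cmod_1; lra|].
  rewrite Cmod_mult; apply Rmult_le_compat; try apply Cmod_ge_0; [|apply IH; intros; apply Hzs; now right].
  apply Cmod_minus_bound; pose proof (Hzs z (or_introl eq_refl)); unfold a; lra. }
assert (Hlow : forall t, (2 * a + 1) ^ length zs <= Cmod (Pol zs (c + rho * circ 2 t)%C)).
{ intros t; clear - Hzs Ha; induction zs as [|z zs IH]; simpl; [rewrite Cmod_1; lra|].
  rewrite Cmod_mult; apply Rmult_le_compat; [lra|apply pow_le; lra| |apply IH; intros; apply Hzs; now right].
  replace (c + rho * circ 2 t - z)%C with (rho * circ 2 t - (z - c))%C by ring.
  eapply Rle_trans; [|apply Cmod_rev_triangle].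
  rewrite Cmod_mult, Cmod_circ, Cmod_R, Rabs_pos_eq by (unfold rho; lra).
  pose proof (Cmod_minus_le z c); pose proof (Hzs z (or_introl eq_refl)); unfold rho, a in *; lra. }
assert (Hp : 0 < (2 * a + 1) ^ length zs) by (apply pow_lt; lra).
assert (HFc : Cmod (F c) <= M / (2 * a + 1) ^ length zs).
{ assert (HI : is_CInt (fun t => F (c + 1 * (rho * circ 2 t))%C) 0 PI (PI * F (c + 1 * 0))%C).
  { apply (mean_value (fun w => F (c + 1 * w)%C) rho (rho + 1) 2); [lra|apply circ_period; auto|unfold rho; lra|].
    eapply holn_subset; [|apply (holn_comp_affine 2 (fun _ => True) c 1 F), entp_holn, HF]; easy. }
  apply is_CInt_norm_const with (M := M / (2 * a + 1) ^ length zs) in HI; [|lra|].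
  - replace (c + 1 * 0)%C with c in HI by ring.
    rewrite Cmod_mult, Cmod_R, Rabs_pos_eq in HI by lra.
    apply (Rmult_le_reg_l PI); [lra|]; lra.
  - intros t Ht; replace (c + 1 * (rho * circ 2 t))%C with (c + rho * circ 2 t)%C by ring.
    specialize (HMb t Ht); cbv beta in HMb; rewrite E, Cmod_mult in HMb; specialize (Hlow t).
    apply (Rmult_le_reg_l ((2 * a + 1) ^ length zs)); [exact Hp|].
    replace ((2 * a + 1) ^ length zs * (M / (2 * a + 1) ^ length zs)) with M by (field; lra).
    eapply Rle_trans; [|exact HMb]; apply Rmult_le_compat_r; [apply Cmod_ge_0|exact Hlow]. }
rewrite E, Cmod_mult.
apply Rle_trans with (a ^ length zs * (M / (2 * a + 1) ^ length zs)).
{ apply Rmult_le_compat; auto. }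
assert (Hq : a ^ length zs <= (2 * a + 1) ^ length zs * (/ 2) ^ length zs).
{ rewrite <- Rpow_mult_distr; apply pow_incr; lra. }
apply (Rmult_le_compat_r (M / (2 * a + 1) ^ length zs)) in Hq.
- eapply Rle_trans; [exact Hq|]; right; field; lra.
- apply Rlt_le, Rdiv_lt_0_compat; lra.
Qed.

Lemma is_Cderive_unique (f : C -> C) (z a b : C) : is_Cderive f z a -> is_Cderive f z b -> a = b.
Proof. intros Ha Hb; rewrite <- (is_C_derive_unique f z a Ha); now apply is_C_derive_unique. Qed.

(** * Power sums of zeros as integrals over circles *)

Fixpoint psum (j : nat) (zs : list C) : C :=
  match zs with
  | [] => 0
  | z :: zs' => (Cpow z j + psum j zs')%C
  end.

Lemma psum_0 (zs : list C) : psum 0 zs = INR (length zs).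
Proof.
induction zs as [|z zs IH]; [reflexivity|].
change (length (z :: zs)) with (S (length zs)).
rewrite S_INR, RtoC_plus; simpl; rewrite IH; ring.
Qed.

Lemma psum_app (j : nat) (zs ws : list C) : psum j (zs ++ ws) = (psum j zs + psum j ws)%C.
Proof. induction zs as [|z zs IH]; simpl; [ring|rewrite IH; ring]. Qed.

Lemma circ_opp (sig t : R) : (circ sig t * circ (- sig) t = 1)%C.
Proof. unfold circ; rewrite <- cexp_plus, <- cexp_0; f_equal; rewrite RtoC_opp; ring. Qed.

(** As dl = 2 i l dt on the circle, this is the residue of l^j / (l - z); hence the exponent [S j].
    For j = 0 the integrand is 1 / (1 - z w) with w = 1/l, and the mean value over the circle of
    radius 1/rho is its value 1 at w = 0. The induction uses l^(j+2) / (l - z) = l^(j+1) + z l^(j+1)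
    / (l - z). *)
Lemma residue_pole (rho : R) (z : C) (j : nat) : Cmod z < rho ->
  is_CInt (fun t => let l := (rho * circ 2 t)%C in Cpow l (S j) / (l - z))%C 0 PI (PI * Cpow z j)%C.
Proof.
intros Hz; pose proof (Cmod_ge_0 z).
assert (Hrho : RtoC rho <> 0) by (apply RtoC_nz; lra).
assert (Hl0 : forall t, (rho * circ 2 t)%C <> 0).
{ intros t; apply Cmod_gt_0; rewrite Cmod_Rcirc; lra. }
assert (Hlz : forall t, (rho * circ 2 t - z)%C <> 0).
{ intros t; apply Cmod_gt_0; eapply Rlt_le_trans; [|apply Cmod_rev_triangle].
  rewrite Cmod_Rcirc; lra. }
induction j as [|j IH].
(* This radius exceeds 1/rho, stays below 1/|z|, where the pole lies, and makes sense for z = 0 as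
   well. *)
- set (r' := 2 / (rho + Cmod z)).
  assert (Hr' : / rho < r').
  { unfold r'; apply (Rmult_lt_reg_r (rho * (rho + Cmod z))); [apply Rmult_lt_0_compat; lra|].
    field_simplify; lra. }
  assert (Hzw : forall w, Cmod w < r' -> (1 - z * w)%C <> 0).
  { intros w Hw; apply Cmod_gt_0; eapply Rlt_le_trans; [|apply Cmod_rev_triangle].
    rewrite Cmod_1, Cmod_mult.
    assert (Cmod z * Cmod w <= Cmod z * r') by (apply Rmult_le_compat_l; lra).
    assert (Cmod z * r' < 1).
    { unfold r'; apply (Rmult_lt_reg_r (rho + Cmod z)); [lra|]; field_simplify; lra. }
    lra. }
  assert (HI : is_CInt (fun t => (/ (1 - z * (RtoC (/ rho) * circ (- (2)) t)))%C) 0 PI (PI * / (1 - z * 0))%C).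
  { apply (mean_value (fun w => / (1 - z * w))%C (/ rho) r' (- (2))); [lra|apply circ_period; auto| |].
    - split; [apply Rinv_0_lt_compat; lra|exact Hr'].
    - apply holn_inv; [exact Hzw|].
      apply (holn_plus 2 _ (fun _ => 1) (fun w => - (z * w))%C); [apply holn_const|].
      apply (holn_ext 2 _ (fun w => (- z) * w)%C); [intros; ring|].
      apply (holn_mult 2 _ (fun _ => - z)%C (fun w => w)); [apply holn_const|apply holn_id]. }
  eapply is_CInt_change; [exact HI| |].
  + intros t _; cbv beta zeta.
    pose proof (circ_opp 2 t) as Ho.
    assert (Hinv : (RtoC (/ rho) * circ (- (2)) t = / (rho * circ 2 t))%C).
    { rewrite RtoC_inv by (intros ->; now apply Hrho).
      transitivity (/ (rho * circ 2 t) * (circ 2 t * circ (- (2)) t))%C; [|rewrite Ho; ring].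
      field; split; [|exact Hrho].
      intros Hc0; apply (Hl0 t); rewrite Hc0; ring. }
    rewrite Hinv; specialize (Hl0 t); specialize (Hlz t).
    generalize dependent (rho * circ 2 t)%C; intros l Hl0 Hlz Hinv; simpl; field; split; assumption.
  + simpl; field; replace (1 - z * 0)%C with (RtoC 1) by ring; apply C1_nz.
- assert (HI : is_CInt (fun t => Cpow (rho * circ 2 t) (S j))%C 0 PI (PI * Cpow 0 (S j))%C).
  { apply (mean_value (fun w => Cpow w (S j)) rho (rho + 1) 2); [lra|apply circ_period; auto|lra|].
    apply holn_pow. }
  eapply is_CInt_change; [exact (is_CInt_plus _ _ _ _ _ _ HI (is_CInt_scal z _ _ _ _ IH))| |].
  + intros t _; cbv beta zeta; specialize (Hlz t).
    set (l := (rho * circ 2 t)%C) in *; rewrite (Cpow_S l (S j)); field; exact Hlz.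
  + simpl; ring.
Qed.

(** Removing one root z turns f'/f into 1/(l - z) + g'/g. Once no root is left, l^(j+1) F'/F has no
    pole in the disc and vanishes at 0, so its mean is 0. *)
Lemma residue_sum (rho rho' : R) (F : C -> C) (zs : list C) (j : nat) : 0 < rho < rho' ->
  entp F -> (forall w, Cmod w < rho' -> F w <> 0) -> (forall z, In z zs -> Cmod z < rho) ->
  forall f f', (forall w, f w = Pol zs w * F w)%C -> (forall w, is_Cderive f w (f' w)) ->
  is_CInt (fun t => let l := (rho * circ 2 t)%C in Cpow l (S j) * (f' l / f l))%C 0 PI (PI * psum j zs)%C.
Proof.
intros Hrho HF HFn.
assert (Hmod : forall t, Cmod (rho * circ 2 t) = rho).
{ intros t; apply Cmod_Rcirc; lra. }
induction zs as [|z zs IH]; intros Hzs f f' E Df.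
(* Three derivatives of F, because F' itself has to satisfy the order-2 condition of
   [mean_value]. *)
- destruct (entp_holn 3 (fun w => Cmod w < rho') F HF) as (F' & H1 & H2).
  assert (HI : is_CInt (fun t => (let w := (rho * circ 2 t)%C in Cpow w (S j) * (F' w * / F w))%C) 0 PI
     (PI * (Cpow 0 (S j) * (F' 0 * / F 0)))%C).
  { apply (mean_value (fun w => Cpow w (S j) * (F' w * / F w))%C rho rho' 2); [lra|apply circ_period; auto|lra|].
    apply (holn_mult 2 _ (fun w => Cpow w (S j))); [apply holn_pow|].
    apply holn_mult; [exact H2|]; apply holn_inv; [exact HFn|].
    apply holn_mono; now exists F'. }
  eapply is_CInt_change; [exact HI| |].
  + intros t _; cbv beta zeta; set (l := (rho * circ 2 t)%C).
    assert (El : f l = F l) by (rewrite E; simpl; ring).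
    assert (Dl : f' l = F' l).
    { apply (is_Cderive_unique f l); [apply Df|].
      apply (is_Cderive_ext F); [intros w; rewrite E; simpl; ring|].
      apply H1; unfold l; rewrite Hmod; lra. }
    rewrite El, Dl; reflexivity.
  + simpl; ring.
- assert (Hz : Cmod z < rho) by (apply Hzs; now left).
  assert (Hzs' : forall z, In z zs -> Cmod z < rho) by (intros; apply Hzs; now right).
  set (g := fun w => (Pol zs w * F w)%C).
  assert (Hg : entp g) by (apply (entp_mult (Pol zs) F); auto using ent_Pol).
  destruct (entp_derivative g Hg) as [g' Dg].
  eapply is_CInt_change; [exact (is_CInt_plus _ _ _ _ _ _ (residue_pole rho z j Hz) (IH Hzs' g g' (fun _ => eq_refl) Dg))| |].
  + intros t _; cbv beta zeta; set (l := (rho * circ 2 t)%C).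
    assert (El : f l = ((l - z) * g l)%C) by (rewrite E; unfold g; simpl; ring).
    assert (Dl : f' l = (g l + (l - z) * g' l)%C).
    { apply (is_Cderive_unique f l); [apply Df|].
      apply (is_Cderive_ext (fun w => (w - z) * g w)%C); [intros w; rewrite E; unfold g; simpl; ring|].
      eapply is_Cderive_eq; [apply is_Cderive_mult; [apply is_Cderive_minus; [apply is_Cderive_id|apply is_Cderive_const]|apply Dg]|].
      cbv beta; ring. }
    assert (Hlz : (l - z)%C <> 0).
    { apply Cmod_gt_0; eapply Rlt_le_trans; [|apply Cmod_rev_triangle]; unfold l; rewrite Hmod; lra. }
    assert (Hgl : g l <> 0).
    { unfold g; apply Cmult_neq_0; [|apply HFn; unfold l; rewrite Hmod; lra].
      intros H0; apply Pol_eq_0, Hzs' in H0; unfold l in H0; rewrite Hmod in H0; lra. }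
    rewrite El, Dl; field; split; assumption.
  + simpl; ring.
Qed.

(* The principal logarithm, meaningful only on the half plane Re w > 0. *)
Definition clog (w : C) : C := (/ 2 * ln (Re w * Re w + Im w * Im w), atan (Im w / Re w)).

Lemma is_derive_clog (h : R -> C) (t : R) (l : C) : 0 < Re (h t) -> is_derive h t l ->
  is_derive (fun s => clog (h s)) t (l / h t)%C.
Proof.
intros Hp Hd; apply is_derive_RC_parts in Hd; destruct Hd as [H1 H2].
assert (Hpos : 0 < Re (h t) * Re (h t) + Im (h t) * Im (h t)) by nra.
apply is_derive_RC_parts; unfold clog; simpl; split.
- eapply is_derive_eq.
  { apply is_derive_scal.
    apply (is_derive_comp ln (fun s => Re (h s) * Re (h s) + Im (h s) * Im (h s))).
    - apply is_derive_Reals, derivable_pt_lim_ln, Hpos.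
    - apply (is_derive_plus (V := R_NormedModule) (fun s => Re (h s) * Re (h s)) (fun s => Im (h s) * Im (h s)));
      apply (is_derive_mult (K := R_AbsRing)); eauto using Rmult_comm. }
  unfold scal, plus, mult; simpl; unfold mult; simpl; unfold Re, Im in *; destruct (h t) as [a b], l as [c d]; simpl in *; field.
  lra.
- eapply is_derive_eq.
  { apply (is_derive_comp atan (fun s => Im (h s) / Re (h s))).
    - apply is_derive_Reals, derivable_pt_lim_atan.
    - apply is_derive_div; [exact H2|exact H1|lra]. }
  unfold scal, plus, mult; simpl; unfold mult; simpl; unfold Re, Im in *; destruct (h t) as [a b], l as [c d]; simpl in *; field.
  repeat split; try lra; nra.
Qed.

Lemma Re_near_1 (w : C) : Cmod (w - 1) <= / 2 -> 0 < Re w.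
Proof.
intros H; pose proof (re_le_Cmod (w - 1)) as H1.
assert (E : Re (w - 1) = Re w - 1) by (destruct w; simpl; ring).
rewrite E in H1; apply Rabs_le_between in H1; lra.
Qed.

Lemma clog_1 : clog 1 = 0.
Proof.
apply C_eq; unfold clog; simpl.
- replace (1 * 1 + 0 * 0) with 1 by ring; rewrite ln_1; ring.
- replace (0 / 1) with 0 by field; apply atan_0.
Qed.

(** Integrate the derivative v/(1 + t v) - v = -v^2 t/(1 + t v) along the segment from 1 to 1 + v,
    on which the denominator is at least 1/2. *)
Lemma clog_approx (v : C) : Cmod v <= / 2 -> Cmod (clog (1 + v) - v) <= 2 * (Cmod v * Cmod v).
Proof.
intros Hv; pose proof (Cmod_ge_0 v).
assert (Ht : forall t : R, 0 <= t <= 1 -> / 2 <= Cmod (1 + v * t) /\ Cmod (1 + v * t - 1) <= / 2).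
{ intros t Ht.
  assert (Hm : Cmod (v * t) <= / 2) by (rewrite Cmod_mult, Cmod_R, Rabs_pos_eq by lra; nra).
  split.
  - replace (1 + v * t)%C with (1 - (- (v * t)))%C by ring.
    eapply Rle_trans; [|apply Cmod_rev_triangle]; rewrite Cmod_1, Cmod_opp; lra.
  - replace (1 + v * t - 1)%C with (v * t)%C by ring; exact Hm. }
assert (Dl : forall t : R, is_derive (fun t : R => 1 + v * t)%C t v).
{ intros t; eapply is_derive_Ceq; [apply is_derive_Cplus; [apply is_derive_Cconst|apply is_derive_Cscal, is_derive_RtoC]|ring]. }
assert (HI : is_CInt (fun t : R => v / (1 + v * t) - v * 1)%C 0 1 ((clog (1 + v * RtoC 1) - v * RtoC 1) - (clog (1 + v * RtoC 0) - v * RtoC 0))%C).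
{ apply (is_CInt_derive (fun t : R => clog (1 + v * t) - v * t)%C); rewrite Rmin_left, Rmax_right by lra; intros t Hti; destruct (Ht t Hti) as [Ht1 Ht2].
  - apply is_derive_Cminus; [|apply is_derive_Cscal, is_derive_RtoC].
    apply (is_derive_clog (fun t : R => 1 + v * t)%C); [apply Re_near_1, Ht2|apply Dl].
  - apply continuous_Cminus; [|apply continuous_Cconst].
    apply continuous_Cmult; [apply continuous_Cconst|].
    eapply is_derive_continuous; apply (is_derive_Ccomp Cinv (fun t : R => 1 + v * t)%C); [|apply Dl].
    apply (is_Cderive_inv (fun w => w)); [apply Cmod_gt_0; lra|apply is_Cderive_id]. }
apply is_CInt_norm_const with (M := 2 * (Cmod v * Cmod v)) in HI; [|lra|].
- replace (1 + v * 0)%C with (RtoC 1) in HI by ring; rewrite clog_1 in HI.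
  replace (clog (1 + v) - v)%C with ((clog (1 + v * RtoC 1) - v * RtoC 1) - (0 - v * RtoC 0))%C; [lra|].
  replace (1 + v * 1)%C with (1 + v)%C by ring; ring.
- intros t Hti; destruct (Ht t Hti) as [Ht1 _].
  assert (Hne : (1 + v * t)%C <> 0) by (apply Cmod_gt_0; lra).
  replace (v / (1 + v * t) - v * 1)%C with (- (v * (v * t) / (1 + v * t)))%C by (field; exact Hne).
  rewrite Cmod_opp, Cmod_div, !Cmod_mult, Cmod_R, Rabs_pos_eq by (exact Hne || lra).
  apply (Rmult_le_reg_r (Cmod (1 + v * t))); [lra|].
  unfold Rdiv; rewrite Rmult_assoc, Rinv_l, Rmult_1_r by lra.
  assert (0 <= Cmod v * Cmod v) by nra.
  apply Rle_trans with (Cmod v * Cmod v); [nra|].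
  nra.
Qed.

(** Integration by parts on a closed curve. As [h] stays in the disc of radius 1/2 around 1,
    [clog (h t)] returns to its initial value and no boundary term survives. The weight 1 counts
    zeros, the weight l sums them. *)
Lemma log_integral (h h1 mu mu1 : R -> C) (L : C) :
  (forall t, is_derive h t (h1 t)) -> (forall t, ccontinuous h1 t) ->
  (forall t, is_derive mu t (mu1 t)) -> (forall t, ccontinuous mu1 t) ->
  (forall t, Cmod (h t - 1) <= / 2) -> h PI = h 0%R -> mu PI = mu 0%R ->
  is_CInt (fun t => mu1 t * clog (h t))%C 0 PI L ->
  is_CInt (fun t => mu t * (h1 t / h t))%C 0 PI (- L)%C.
Proof.
intros Dh Ch1 Dm Cm1 Hh Eh Em HL.
assert (Hhp : forall t, 0 < Re (h t)) by (intros t; apply Re_near_1, Hh).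
assert (Dlog : forall t, is_derive (fun t => clog (h t)) t (h1 t / h t)%C) by (intros t; now apply is_derive_clog).
assert (Hn : forall t, h t <> 0) by (intros t E; specialize (Hhp t); rewrite E in Hhp; simpl in Hhp; lra).
assert (Cinvh : forall t, ccontinuous (fun t => / h t)%C t).
{ intros t; eapply is_derive_continuous; apply (is_derive_Ccomp Cinv h); [|apply Dh].
  apply (is_Cderive_inv (fun w => w)); [apply Hn|apply is_Cderive_id]. }
assert (HI : is_CInt (fun t => mu1 t * clog (h t) + mu t * (h1 t / h t))%C 0 PI (mu PI * clog (h PI) - mu 0%R * clog (h 0%R))%C).
{ apply (is_CInt_derive (fun t => mu t * clog (h t))%C); intros t _.
  - apply is_derive_Cmult; auto.
  - apply continuous_Cplus; apply continuous_Cmult; auto.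
    + eapply is_derive_continuous; apply Dlog.
    + eapply is_derive_continuous; apply Dm.
    + apply continuous_Cmult; auto. }
eapply is_CInt_change; [exact (is_CInt_minus _ _ _ _ _ _ HI HL)| |].
- intros t _; cbv beta; ring.
- rewrite Eh, Em; ring.
Qed.

(** [zs] lists with multiplicity all zeros in the disc; the cofactor is free of zeros on a strictly
    larger disc, so none lies on the circle and 1/F is available around the closed disc. *)
Definition factored (f : C -> C) (rho : R) (zs : list C) : Prop :=
  exists F rho', 0 < rho < rho' /\ entp F /\ (forall w, Cmod w < rho' -> F w <> 0) /\
    (forall z, In z zs -> Cmod z < rho) /\ forall w, f w = (Pol zs w * F w)%C.

Lemma factored_mult (f g : C -> C) (rho : R) (zs ws : list C) :
  factored f rho zs -> factored g rho ws -> factored (fun w => f w * g w)%C rho (zs ++ ws).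
Proof.
intros (F & r1 & H1 & HF & HFn & Hz & Ef) (G & r2 & H2 & HG & HGn & Hw & Eg).
exists (fun w => F w * G w)%C, (Rmin r1 r2); repeat split.
- lra.
- apply Rmin_glb_lt; lra.
- now apply (entp_mult F G).
- intros w Hlt; apply Cmult_neq_0; [apply HFn|apply HGn]; (eapply Rlt_le_trans; [exact Hlt|]).
  + apply Rmin_l.
  + apply Rmin_r.
- intros z Hin; apply in_app_or in Hin; destruct Hin; auto.
- intros w; rewrite Ef, Eg, Pol_app; ring.
Qed.

Lemma factored_entp (f : C -> C) (rho : R) (zs : list C) : factored f rho zs -> entp f.
Proof.
intros (F & r1 & H1 & HF & _ & _ & Ef); apply (entp_mult (Pol zs) F); auto using ent_Pol.
Qed.

Lemma factored_neq_0 (f : C -> C) (rho : R) (zs : list C) (w : C) :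
  factored f rho zs -> Cmod w = rho -> f w <> 0.
Proof.
intros (F & r1 & H1 & HF & HFn & Hz & Ef) Hw; rewrite Ef; apply Cmult_neq_0; [|apply HFn; lra].
intros H0; apply Pol_eq_0, Hz in H0; lra.
Qed.

Lemma factored_residue (f f' : C -> C) (rho : R) (zs : list C) (j : nat) :
  factored f rho zs -> (forall w, is_Cderive f w (f' w)) ->
  is_CInt (fun t => let l := (rho * circ 2 t)%C in Cpow l (S j) * (f' l / f l))%C 0 PI (PI * psum j zs)%C.
Proof.
intros (F & r1 & H1 & HF & HFn & Hz & Ef) Df.
exact (residue_sum rho r1 F zs j H1 HF HFn Hz f f' Ef Df).
Qed.

(** For h = f/g the difference of the residue integrals is that of h'/h. The weight 1 gives integral
    0, hence equal counts, as in the theorem of Rouché; the weight l shows that the sums of zeros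
    differ by minus the mean of l clog(h). If that function is within [eps] of -v, the difference is
    within [eps] of v. *)
Lemma factored_comparison (f g : C -> C) (rho : R) (zs ws : list C) :
  factored f rho zs -> factored g rho ws ->
  (forall t, Cmod (f (rho * circ 2 t)%C / g (rho * circ 2 t)%C - 1) <= / 2) ->
  length zs = length ws /\
  forall v eps, (forall t, let l := (rho * circ 2 t)%C in Cmod (l * clog (f l / g l) + v) <= eps) ->
    Cmod (psum 1 zs - psum 1 ws - v) <= eps.
Proof.
intros Ff Fg Hnear; pose proof PI_RGT_0 as HPI.
assert (Hrho : 0 < rho) by (destruct Ff as (F & r1 & H1 & _); lra).
assert (HPIC : RtoC PI <> 0) by (apply RtoC_nz; lra).
destruct (entp_holn 2 (fun _ => True) f (factored_entp _ _ _ Ff)) as (f' & Df & f'' & Df' & _).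
destruct (entp_holn 2 (fun _ => True) g (factored_entp _ _ _ Fg)) as (g' & Dg & g'' & Dg' & _).
set (l := fun t => (rho * circ 2 t)%C) in *.
assert (Hl : forall t, Cmod (l t) = rho).
{ intros t; unfold l; apply Cmod_Rcirc; lra. }
assert (Hl0 : forall t, l t <> 0) by (intros t; apply Cmod_gt_0; rewrite Hl; exact Hrho).
assert (Dl : forall t, is_derive l t (2 * Ci * l t)%C).
{ intros t; eapply is_derive_Ceq; [apply is_derive_Cscal, is_derive_circ|unfold l; ring]. }
pose proof (is_derive_all_continuous l _ Dl) as Cl.
assert (Hf0 : forall t, f (l t) <> 0) by (intros t; apply (factored_neq_0 f rho zs); auto).
assert (Hg0 : forall t, g (l t) <> 0) by (intros t; apply (factored_neq_0 g rho ws); auto).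
set (h := fun t => (f (l t) / g (l t))%C).
set (h1 := fun t => (2 * Ci * l t * (f' (l t) / f (l t) - g' (l t) / g (l t)) * h t)%C).
assert (Dinv : forall k k' : C -> C, (forall w, is_Cderive k w (k' w)) -> (forall t, k (l t) <> 0) ->
  forall t, is_derive (fun t => / k (l t))%C t (2 * Ci * l t * (- k' (l t) / (k (l t) * k (l t))))%C).
{ intros k k' Dk Hk t; apply (is_derive_Ccomp (fun w => / k w)%C l); [|apply Dl].
  now apply is_Cderive_inv. }
assert (Df1 : forall w, is_Cderive f w (f' w)) by (intros; now apply Df).
assert (Dg1 : forall w, is_Cderive g w (g' w)) by (intros; now apply Dg).
assert (Dh : forall t, is_derive h t (h1 t)).
{ intros t; eapply is_derive_Ceq.
  - apply is_derive_Cmult; [apply (is_derive_Ccomp f l); [apply Df1|apply Dl]|].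
    now apply (Dinv g g').
  - unfold h1, h; cbv beta; field; auto. }
assert (Ccomp : forall k k' : C -> C, (forall w, is_Cderive k w (k' w)) -> forall t, ccontinuous (fun t => k (l t)) t).
{ intros k k' Dk t; eapply is_derive_continuous; apply (is_derive_Ccomp k l); [apply Dk|apply Dl]. }
pose proof (is_derive_all_continuous h _ Dh) as Ch.
assert (Ch1 : forall t, ccontinuous h1 t).
{ intros t; apply continuous_Cmult; [|apply Ch]; apply continuous_Cmult.
  - apply continuous_Cmult; [apply continuous_Cconst|apply Cl].
  - apply continuous_Cminus; apply continuous_Cmult.
    + apply (Ccomp f' f''); intros; now apply Df'.
    + eapply is_derive_continuous; now apply (Dinv f f').
    + apply (Ccomp g' g''); intros; now apply Dg'.
    + eapply is_derive_continuous; now apply (Dinv g g'). }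
assert (El : l PI = l 0%R) by (unfold l; rewrite circ_period, circ_0; auto).
assert (Eh : h PI = h 0%R) by (unfold h; rewrite El; reflexivity).
assert (Hh0 : forall t, h t <> 0).
{ intros t E; specialize (Hnear t); apply Re_near_1 in Hnear; change (0 < Re (h t)) in Hnear; rewrite E in Hnear; simpl in Hnear; lra. }
(* h'/h carries the factor 2 i l from the parametrization, which supplies the missing power in
   l^(j+1). *)
assert (Res : forall j, is_CInt (fun t => Cpow (l t) j * (h1 t / h t))%C 0 PI (2 * Ci * (PI * psum j zs - PI * psum j ws))%C).
{ intros j; eapply is_CInt_ext; [|exact (is_CInt_scal (2 * Ci)%C _ _ _ _ (is_CInt_minus _ _ _ _ _ _
    (factored_residue f f' rho zs j Ff Df1) (factored_residue g g' rho ws j Fg Dg1)))].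
  intros t _; cbv beta zeta; fold (l t); unfold h1.
  rewrite Cpow_S; field; auto. }
assert (H2i : (2 * Ci)%C <> 0) by (apply Cmult_neq_0; auto).
assert (Clog : forall t, ccontinuous (fun t => clog (h t)) t).
{ intros t; eapply is_derive_continuous; apply is_derive_clog; [apply Re_near_1, Hnear|apply Dh]. }
split.
- pose proof (log_integral h h1 (fun _ => 1) (fun _ => 0) 0 Dh Ch1 (fun t => is_derive_Cconst _ t) (fun t => continuous_Cconst _ t) Hnear Eh eq_refl) as HL.
  assert (H0 : is_CInt (fun t => Cpow (l t) 0 * (h1 t / h t))%C 0 PI (- 0)%C).
  { apply HL; eapply is_CInt_change; [apply (is_CInt_const 0)|intros; cbv beta; ring|ring]. }
  pose proof (is_CInt_det _ _ _ _ _ (Res O) H0) as E0; rewrite !psum_0 in E0.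
  apply INR_eq, RtoC_inj.
  transitivity (INR (length ws) + / (2 * Ci * PI) * (2 * Ci * (PI * INR (length zs) - PI * INR (length ws))))%C.
  + field; auto.
  + rewrite E0; ring.
- intros v eps Hv.
  assert (HL := CInt_correct (fun t => 2 * Ci * l t * clog (h t))%C 0 PI
    ltac:(intros t _; apply continuous_Cmult; [apply continuous_Cmult; [apply continuous_Cconst|apply Cl]|apply Clog])).
  set (L := CInt _ 0 PI) in HL.
  pose proof (log_integral h h1 l (fun t => 2 * Ci * l t)%C L Dh Ch1 Dl
    (fun t => continuous_Cmult (T := R_UniformSpace) _ _ t (continuous_Cconst _ _) (Cl t)) Hnear Eh El HL) as HI.
  assert (H1 : is_CInt (fun t => Cpow (l t) 1 * (h1 t / h t))%C 0 PI (- L)%C).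
  { eapply is_CInt_ext; [|exact HI]; intros; simpl; ring. }
  pose proof (is_CInt_det _ _ _ _ _ (Res 1%nat) H1) as E1.
  assert (HV : is_CInt (fun t => l t * clog (h t) + v)%C 0 PI (- PI * (psum 1 zs - psum 1 ws - v))%C).
  { eapply is_CInt_change; [exact (is_CInt_plus _ _ _ _ _ _ (is_CInt_scal (/ (2 * Ci))%C _ _ _ _ HL) (is_CInt_const v 0 PI))| |].
    - intros t _; cbv beta; field; auto.
    - replace (PI - 0) with PI by ring.
      replace L with (- (2 * Ci * (PI * psum 1 zs - PI * psum 1 ws)))%C by (rewrite E1; ring).
      field; auto. }
  apply is_CInt_norm_const with (M := eps) in HV; [|lra|intros t _; apply Hv].
  rewrite Cmod_mult, Cmod_opp, Cmod_R, Rabs_pos_eq in HV by lra.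
  apply (Rmult_le_reg_l PI); lra.
Qed.

(** * Enumerations of zeros *)

Lemma entp_entire (f : C -> C) : entp f -> entire f.
Proof. intros Hf w; destruct (entp_derivative f Hf) as [f' Df]; exists (f' w); apply Df. Qed.

Lemma Pol_split (zs : list C) (z w : C) :
  Pol zs w = (Cpow (w - z) (count_occ Ceq_dec zs z) * Pol (remove Ceq_dec z zs) w)%C.
Proof.
induction zs as [|y zs IH]; simpl; [ring|].
destruct (Ceq_dec y z) as [Ey|Ey]; destruct (Ceq_dec z y) as [Ez|Ez]; try congruence;
simpl; rewrite IH; [rewrite Ey|]; ring.
Qed.

Lemma Pol_repeat (z w : C) (n : nat) : Pol (repeat z n) w = Cpow (w - z) n.
Proof. induction n as [|n IH]; simpl; [reflexivity|now rewrite IH]. Qed.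

(** Dividing by w - z can be repeated only while the cofactor vanishes at z, and [roots_bounded]
    forbids arbitrarily many copies of the root z. *)
Lemma finite_order (f : C -> C) (c z : C) : entp f -> f c <> 0 ->
  exists n g, entp g /\ g z <> 0 /\ forall w, f w = (Cpow (w - z) n * g w)%C.
Proof.
intros Hf Hc.
destruct (roots_bounded f c (Cmod z) Hf Hc (Cmod_ge_0 z)) as [N HN].
assert (H : forall m, (exists n g, entp g /\ g z <> 0 /\ forall w, f w = (Cpow (w - z) n * g w)%C) \/
  exists g, entp g /\ forall w, f w = (Cpow (w - z) m * g w)%C).
{ induction m as [|m IH].
  - right; exists f; split; [exact Hf|]; intros w; simpl; ring.
  - destruct IH as [IH|(g & Hg & E)]; [now left|].
    destruct (Ceq_dec (g z) 0) as [Hz|Hz]; [right|left; now exists m, g].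
    destruct (entp_div g z Hg Hz) as (g1 & Hg1 & E1).
    exists g1; split; [exact Hg1|]; intros w; rewrite E, E1; simpl; ring. }
destruct (H N) as [H1|(g & Hg & E)]; [exact H1|exfalso].
apply (Nat.lt_irrefl N); rewrite <- (repeat_length z N) at 1; apply (HN (repeat z N) g).
- intros y Hy; apply repeat_spec in Hy; rewrite Hy; lra.
- exact Hg.
- intros w; rewrite Pol_repeat; apply E.
Qed.

(** Cancelling a power of w - z leaves an identity valid only off z; continuity of both cofactors
    along z + r, for r tending to 0, extends its consequence to z. *)
Lemma vanishing_factor (g k : C -> C) (z : C) : entp g -> entp k ->
  (forall w, w <> z -> g w = ((w - z) * k w)%C) -> g z = 0.
Proof.
intros Hg Hk E.
destruct (entp_derivative g Hg) as [g' Dg], (entp_derivative k Hk) as [k' Dk].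
destruct (Cderive_bounded g z _ (Dg z)) as (d1 & Hd1 & H1), (Cderive_bounded k z _ (Dk z)) as (d2 & Hd2 & H2).
set (A := Cmod (g' z) + 1) in *; set (B := Cmod (k' z) + 1) in *.
pose proof (Cmod_ge_0 (g' z)); pose proof (Cmod_ge_0 (k' z)); pose proof (Cmod_ge_0 (k z)).
apply Cmod_eq_0, Rle_antisym; [|apply Cmod_ge_0]; apply le_epsilon; intros e He.
set (r := Rmin (Rmin 1 (e / (A + Cmod (k z) + B))) (Rmin d1 d2 / 2)).
assert (Hd : 0 < Rmin d1 d2) by now apply Rmin_pos.
assert (HAB : 0 < A + Cmod (k z) + B) by (unfold A, B; lra).
assert (Hr : 0 < r) by (unfold r; repeat apply Rmin_pos; try lra; apply Rdiv_lt_0_compat; lra).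
assert (Hr1 : r <= 1) by (eapply Rle_trans; [apply Rmin_l|apply Rmin_l]).
assert (Hre : r <= e / (A + Cmod (k z) + B)) by (eapply Rle_trans; [apply Rmin_l|apply Rmin_r]).
assert (Hrd : r <= Rmin d1 d2 / 2) by apply Rmin_r.
assert (Hrd1 : r < d1) by (pose proof (Rmin_l d1 d2); lra).
assert (Hrd2 : r < d2) by (pose proof (Rmin_r d1 d2); lra).
set (w := (z + r)%C).
assert (Hw : Cmod (w - z) = r).
{ unfold w; replace (z + r - z)%C with (RtoC r) by ring; rewrite Cmod_R, Rabs_pos_eq; lra. }
assert (Hwz : w <> z).
{ intros Ew; rewrite Ew in Hw; unfold Cminus in Hw; rewrite Cplus_opp_r, Cmod_0 in Hw; lra. }
specialize (H1 w ltac:(lra)); specialize (H2 w ltac:(lra)); rewrite Hw in H1, H2.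
replace (g z) with ((w - z) * (k z + (k w - k z)) - (g w - g z))%C by (rewrite (E w Hwz); ring).
apply Cmod_minus_bound; rewrite Cmod_mult, Hw.
pose proof (Cmod_triangle (k z) (k w - k z)) as Ht.
apply (Rmult_le_compat_r (A + Cmod (k z) + B)) in Hre; [|lra].
replace (e / (A + Cmod (k z) + B) * (A + Cmod (k z) + B)) with e in Hre by (field; lra).
assert (Hk1 : Cmod (k z + (k w - k z)) <= Cmod (k z) + B) by (assert (0 < B) by (unfold B; lra); nra).
apply (Rmult_le_compat_l r) in Hk1; lra.
Qed.

(** The indices below [M] carrying the value z, to be compared as a set with the list of all such
    indices that [enum_zeros] provides. *)
Definition hits (E : nat -> C) (z : C) (M : nat) : list nat :=
  filter (fun m => if Ceq_dec (E m) z then true else false) (seq 0 M).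

Lemma hits_length (E : nat -> C) (z : C) (M : nat) :
  length (hits E z M) = count_occ Ceq_dec (map E (seq 0 M)) z.
Proof.
unfold hits; induction (seq 0 M) as [|m l IH]; simpl; [reflexivity|].
destruct (Ceq_dec (E m) z); simpl; rewrite IH; reflexivity.
Qed.

Lemma hits_In (E : nat -> C) (z : C) (M m : nat) : In m (hits E z M) <-> (m < M)%nat /\ E m = z.
Proof.
unfold hits; rewrite filter_In, in_seq; destruct (Ceq_dec (E m) z); intuition (try lia; congruence).
Qed.

(** Were the cofactor F nonzero at E(M), the order of f there would equal the number of earlier
    indices with that value. The enumeration allows exactly that many indices in total, yet M itself
    is one more. So F vanishes at E(M) and can be divided once again. *)
Lemma enum_zeros_factor (f : C -> C) (E : nat -> C) : entp f -> enum_zeros f E ->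
  forall M, exists F, entp F /\ forall w, f w = (Pol (map E (seq 0 M)) w * F w)%C.
Proof.
intros Hf [_ HE]; induction M as [|M (F & HF & EF)].
- exists f; split; [exact Hf|]; intros w; simpl; ring.
- assert (Hz : F (E M) = 0).
  { destruct (Ceq_dec (F (E M)) 0) as [Hz|Hz]; [exact Hz|exfalso].
    destruct (HE (E M) (count_occ Ceq_dec (map E (seq 0 M)) (E M))) as (l & Hnd & Hlen & Hl).
    - exists (fun w => Pol (remove Ceq_dec (E M) (map E (seq 0 M))) w * F w)%C; split; [|split].
      + apply entp_entire; eapply entp_mult; [apply ent_Pol|exact HF|reflexivity].
      + apply Cmult_neq_0; [|exact Hz].
        intros H; apply Pol_eq_0 in H; now apply remove_In in H.
      + intros w; rewrite EF, (Pol_split _ (E M)); ring.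
    - assert (Hincl : (length (M :: hits E (E M) M) <= length l)%nat).
      { apply NoDup_incl_length.
        - constructor; [rewrite hits_In; lia|apply NoDup_filter, seq_NoDup].
        - intros m [<-|Hm]; apply Hl; [reflexivity|now apply hits_In in Hm]. }
      simpl in Hincl; rewrite hits_length in Hincl; lia. }
  destruct (entp_div F (E M) HF Hz) as (F1 & HF1 & E1).
  exists F1; split; [exact HF1|]; intros w.
  rewrite seq_S, map_app, Pol_app, EF, E1; simpl; ring.
Qed.

Lemma nondecreasing_nat (E : nat -> C) : (forall m, Cmod (E m) <= Cmod (E (S m))) ->
  forall m n, (m <= n)%nat -> Cmod (E m) <= Cmod (E n).
Proof. intros H m n Hmn; induction Hmn; [lra|specialize (H m0); lra]. Qed.

(** The first [M] with |E(M)| >= rho exists by [roots_bounded], and |E(M)| serves as the larger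
    radius. A zero of the cofactor below that radius would have a larger order in f than the
    enumeration accounts for. *)
Lemma enum_zeros_factored (f : C -> C) (E : nat -> C) (c : C) (rho : R) :
  entp f -> f c <> 0 -> enum_zeros f E -> 0 < rho -> (forall w, Cmod w = rho -> f w <> 0) ->
  exists M, factored f rho (map E (seq 0 M)).
Proof.
intros Hf Hc HE Hrho Hcirc.
pose proof (enum_zeros_factor f E Hf HE) as Hfac.
destruct HE as [Hmono HE]; pose proof (nondecreasing_nat E Hmono) as Hmon.
destruct (roots_bounded f c rho Hf Hc (Rlt_le _ _ Hrho)) as [N HN].
assert (Hfirst : forall K, (forall m, (m < K)%nat -> Cmod (E m) < rho) \/
  exists M, rho <= Cmod (E M) /\ forall m, (m < M)%nat -> Cmod (E m) < rho).
{ induction K as [|K [IH|IH]]; [left; intros; lia| |now right].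
  destruct (Rlt_le_dec (Cmod (E K)) rho) as [H|H]; [left|right; now exists K].
  intros m Hm; destruct (Nat.eq_dec m K) as [->|]; [exact H|apply IH; lia]. }
destruct (Hfirst N) as [H|(M & HM & HMlt)].
{ exfalso; destruct (Hfac N) as (F & HF & EF).
  apply (Nat.lt_irrefl N); rewrite <- (length_seq N 0) at 1; rewrite <- (length_map E).
  apply (HN _ F); [|exact HF|exact EF].
  intros z Hz; apply in_map_iff in Hz; destruct Hz as (m & <- & Hm); apply in_seq in Hm.
  apply Rlt_le, H; lia. }
exists M.
assert (HEM : f (E M) = 0).
{ destruct (Hfac (S M)) as (F & _ & EF).
  rewrite EF, (proj2 (Pol_eq_0 _ (E M))); [ring|].
  apply in_map, in_seq; lia. }
(* The inequality is strict because E(M) is a zero of f and f has none on the circle. *)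
assert (HM' : rho < Cmod (E M)).
{ destruct HM as [HM|HM]; [exact HM|now destruct (Hcirc (E M) (eq_sym HM))]. }
destruct (Hfac M) as (F & HF & EF).
exists F, (Cmod (E M)); repeat split; [exact Hrho|exact HM'|exact HF| | |exact EF].
- intros z Hz HFz.
  destruct (finite_order f c z Hf Hc) as (n & g & Hg & Hgz & Eg).
  destruct (HE z n) as (l & Hnd & Hlen & Hl).
  { exists g; split; [now apply entp_entire|split; [exact Hgz|exact Eg]]. }
  (* Every index with value z lies below [M], since |z| < |E(M)| and the moduli do not decrease. *)
  assert (Hn : (n <= count_occ Ceq_dec (map E (seq 0 M)) z)%nat).
  { rewrite <- Hlen, <- hits_length; apply NoDup_incl_length; [exact Hnd|].
    intros m Hm; apply Hl in Hm; apply hits_In; split; [|exact Hm].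
    apply Nat.nle_gt; intros HMm; apply Hmon in HMm; rewrite Hm in HMm; lra. }
  set (k := count_occ Ceq_dec (map E (seq 0 M)) z) in *.
  destruct (entp_div F z HF HFz) as (F1 & HF1 & E1).
  (* f contains (w - z)^(k + 1) with k >= n, so off z the function g is (w - z) G; this forces g(z)
     = 0, against the definition of the order n. *)
  set (G := fun w => (Pol (repeat z (k - n)) w * (Pol (remove Ceq_dec z (map E (seq 0 M))) w * F1 w))%C).
  apply Hgz, (vanishing_factor g G z Hg).
  + eapply entp_mult; [apply ent_Pol| |reflexivity].
    eapply entp_mult; [apply ent_Pol|exact HF1|reflexivity].
  + intros w Hw.
    assert (Hwz : Cpow (w - z) n <> 0) by now apply Cpow_nz, Cminus_eq_contra.
    assert (Ew : (Cpow (w - z) n * g w = Cpow (w - z) n * ((w - z) * G w))%C).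
    { rewrite <- Eg, EF, (Pol_split _ z), E1; fold k; unfold G; rewrite Pol_repeat.
      replace k with (n + (k - n))%nat at 1 by lia; rewrite Cpow_add_r; ring. }
    transitivity (/ Cpow (w - z) n * (Cpow (w - z) n * g w))%C; [field; exact Hwz|].
    rewrite Ew; field; exact Hwz.
- intros z Hz; apply in_map_iff in Hz; destruct Hz as (m & <- & Hm); apply in_seq in Hm; apply HMlt; lia.
Qed.

(** * The free problem *)

(** Half-angle formulas for the modulus and argument; the root in the closed upper half plane is the
    one for which the bounds with exp(Im k t) hold. *)
Lemma Csqrt_upper (w : C) : exists k, (k * k = w)%C /\ 0 <= Im k.
Proof.
set (r := Cmod w); destruct w as [a b].
assert (Hr2 : r * r = a * a + b * b).
{ unfold r; pose proof (Cmod2_alt (a, b)) as H; simpl in H; lra. }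
assert (Hr : 0 <= r) by apply Cmod_ge_0.
assert (Ha : Rabs a <= r).
{ apply Rsqr_incr_0_var; [|exact Hr]; rewrite <- Rsqr_abs; unfold Rsqr; nra. }
apply Rabs_le_between in Ha.
set (p := sqrt ((r + a) / 2)); set (q := sqrt ((r - a) / 2)).
assert (Hp : p * p = (r + a) / 2) by (apply sqrt_sqrt; lra).
assert (Hq : q * q = (r - a) / 2) by (apply sqrt_sqrt; lra).
assert (Hpq : p * q = Rabs b / 2).
{ unfold p, q; rewrite <- sqrt_mult by lra.
  replace ((r + a) / 2 * ((r - a) / 2)) with (Rsqr (Rabs b / 2)).
  - apply sqrt_Rsqr; pose proof (Rabs_pos b); lra.
  - unfold Rsqr; replace (Rabs b / 2 * (Rabs b / 2)) with (Rabs b * Rabs b / 4) by field.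
    replace (Rabs b * Rabs b) with (b * b); [nra|].
    pose proof (Rsqr_abs b) as H; unfold Rsqr in H; exact H. }
assert (Hq0 : 0 <= q) by apply sqrt_pos.
destruct (Rle_dec 0 b) as [Hb|Hb].
- exists (p, q); split; [|exact Hq0].
  rewrite Rabs_pos_eq in Hpq by exact Hb.
  apply C_eq; simpl; lra.
- exists (- p, q); split; [|exact Hq0].
  rewrite Rabs_left in Hpq by lra.
  apply C_eq; simpl; lra.
Qed.

Lemma ksin_cexp (k : C) : k <> 0 ->
  (2 * Ci * k * ksin k PI = cexp (Ci * k * PI) - cexp (- (Ci * k * PI)))%C.
Proof. intros Hk; unfold ksin; field; auto. Qed.

(** This is |sin(a + i b)|^2 = sinh(b)^2 + sin(a)^2 at a + i b = pi k, multiplied by 4. *)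
Lemma Cmod_sin_sqr (k : C) :
  Cmod (cexp (Ci * k * PI) - cexp (- (Ci * k * PI))) ^ 2 =
  (exp (Im k * PI) - exp (- (Im k * PI))) ^ 2 + 4 * sin (Re k * PI) ^ 2.
Proof.
destruct k as [a b]; rewrite Cmod2_alt; unfold cexp; simpl.
replace ((0 * a - 1 * b) * PI - (0 * b + 1 * a) * 0) with (- (b * PI)) by ring.
replace ((0 * a - 1 * b) * 0 + (0 * b + 1 * a) * PI) with (a * PI) by ring.
rewrite Ropp_involutive, cos_neg, sin_neg.
assert (He : exp (b * PI) * exp (- (b * PI)) = 1) by (rewrite <- exp_plus, Rplus_opp_r, exp_0; reflexivity).
pose proof (sin2_cos2 (a * PI)) as Hsc; unfold Rsqr in Hsc.
set (P := exp (b * PI)) in *; set (Q := exp (- (b * PI))) in *.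
set (s := sin (a * PI)) in *; set (c := cos (a * PI)) in *.
replace (c * c) with (1 - s * s) by lra.
transitivity ((Q * c - P * c) * (Q * c - P * c) + (Q * s + P * s) * (Q * s + P * s)); [ring|].
transitivity ((P - Q) * (P - Q) * (s * s + c * c) + 4 * (P * Q) * (s * s)); [ring|].
rewrite Hsc, He; ring.
Qed.

Lemma sin_sqr_shift (y : R) (N : nat) : sin (y + INR N * PI) ^ 2 = sin y ^ 2.
Proof.
induction N as [|N IH]; [simpl; do 2 f_equal; f_equal; ring|].
rewrite S_INR; replace (y + (INR N + 1) * PI) with (y + INR N * PI + PI) by ring.
rewrite neg_sin; rewrite <- IH; ring.
Qed.

(** On the circle |k| = N + 1/2 a point close to the real axis has real part close to plus or minus
    N + 1/2: b < 1/3 and (R - |a|)(R + |a|) = b^2 give R - |a| <= 1/9. Up to sign the sine is then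
    the cosine of an angle at most pi/3. *)
Lemma sin_sqr_near_half_integer (a b : R) (N : nat) : (1 <= N)%nat ->
  a * a + b * b = (INR N + / 2) * (INR N + / 2) -> 0 <= b -> b * PI < 1 -> / 4 <= sin (a * PI) ^ 2.
Proof.
intros HN Hab Hb HbP.
assert (HN1 : 1 <= INR N) by (apply (le_INR 1); exact HN).
pose proof PI_RGT_0 as HPI; pose proof PI2_3_2 as HPI3.
set (R := INR N + / 2) in *; set (A := Rabs a).
assert (HA2 : A * A = a * a) by (pose proof (Rsqr_abs a) as H; unfold Rsqr in H; unfold A; lra).
assert (HA : 0 <= A) by apply Rabs_pos.
assert (Hb13 : b < / 3) by nra.
assert (HAR : A <= R) by (unfold R in *; nra).
set (d := (R - A) * PI).
assert (Hd : 0 <= d <= PI / 3).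
{ unfold d; split; [nra|].
  assert (H1 : (R - A) * (R + A) = b * b) by nra.
  assert (H2 : R - A <= / 9) by (unfold R in *; nra). nra. }
assert (E : sin (a * PI) ^ 2 = cos d ^ 2).
{ replace (sin (a * PI) ^ 2) with (sin (A * PI) ^ 2).
  - replace (A * PI) with (PI / 2 - d + INR N * PI) by (unfold d, R; field).
    rewrite sin_sqr_shift, sin_shift; reflexivity.
  - unfold A, Rabs; destruct (Rcase_abs a); [|reflexivity].
    replace (- a * PI) with (- (a * PI)) by ring; rewrite sin_neg; ring. }
rewrite E.
assert (Hc : / 2 <= cos d).
{ replace (/ 2) with (cos (PI / 3)) by (rewrite cos_PI3; field).
  apply cos_decr_1; lra. }
nra.
Qed.

(** The lower bound that the choice of radii provides. It amounts to |2 sin(pi k)| >= exp(pi Im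
    k)/3; the 6 is this 3 times the 2 in the denominator of [ksin]. *)
Lemma ksin_lower (k : C) (N : nat) : (1 <= N)%nat -> Cmod k = INR N + / 2 -> 0 <= Im k ->
  exp (Im k * PI) / (6 * Cmod k) <= Cmod (ksin k PI).
Proof.
intros HN HkN Hk.
assert (HN1 : 1 <= INR N) by (apply (le_INR 1); exact HN).
assert (Hk0 : k <> 0) by (apply Cmod_gt_0; lra).
pose proof (f_equal Cmod (ksin_cexp k Hk0)) as E.
rewrite !Cmod_mult, Cmod_Ci, Cmod_R, Rabs_pos_eq in E by lra.
pose proof (Cmod_sin_sqr k) as S.
set (X := Cmod (cexp (Ci * k * PI) - cexp (- (Ci * k * PI)))) in *.
assert (HX : 0 <= X) by apply Cmod_ge_0.
set (e := exp (Im k * PI)) in *; assert (He : 0 < e) by apply exp_pos.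
pose proof PI_RGT_0 as HPI.
assert (Hlow : e / 3 <= X).
{ assert (Hs0 : 0 <= sin (Re k * PI) ^ 2) by apply pow2_ge_0.
  (* Far from the real axis the hyperbolic term alone suffices; near it the exponential is at most 3
     and the sine term gives modulus at least 1. *)
  destruct (Rle_dec 1 (Im k * PI)) as [H1|H1].
  - assert (He2 : 2 <= e).
    { pose proof (exp_ineq1_le (Im k * PI)); unfold e; lra. }
    assert (Hi : exp (- (Im k * PI)) <= / 2).
    { rewrite exp_Ropp; fold e; apply Rinv_le_contravar; lra. }
    pose proof (exp_pos (- (Im k * PI))).
    apply Rsqr_incr_0_var; [|exact HX]; unfold Rsqr.
    replace (X * X) with (X ^ 2) by ring; rewrite S; nra.
  - assert (He3 : e <= 3).
    { apply Rle_trans with (exp 1); [apply exp_mono; lra|apply exp_le_3]. }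
    assert (Hs : / 4 <= sin (Re k * PI) ^ 2).
    { apply (sin_sqr_near_half_integer (Re k) (Im k) N); try assumption; [|lra].
      rewrite <- HkN; pose proof (Cmod2_alt k); nra. }
    apply Rsqr_incr_0_var; [|exact HX]; unfold Rsqr.
    replace (X * X) with (X ^ 2) by ring; rewrite S.
    pose proof (pow2_ge_0 (e - exp (- (Im k * PI)))); nra. }
assert (HK : 0 < Cmod k) by lra.
apply (Rmult_le_reg_l (2 * 1 * Cmod k)); [lra|].
rewrite E; replace (2 * 1 * Cmod k * (e / (6 * Cmod k))) with (e / 3) by (field; lra); exact Hlow.
Qed.

Lemma ksin_real (k : R) : k <> 0 -> ksin k PI = RtoC (sin (k * PI) / k).
Proof.
intros Hk; unfold ksin, cexp.
assert (HkC : RtoC k <> 0) by now apply RtoC_nz.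
assert (E1 : (Ci * k * PI)%C = (0, k * PI)) by (apply C_eq; simpl; ring).
rewrite E1; simpl.
rewrite Ropp_0, exp_0, cos_neg, sin_neg, !Rmult_1_l.
replace ((cos (k * PI), sin (k * PI)) - (cos (k * PI), Ropp (sin (k * PI))))%C with (2 * Ci * RtoC (sin (k * PI)))%C.
- rewrite RtoC_div by exact Hk; field; auto.
- apply C_eq; simpl; ring.
Qed.

Lemma sin_nat_PI (m : nat) : sin (INR m * PI) = 0.
Proof. rewrite INR_IZR_INZ; apply sin_eq_0_1; now exists (Z.of_nat m). Qed.

Lemma cos_nat_PI_neq_0 (m : nat) : cos (INR m * PI) <> 0.
Proof.
intros H; pose proof (sin2_cos2 (INR m * PI)) as H1; unfold Rsqr in H1.
rewrite H, sin_nat_PI in H1; lra.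
Qed.

Definition free_neumann (lam : C) : C := c_solD (fun _ => RtoC 0) lam 0 PI.

Lemma free_neumann_eq (k : C) : k <> 0 -> free_neumann (k * k) = (- (k * k) * ksin k PI)%C.
Proof.
intros Hk; unfold free_neumann, c_solD.
destruct (ivp_sol_solves (fun _ => RtoC 0) (k * k) 0 1 0 (fun t => continuous_Cconst _ t)) as (H & Ha & Hb).
refine (proj2 (solution_unique (fun t => 0 - k * k)%C _ _ (kcos k) (fun t => - (k * k) * ksin k t)%C 0 PI _ H _ _ _)).
- intros t; apply continuous_Cconst.
- split; intros t; [now apply is_derive_kcos|].
  eapply is_derive_Ceq; [apply is_derive_Cscal; now apply is_derive_ksin|ring].
- rewrite Ha, kcos_0; reflexivity.
- rewrite Hb, ksin_0 by exact Hk; ring.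
Qed.

Lemma ent_free_neumann : ent free_neumann.
Proof. apply (ivp_sol_entire (fun _ => RtoC 0) 0 1 0 PI); intros; apply continuous_Cconst. Qed.

(** Includes k = 0, where [ksin] has a junk value; this is what exhibits the zero at lam = 0. *)
Lemma free_neumann_real (k : R) : free_neumann (k * k)%C = RtoC (- (k * sin (k * PI))).
Proof.
destruct (Req_dec k 0) as [->|Hk].
- replace (0 * 0)%C with (RtoC 0) by ring; replace (- (0 * sin (0 * PI))) with 0 by ring.
  unfold free_neumann, c_solD.
  destruct (ivp_sol_solves (fun _ => RtoC 0) 0 0 1 0 (fun t => continuous_Cconst _ t)) as (H & Ha & Hb).
  refine (proj2 (solution_unique (fun t => 0 - 0)%C _ _ (fun _ => RtoC 1) (fun _ => RtoC 0) 0 PI _ H _ Ha Hb)).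
  + intros t; apply continuous_Cconst.
  + split; intros t; [apply is_derive_Cconst|eapply is_derive_Ceq; [apply is_derive_Cconst|ring]].
- rewrite free_neumann_eq by now apply RtoC_nz.
  rewrite ksin_real by exact Hk; rewrite <- RtoC_mult, <- RtoC_opp, <- RtoC_mult; f_equal; field; exact Hk.
Qed.

Lemma is_derive_RtoC_comp (f : R -> R) (t l : R) : is_derive f t l -> is_derive (fun s => RtoC (f s)) t (RtoC l).
Proof.
intros H; apply is_derive_RC_parts; split; simpl; [exact H|].
apply (is_derive_const (K := R_AbsRing) (V := R_NormedModule)).
Qed.

Lemma is_derive_RC_unique (f : R -> C) (t : R) (a b : C) : is_derive f t a -> is_derive f t b -> a = b.
Proof.
rewrite !is_derive_RC_parts; intros [H1 H2] [H3 H4]; apply C_eq.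
- rewrite <- (is_derive_unique _ _ _ H1); now apply is_derive_unique.
- rewrite <- (is_derive_unique _ _ _ H2); now apply is_derive_unique.
Qed.

(** Tested on real k. For m >= 1 a double zero would annihilate the derivative of -k sin(pi k) at k
    = m, which is -pi m cos(pi m). At m = 0 the substitution lam = k^2 doubles orders, so one factor
    k is removed first: -sin(pi k) would be k^3 G(k^2), yet its derivative at 0 is -pi. *)
Lemma free_neumann_simple (m : nat) (G : C -> C) : entp G ->
  ~ (forall w, free_neumann w = ((w - INR m * INR m) * ((w - INR m * INR m) * G w))%C).
Proof.
intros HG E.
destruct (entp_derivative G HG) as [G' DG].
assert (Dsq : forall k : R, is_derive (fun k : R => RtoC k * RtoC k)%C k (RtoC 1 * k + k * RtoC 1)%C).
{ intros k; apply is_derive_Cmult; apply is_derive_RtoC. }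
assert (DGk : forall k : R, is_derive (fun k : R => G (k * k)%C) k ((RtoC 1 * k + k * RtoC 1) * G' (k * k))%C).
{ intros k; apply (is_derive_Ccomp G (fun k : R => k * k)%C); [apply DG|apply Dsq]. }
assert (Dmono : forall k : R, is_derive (fun k : R => k * k - INR m * INR m)%C k (RtoC 1 * k + k * RtoC 1 - 0)%C).
{ intros k; apply is_derive_Cminus; [apply Dsq|apply is_derive_Cconst]. }
pose proof PI_RGT_0 as HPI.
destruct m as [|m].
- assert (D1 : is_derive (fun k : R => RtoC (- sin (k * PI))) 0 (RtoC (- PI))).
  { apply is_derive_RtoC_comp; auto_derive; [easy|]; rewrite Rmult_0_l, cos_0; ring. }
  assert (D2 : is_derive (fun k : R => RtoC k * (RtoC k * (RtoC k * G (k * k))))%C 0 (RtoC 0)).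
  { eapply is_derive_Ceq.
    - do 3 (apply is_derive_Cmult; [apply is_derive_RtoC|]); apply DGk.
    - cbv beta; ring. }
  assert (E0 : RtoC (- PI) = 0).
  { eapply is_derive_RC_unique; [exact D1|].
    apply (is_derive_Cext (fun k : R => RtoC k * (RtoC k * (RtoC k * G (k * k))))%C); [|exact D2].
    intros k; destruct (Req_dec k 0) as [->|Hk].
    - rewrite Rmult_0_l, sin_0, Ropp_0; ring.
    - assert (HkC : RtoC k <> 0) by now apply RtoC_nz.
      specialize (E (k * k)%C); rewrite free_neumann_real in E; simpl INR in E.
      replace (- sin (k * PI)) with (- (k * sin (k * PI)) * / k) by (field; exact Hk).
      rewrite RtoC_mult, E, RtoC_inv by exact Hk; field; exact HkC. }
  apply RtoC_inj in E0; lra.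
- set (n := INR (S m)) in *.
  assert (Hn : n <> 0) by (apply not_0_INR; lia).
  assert (D1 : is_derive (fun k : R => RtoC (- (k * sin (k * PI)))) n (RtoC (- (n * (PI * cos (n * PI)))))).
  { apply is_derive_RtoC_comp; auto_derive; [easy|]; unfold n; rewrite sin_nat_PI; ring. }
  assert (D2 : is_derive (fun k : R => (k * k - n * n) * ((k * k - n * n) * G (k * k)))%C n (RtoC 0)).
  { eapply is_derive_Ceq.
    - apply is_derive_Cmult; [apply Dmono|apply is_derive_Cmult; [apply Dmono|apply DGk]].
    - cbv beta; fold n; ring. }
  assert (E0 : RtoC (- (n * (PI * cos (n * PI)))) = 0).
  { eapply is_derive_RC_unique; [exact D1|].
    apply (is_derive_Cext (fun k : R => (k * k - n * n) * ((k * k - n * n) * G (k * k)))%C); [|exact D2].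
    intros k; rewrite <- E; apply free_neumann_real. }
  apply RtoC_inj in E0.
  pose proof (cos_nat_PI_neq_0 (S m)) as Hc; fold n in Hc.
  assert (Hne : n * (PI * cos (n * PI)) <> 0).
  { apply Rmult_integral_contrapositive_currified; [exact Hn|].
    apply Rmult_integral_contrapositive_currified; [lra|exact Hc]. }
  lra.
Qed.

(** Both squares in [Cmod_sin_sqr] must vanish: the hyperbolic one makes k real, the other makes it
    an integer. *)
Lemma free_neumann_zeros (w : C) : free_neumann w = 0 -> exists m : nat, w = (INR m * INR m)%C.
Proof.
intros H; destruct (Csqrt_upper w) as (k & <- & Hk).
destruct (Ceq_dec k 0) as [->|Hk0]; [exists O; simpl; ring|].
rewrite free_neumann_eq in H by exact Hk0.
assert (Hs : ksin k PI = 0).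
{ destruct (Ceq_dec (ksin k PI) 0) as [|Hn]; [assumption|exfalso].
  revert H; apply Cmult_neq_0; [|exact Hn].
  intros H1; apply (Cmult_neq_0 k k Hk0 Hk0).
  replace (k * k)%C with (- - (k * k))%C by ring; rewrite H1; ring. }
pose proof (ksin_cexp k Hk0) as E; rewrite Hs in E.
pose proof (Cmod_sin_sqr k) as S; rewrite <- E in S.
replace (2 * Ci * k * 0)%C with (RtoC 0) in S by ring; rewrite Cmod_0 in S.
set (P := exp (Im k * PI)) in *; set (Q := exp (- (Im k * PI))) in *.
pose proof (pow2_ge_0 (P - Q)); pose proof (pow2_ge_0 (sin (Re k * PI))).
assert (HPQ : P = Q) by nra.
assert (Hsin : sin (Re k * PI) = 0) by nra.
apply exp_inv in HPQ; pose proof PI_RGT_0 as HPI.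
assert (Him : Im k = 0) by nra.
apply sin_eq_0_0 in Hsin; destruct Hsin as [z Hz].
assert (Hre : Re k = IZR z) by (apply (Rmult_eq_reg_r PI); lra).
exists (Z.abs_nat z); rewrite INR_IZR_INZ, Zabs2Nat.id_abs, abs_IZR.
destruct k as [a b]; simpl in *; subst a b.
rewrite <- RtoC_mult.
replace (Rabs (IZR z) * Rabs (IZR z)) with (IZR z * IZR z) by (pose proof (Rsqr_abs (IZR z)) as Hq; unfold Rsqr in Hq; exact Hq).
apply C_eq; simpl; ring.
Qed.

Lemma entp_div_list (f : C -> C) (zs : list C) : entp f -> NoDup zs -> (forall z, In z zs -> f z = 0) ->
  exists F, entp F /\ forall w, f w = (Pol zs w * F w)%C.
Proof.
revert f; induction zs as [|z zs IH]; intros f Hf Hnd Hz.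
- exists f; split; [exact Hf|]; intros w; simpl; ring.
- inversion Hnd as [|? ? Hin Hnd']; subst.
  destruct (entp_div f z Hf (Hz z (or_introl eq_refl))) as (g & Hg & E).
  destruct (IH g Hg Hnd') as (F & HF & EF).
  + intros y Hy; pose proof (Hz y (or_intror Hy)) as H0; rewrite E in H0.
    destruct (Ceq_dec (g y) 0) as [|Hn]; [assumption|exfalso].
    revert H0; apply Cmult_neq_0; [|exact Hn].
    apply Cminus_eq_contra; intros ->; contradiction.
  + exists F; split; [exact HF|]; intros w; rewrite E, EF; simpl; ring.
Qed.

Lemma free_neumann_factored (N : nat) :
  factored free_neumann ((INR N + / 2) * (INR N + / 2)) (map (fun m => INR m * INR m)%C (seq 0 (S N))).
Proof.
set (zs := map (fun m => INR m * INR m)%C (seq 0 (S N))).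
assert (Hmod : forall m : nat, Cmod (INR m * INR m) = INR m * INR m).
{ intros m; rewrite Cmod_mult, Cmod_R, Rabs_pos_eq by apply pos_INR; reflexivity. }
assert (Hz0 : forall m : nat, free_neumann (INR m * INR m)%C = 0).
{ intros m; rewrite free_neumann_real, sin_nat_PI; f_equal; ring. }
pose proof (entp_ent _ ent_free_neumann) as Hf.
pose proof (pos_INR N) as HN0.
assert (Hin : forall z, In z zs <-> exists m : nat, (m <= N)%nat /\ z = (INR m * INR m)%C).
{ intros z; unfold zs; rewrite in_map_iff; split.
  - intros (m & <- & Hm); apply in_seq in Hm; exists m; split; [lia|reflexivity].
  - intros (m & Hm & ->); exists m; split; [reflexivity|apply in_seq; lia]. }
destruct (entp_div_list free_neumann zs Hf) as (F & HF & EF).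
- apply Injective_map_NoDup; [|apply seq_NoDup].
  intros m n E; rewrite <- !RtoC_mult in E; apply RtoC_inj in E.
  pose proof (pos_INR m); pose proof (pos_INR n); apply INR_eq; nra.
- intros z Hz; apply Hin in Hz; destruct Hz as (m & _ & ->); apply Hz0.
(* The larger radius is the modulus of the next zero. A zero of F below it would be one of the
   listed squares and hence a double zero. *)
- exists F, ((INR N + 1) * (INR N + 1)); repeat split; [nra|nra|exact HF| | |exact EF].
  + intros w Hw HFw.
    assert (Hfw : free_neumann w = 0) by (rewrite EF, HFw; ring).
    destruct (free_neumann_zeros w Hfw) as [m Em].
    destruct (entp_div F w HF HFw) as (F1 & HF1 & E1).
    assert (HmN : (m <= N)%nat).
    { rewrite Em, Hmod in Hw; pose proof (pos_INR m).
      assert (Hlt : INR m < INR (S N)) by (rewrite S_INR; nra).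
      apply INR_lt in Hlt; lia. }
    assert (Hw_in : In w zs) by (apply Hin; now exists m).
    assert (Hcnt : exists P, entp P /\ forall y, Pol zs y = ((y - w) * P y)%C).
    { apply entp_div; [apply ent_Pol|now apply Pol_eq_0]. }
    destruct Hcnt as (P & HP & EP).
    apply (free_neumann_simple m (fun y => P y * F1 y)%C).
    * now apply (entp_mult P F1).
    * intros y; rewrite <- Em, EF, EP, E1; ring.
  + intros z Hz; apply Hin in Hz; destruct Hz as (m & Hm & ->); rewrite Hmod.
    apply le_INR in Hm; pose proof (pos_INR m); nra.
Qed.

(** * The trace formula *)

(* With alpha = a / (- lam s) and beta = u^2 / (4 a s), the quotient a^2 / (- lam D) is alpha / (1 + beta). *)
Lemma quotient_estimate (lam s sg u w v : C) (R E B eps : R) :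
  0 < E -> 1 <= B -> 0 < eps <= 1 -> 48 * B * (1 + Cmod v) <= R -> Cmod lam = R * R ->
  E / (6 * R) <= Cmod sg -> Cmod (s - sg) <= B * E / (R * R) ->
  Cmod u <= B * E / (R * R) -> Cmod w <= eps * E / R ->
  let a := (w - (lam - v) * s)%C in
  let D := (u * u / 4 + a * s)%C in
  let h := (a * a / (- lam * D))%C in
  a <> 0 /\ D <> 0 /\ Cmod (a / (- lam * sg) - 1) <= / 2 /\ Cmod (h - 1) <= / 2 /\
  Cmod (lam * clog h + v) <= 24 * eps + (144 * (B * B) * (1 + Cmod v) + 2 * ((Cmod v + 80) * (Cmod v + 80))) / (R * R).
Proof.
intros HE HB He HR Hlam Hsg Hs Hu Hw a D h.
pose proof (Cmod_ge_0 v) as Hv.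
assert (HR48 : 48 * B <= R) by nra.
assert (HRv : 48 * (1 + Cmod v) <= R) by nra.
assert (HR0 : 0 < R) by lra.
assert (HRR : 0 < R * R) by nra.
assert (Hl0 : lam <> 0) by (apply Cmod_gt_0; lra).
assert (Hsg0 : 0 < Cmod sg) by (eapply Rlt_le_trans; [|exact Hsg]; apply Rdiv_lt_0_compat; lra).
assert (Hsgn : sg <> 0) by now apply Cmod_gt_0.
set (er := E / R) in *.
assert (Her : 0 < er) by (apply Rdiv_lt_0_compat; assumption).
assert (Hsg' : er / 6 <= Cmod sg) by (replace (er / 6) with (E / (6 * R)) by (unfold er; field; lra); exact Hsg).
assert (HBR : 0 <= B / R <= / 48).
{ split; [apply Rdiv_le_0_compat; lra|].
  apply (Rmult_le_reg_r R); [lra|]; unfold Rdiv; rewrite Rmult_assoc, Rinv_l by lra; lra. }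
set (b := B / R) in *.
assert (Hs' : Cmod (s - sg) <= b * er) by (replace (b * er) with (B * E / (R * R)) by (unfold b, er; field; lra); exact Hs).
assert (Hu' : Cmod u <= b * er) by (replace (b * er) with (B * E / (R * R)) by (unfold b, er; field; lra); exact Hu).
assert (Hw' : Cmod w <= eps * er) by (replace (eps * er) with (eps * E / R) by (unfold er; field; lra); exact Hw).
(* The free lower bound er/6 loses at most er/48 in passing from [sg] to [s]; the 12 here is the
   source of the 24 in the final estimate. *)
assert (Hslow : er / 12 <= Cmod s).
{ pose proof (Cmod_rev_triangle sg s) as H; rewrite Cmod_minus_sym in H; nra. }
assert (Hs0 : 0 < Cmod s) by lra.
assert (Hsn : s <> 0) by now apply Cmod_gt_0.
set (om := (w / s)%C).
assert (Hom : Cmod om <= 12 * eps).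
{ unfold om; rewrite Cmod_div by exact Hsn.
  apply (Rmult_le_reg_r (Cmod s)); [exact Hs0|]; unfold Rdiv; rewrite Rmult_assoc, Rinv_l by lra; nra. }
set (al := (1 - (v + om) / lam)%C).
assert (Ea : a = (- lam * s * al)%C) by (unfold a, al, om; field; split; assumption).
assert (Hal1 : Cmod (al - 1) <= (Cmod v + 12) / (R * R)).
{ replace (al - 1)%C with (- ((v + om) / lam))%C by (unfold al; ring).
  rewrite Cmod_opp, Cmod_div, Hlam by exact Hl0.
  apply Rmult_le_compat_r; [apply Rlt_le, Rinv_0_lt_compat, HRR|].
  apply Cmod_plus_bound; lra. }
assert (Hv8 : (Cmod v + 12) / (R * R) <= / 8).
{ apply (Rmult_le_reg_r (R * R)); [exact HRR|]; unfold Rdiv; rewrite Rmult_assoc, Rinv_l by lra; nra. }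
assert (Hal : 7 / 8 <= Cmod al).
{ pose proof (Cmod_rev_triangle 1 al) as H; rewrite Cmod_1, Cmod_minus_sym in H; lra. }
assert (Haln : al <> 0) by (apply Cmod_gt_0; lra).
assert (Ha0 : a <> 0) by (rewrite Ea; repeat apply Cmult_neq_0; auto; intros H; apply Hl0; replace lam with (- - lam)%C by ring; rewrite H; ring).
assert (H4 : RtoC 4 <> 0) by (apply RtoC_nz; lra).
set (be := (- (u * u) / (4 * lam * (s * s) * al))%C).
assert (ED : D = (- lam * (s * s) * al * (1 + be))%C).
{ unfold D, be; rewrite Ea; field; repeat split; assumption. }
assert (Hbe : Cmod be <= 72 * (B * B) / (R * R * (R * R))).
{ assert (Hden : 2 * (R * R) * (er / 12 * (er / 12)) <= Cmod (4 * lam * (s * s) * al)).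
  { rewrite !Cmod_mult, Hlam, Cmod_R, Rabs_pos_eq by lra.
    assert (H1 : er / 12 * (er / 12) <= Cmod s * Cmod s) by (apply Rmult_le_compat; lra).
    assert (H2 : (R * R) * (er / 12 * (er / 12)) <= (R * R) * (Cmod s * Cmod s)) by (apply Rmult_le_compat_l; lra).
    assert (H3 : 0 <= (R * R) * (Cmod s * Cmod s)) by (apply Rmult_le_pos; nra).
    apply Rle_trans with (4 * ((R * R) * (Cmod s * Cmod s)) * (7 / 8)); [lra|].
    replace (4 * (R * R) * (Cmod s * Cmod s) * Cmod al) with (4 * ((R * R) * (Cmod s * Cmod s)) * Cmod al) by ring.
    apply Rmult_le_compat_l; lra. }
  assert (Hd0 : 0 < 2 * (R * R) * (er / 12 * (er / 12))).
  { apply Rmult_lt_0_compat; [lra|]; apply Rmult_lt_0_compat; lra. }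
  assert (Hdn : (4 * lam * (s * s) * al)%C <> 0) by (apply Cmod_gt_0; lra).
  unfold be; rewrite Cmod_div, Cmod_opp, Cmod_mult by exact Hdn.
  apply (Rmult_le_reg_r (Cmod (4 * lam * (s * s) * al))); [lra|].
  unfold Rdiv at 1; rewrite Rmult_assoc, Rinv_l, Rmult_1_r by lra.
  apply Rle_trans with (72 * (B * B) / (R * R * (R * R)) * (2 * (R * R) * (er / 12 * (er / 12)))).
  - replace (72 * (B * B) / (R * R * (R * R)) * (2 * (R * R) * (er / 12 * (er / 12)))) with ((b * er) * (b * er)) by (unfold b; field; lra).
    apply Rmult_le_compat; auto.
  - apply Rmult_le_compat_l; [|exact Hden]; apply Rdiv_le_0_compat; nra. }
assert (Hb2 : b * b <= / 2304) by nra.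
assert (Hbe2 : Cmod be * (R * R) <= 72 * (b * b)).
{ apply (Rmult_le_compat_r (R * R)) in Hbe; [|lra].
  replace (72 * (B * B) / (R * R * (R * R)) * (R * R)) with (72 * (b * b)) in Hbe by (unfold b; field; lra); exact Hbe. }
assert (HRR48 : 2304 <= R * R) by nra.
pose proof (Cmod_ge_0 be) as Hbe0.
assert (Hbe8 : Cmod be <= / 8) by nra.
assert (H1be : 7 / 8 <= Cmod (1 + be)).
{ pose proof (Cmod_rev_triangle 1 (- be)) as H; rewrite Cmod_1, Cmod_opp in H.
  replace (1 - - be)%C with (1 + be)%C in H by ring; lra. }
assert (Hben : (1 + be)%C <> 0) by (apply Cmod_gt_0; lra).
assert (Hmln : (- lam)%C <> 0) by (intros H; apply Hl0; replace lam with (- - lam)%C by ring; rewrite H; ring).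
assert (HD0 : D <> 0) by (rewrite ED; repeat apply Cmult_neq_0; auto).
assert (Eh : h = (al / (1 + be))%C).
{ unfold h; rewrite ED, Ea; field; repeat split; assumption. }
split; [exact Ha0|split; [exact HD0|]].
assert (Hratio : Cmod (a / (- lam * sg) - 1) <= / 2).
{ replace (a / (- lam * sg) - 1)%C with ((al - 1) + al * ((s - sg) / sg))%C by (rewrite Ea; field; repeat split; assumption).
  apply Cmod_plus_bound; rewrite Cmod_mult, Cmod_div by exact Hsgn.
  assert (H1 : Cmod (s - sg) / Cmod sg <= / 8).
  { apply (Rmult_le_reg_r (Cmod sg)); [exact Hsg0|]; unfold Rdiv; rewrite Rmult_assoc, Rinv_l by lra; nra. }
  assert (H2 : Cmod al <= 9 / 8).
  { replace al with (1 + (al - 1))%C by ring; apply Cmod_plus_bound; rewrite Cmod_1; lra. }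
  assert (0 <= Cmod (s - sg) / Cmod sg) by (apply Rdiv_le_0_compat; [apply Cmod_ge_0|exact Hsg0]).
  pose proof (Cmod_ge_0 al); nra. }
split; [exact Hratio|].
(* Error of the first-order expansion of lam (h - 1). The terms +v and -v cancel in the numerator,
   leaving -om - lam be + v be; lam be tends to 0 since be is of order 1/lam^2. *)
set (de := (lam * (h - 1) + v)%C).
assert (Hde : Cmod de <= 24 * eps + 144 * (B * B) * (1 + Cmod v) / (R * R)).
{ replace de with ((- om - lam * be + v * be) / (1 + be))%C
   by (unfold de; rewrite Eh; unfold al; field; repeat split; assumption).
  rewrite Cmod_div by exact Hben.
  apply (Rmult_le_reg_r (Cmod (1 + be))); [lra|].
  unfold Rdiv at 1; rewrite Rmult_assoc, Rinv_l, Rmult_1_r by lra.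
  assert (Hnum : Cmod (- om - lam * be + v * be) <= 12 * eps + 72 * (b * b) * (1 + Cmod v)).
  { apply Cmod_plus_bound; eapply Rle_trans; [apply Rplus_le_compat_r, Cmod_minus_le|].
    rewrite Cmod_opp, !Cmod_mult, Hlam.
    assert (Cmod v * Cmod be <= Cmod v * (72 * (b * b))) by (apply Rmult_le_compat_l; nra). lra. }
  replace (144 * (B * B) * (1 + Cmod v) / (R * R)) with (2 * (72 * (b * b) * (1 + Cmod v))) by (unfold b; field; lra).
  assert (0 <= 72 * (b * b) * (1 + Cmod v)) by (apply Rmult_le_pos; nra).
  nra. }
assert (Hbb : 144 * (B * B) * (1 + Cmod v) / (R * R) = 144 * (b * b) * (1 + Cmod v)) by (unfold b; field; lra).
assert (Hh : Cmod (h - 1) <= (Cmod v + 80) / (R * R)).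
{ replace (h - 1)%C with ((de - v) / lam)%C by (unfold de; field; exact Hl0).
  rewrite Cmod_div, Hlam by exact Hl0.
  apply Rmult_le_compat_r; [apply Rlt_le, Rinv_0_lt_compat, HRR|].
  apply Cmod_minus_bound.
  assert (144 * (b * b) * (1 + Cmod v) <= 1).
  { assert (b * (1 + Cmod v) <= / 48).
    { unfold b; apply (Rmult_le_reg_r R); [lra|].
      replace (B / R * (1 + Cmod v) * R) with (B * (1 + Cmod v)) by (field; lra); lra. }
    assert (0 <= b * (1 + Cmod v)) by (apply Rmult_le_pos; lra). nra. }
  lra. }
assert (Hh2 : (Cmod v + 80) / (R * R) <= / 2).
{ apply (Rmult_le_reg_r (R * R)); [exact HRR|]; unfold Rdiv; rewrite Rmult_assoc, Rinv_l by lra; nra. }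
split; [lra|].
(* Passing from h - 1 to its logarithm costs lam times a quadratic term, and h - 1 is of order
   1/lam. *)
replace (lam * clog h + v)%C with (de + lam * (clog (1 + (h - 1)) - (h - 1)))%C.
2: { replace (1 + (h - 1))%C with h by ring; unfold de; ring. }
apply Cmod_plus_bound; rewrite Cmod_mult, Hlam.
pose proof (clog_approx (h - 1) ltac:(lra)) as Hc.
assert (Hq : R * R * Cmod (clog (1 + (h - 1)) - (h - 1)) <= 2 * ((Cmod v + 80) * (Cmod v + 80)) / (R * R)).
{ apply Rle_trans with (R * R * (2 * ((Cmod v + 80) / (R * R) * ((Cmod v + 80) / (R * R))))).
  - apply Rmult_le_compat_l; [lra|]; eapply Rle_trans; [exact Hc|].
    apply Rmult_le_compat_l; [lra|]; apply Rmult_le_compat; auto.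
  - right; field; lra. }
unfold Rdiv in *; lra.
Qed.

(** * Change of base point, the discriminant and the circles *)

Lemma solves_translate (W y y1 : R -> C) (h : R) : solves W y y1 ->
  solves (fun t => W (t + h)) (fun t => y (t + h)) (fun t => y1 (t + h)).
Proof. intros [H1 H2]; split; intros t; apply is_derive_translate; auto. Qed.

Lemma is_ivp_sol_translate (V : R -> C) (lam : C) (x : R) (a b : C) (fg : (R -> C) * (R -> C)) :
  is_ivp_sol V lam x a b fg ->
  is_ivp_sol (fun t => V (t + x)) lam 0 a b (fun t => fst fg (t + x), fun t => snd fg (t + x)).
Proof.
rewrite !is_ivp_sol_solves; intros (H & Ha & Hb); simpl; rewrite Rplus_0_l.
split; [exact (solves_translate _ _ _ x H)|now split].
Qed.

(* The monodromy matrices at 0 and x are conjugate by the (unimodular) transfer matrix from 0 to x. *)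
Lemma Delta_basepoint (V : R -> C) (lam : C) (x : R) :
  (forall t, ccontinuous V t) -> (forall t, V (t + PI) = V t) ->
  (c_sol V lam x (x + PI) * s_solD V lam x (x + PI) - c_solD V lam x (x + PI) * s_sol V lam x (x + PI) = 1)%C /\
  Defs.Delta V lam = ((c_sol V lam x (x + PI) + s_solD V lam x (x + PI)) / 2)%C.
Proof.
intros CV Hper; unfold Defs.Delta, c_sol, c_solD, s_sol, s_solD.
destruct (ivp_sol_solves V lam 0 1 0 CV) as (Hc0 & Ec0 & Ec01).
destruct (ivp_sol_solves V lam 0 0 1 CV) as (Hs0 & Es0 & Es01).
destruct (ivp_sol_solves V lam x 1 0 CV) as (Hc & Ec & Ec1).
destruct (ivp_sol_solves V lam x 0 1 CV) as (Hs & Es & Es1).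
set (c0 := fst (ivp_sol V lam 0 1 0)) in *; set (c01 := snd (ivp_sol V lam 0 1 0)) in *.
set (s0 := fst (ivp_sol V lam 0 0 1)) in *; set (s01 := snd (ivp_sol V lam 0 0 1)) in *.
set (c := fst (ivp_sol V lam x 1 0)) in *; set (c1 := snd (ivp_sol V lam x 1 0)) in *.
set (s := fst (ivp_sol V lam x 0 1)) in *; set (s1 := snd (ivp_sol V lam x 0 1)) in *.
destruct (solution_basis _ c c1 s s1 c0 c01 x (x + PI) Hc Hs Hc0 Ec Ec1 Es Es1) as (W & A1 & A2).
destruct (solution_basis _ c c1 s s1 s0 s01 x (x + PI) Hc Hs Hs0 Ec Ec1 Es Es1) as (_ & A3 & A4).
destruct (solution_basis _ c0 c01 s0 s01 c0 c01 0 x Hc0 Hs0 Hc0 Ec0 Ec01 Es0 Es01) as (W0 & _).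
assert (Hsh : forall y y1, solves (fun t => V t - lam)%C y y1 -> solves (fun t => V t - lam)%C (fun t => y (t + PI)) (fun t => y1 (t + PI))).
{ intros y y1 Hy; eapply solves_ext; [|exact (solves_translate _ _ _ PI Hy)].
  intros t; cbv beta; now rewrite Hper. }
destruct (solution_basis _ c0 c01 s0 s01 _ _ 0 x Hc0 Hs0 (Hsh _ _ Hc0) Ec0 Ec01 Es0 Es01) as (_ & B1 & B2).
destruct (solution_basis _ c0 c01 s0 s01 _ _ 0 x Hc0 Hs0 (Hsh _ _ Hs0) Ec0 Ec01 Es0 Es01) as (_ & B3 & B4).
rewrite Rplus_0_l in B1, B2, B3, B4.
rewrite A1 in B1; rewrite A2 in B2; rewrite A3 in B3; rewrite A4 in B4.
split; [exact W|].
f_equal.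
(* Invariance of the trace by hand: it is multiplied by the Wronskian of c0 and s0 at x, which is 1,
   so that both conjugation relations can be inserted. *)
transitivity ((c0 PI + s01 PI) * (c0 x * s01 x - c01 x * s0 x))%C; [rewrite W0; ring|].
transitivity (s01 x * (c0 PI * c0 x + c01 PI * s0 x) - c01 x * (s0 PI * c0 x + s01 PI * s0 x)
  + (c0 x * (s0 PI * c01 x + s01 PI * s01 x) - s0 x * (c0 PI * c01 x + c01 PI * s01 x)))%C; [ring|].
rewrite <- B1, <- B2, <- B3, <- B4.
transitivity ((c (x + PI)%R + s1 (x + PI)%R) * (c0 x * s01 x - c01 x * s0 x))%C; [ring|].
rewrite W0; ring.
Qed.

(** From ((a + b)/2)^2 = ((a - b)/2)^2 + a b with a = c and b = s', together with the Wronskian c s'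
    - c' s = 1. *)
Lemma Delta_sqr (V : R -> C) (lam : C) (x : R) :
  (forall t, ccontinuous V t) -> (forall t, V (t + PI) = V t) ->
  let u := (c_sol V lam x (x + PI) - s_solD V lam x (x + PI))%C in
  (Defs.Delta V lam * Defs.Delta V lam - 1 = u * u / 4 + c_solD V lam x (x + PI) * s_sol V lam x (x + PI))%C.
Proof.
intros CV Hper u; destruct (Delta_basepoint V lam x CV Hper) as [W ->].
set (a := c_sol V lam x (x + PI)) in *; set (b1 := s_solD V lam x (x + PI)) in *.
set (a1 := c_solD V lam x (x + PI)) in *; set (b := s_sol V lam x (x + PI)) in *.
transitivity (u * u / 4 + (a * b1 - 1))%C.
- unfold u; field; split; apply RtoC_nz; lra.
- rewrite <- W; ring.
Qed.

Lemma ent_Delta_factor (V : R -> C) (d : C) :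
  (forall t, ccontinuous V t) -> ent (fun lam => Defs.Delta V lam + d)%C.
Proof.
intros CV.
assert (H := ent_lin (/ 2)%C (/ 2)%C _ _ (proj1 (ivp_sol_entire V 0 1 0 PI CV)) (proj2 (ivp_sol_entire V 0 0 1 PI CV))).
eapply ent_ext; [|exact (ent_lin 1 d _ _ H (ent_const 1))].
intros lam; unfold Defs.Delta, c_sol, s_solD; field; apply C2_nz.
Qed.

Lemma entp_Delta (V : R -> C) :
  (forall t, ccontinuous V t) -> entp (fun lam => Defs.Delta V lam * Defs.Delta V lam - 1)%C.
Proof.
intros CV; eapply entp_mult.
- apply entp_ent, (ent_Delta_factor V 1 CV).
- apply entp_ent, (ent_Delta_factor V (- 1)%C CV).
- intros lam; cbv beta; ring.
Qed.

(** Translating the potential by x brings the base point to 0, where [hill_asymptotics] applies; the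
    threshold in N is uniform over the whole circle. *)
Lemma circle_asymptotics (V V' : R -> C) (x : R) :
  (forall t, is_derive V t (V' t)) -> (forall t, ccontinuous V' t) ->
  (forall t, V (t + PI) = V t) -> forall eps, 0 < eps ->
  exists N0, forall N lam, (N0 <= N)%nat -> Cmod lam = (INR N + / 2) * (INR N + / 2) ->
  let a := c_solD V lam x (x + PI) in
  let D := (Defs.Delta V lam * Defs.Delta V lam - 1)%C in
  let h := (a * a / (- lam * D))%C in
  a <> 0 /\ D <> 0 /\ Cmod (a / free_neumann lam - 1) <= / 2 /\ Cmod (h - 1) <= / 2 /\
  Cmod (lam * clog h + V x) <= eps.
Proof.
intros HV HV' Hper eps Heps.
pose proof (is_derive_all_continuous V _ HV) as CV.
destruct (hill_asymptotics (fun t => V (t + x)) (fun t => V' (t + x))) as (B & HB & Hsu & Hw).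
{ intros t; apply is_derive_translate, HV. }
{ intros t; apply (continuous_comp (fun s : R => s + x) V'); [|apply HV'].
  apply (continuous_plus (V := R_NormedModule)); [apply continuous_id|apply continuous_const]. }
{ rewrite Rplus_0_l, Rplus_comm; apply Hper. }
set (v := V x); pose proof (Cmod_ge_0 v) as Hv.
(* [quotient_estimate] turns e1 into 24 e1 <= eps/2; the other half of eps is for the terms of order
   1/lam. *)
set (e1 := Rmin 1 (eps / 48)).
assert (He1 : 0 < e1 <= 1) by (unfold e1; split; [apply Rmin_pos; lra|apply Rmin_l]).
assert (He1' : e1 <= eps / 48) by apply Rmin_r.
destruct (Hw e1 (proj1 He1)) as (K & HBK & HwK).
set (C0 := 144 * (B * B) * (1 + Cmod v) + 2 * ((Cmod v + 80) * (Cmod v + 80))).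
assert (HC0 : 0 < C0).
{ unfold C0; apply Rplus_lt_0_compat; [|nra]; apply Rmult_lt_0_compat; nra. }
set (K' := Rmax (Rmax K (48 * B * (1 + Cmod v))) (2 * C0 / eps)).
destruct (INR_unbounded K') as [N0 HN0].
(* The successor guarantees N >= 1, as [ksin_lower] demands. *)
exists (S N0); intros N lam HN Hlam a D h.
set (Rr := INR N + / 2) in *.
assert (HRK' : K' <= Rr).
{ apply le_INR in HN; rewrite S_INR in HN; unfold Rr; lra. }
assert (HRK : K <= Rr) by (eapply Rle_trans; [|exact HRK']; eapply Rle_trans; [apply Rmax_l|apply Rmax_l]).
assert (HRB : 48 * B * (1 + Cmod v) <= Rr) by (eapply Rle_trans; [|exact HRK']; eapply Rle_trans; [apply Rmax_r|apply Rmax_l]).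
assert (HRC : 2 * C0 / eps <= Rr) by (eapply Rle_trans; [|exact HRK']; apply Rmax_r).
assert (HR1 : 1 <= Rr) by lra.
destruct (Csqrt_upper lam) as (k & Ek & Hk).
assert (HkR : Cmod k = Rr).
{ assert (Hkk : Cmod k * Cmod k = Rr * Rr) by (rewrite <- Cmod_mult, Ek; exact Hlam).
  pose proof (Cmod_ge_0 k); nra. }
assert (Hk0 : k <> 0) by (apply Cmod_gt_0; lra).
pose proof (is_ivp_sol_translate V lam x 1 0 _ (ivp_sol_spec V lam x 1 0 CV)) as Sc.
pose proof (is_ivp_sol_translate V lam x 0 1 _ (ivp_sol_spec V lam x 0 1 CV)) as Ss.
rewrite <- Ek in Sc, Ss.
destruct (Hsu k _ _ _ _ Hk ltac:(lra) Sc Ss) as [Hs Hu].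
pose proof (HwK k _ _ _ _ Hk ltac:(lra) Sc Ss) as Hww.
cbv beta in Hs, Hu, Hww; rewrite Ek, HkR, (Rplus_comm PI x), ?Rplus_0_l in *.
fold (c_sol V lam x (x + PI)) (s_solD V lam x (x + PI)) (c_solD V lam x (x + PI)) (s_sol V lam x (x + PI)) in *.
fold a v in Hww.
set (s := s_sol V lam x (x + PI)) in *.
set (u := (c_sol V lam x (x + PI) - s_solD V lam x (x + PI))%C) in *.
pose proof (ksin_lower k N ltac:(lia) HkR Hk) as Hlow; rewrite HkR in Hlow.
(* The small quantity is w = a + (lam - v) s, so the a of the estimate is the Neumann function
   itself. *)
assert (Hquot := quotient_estimate lam s (ksin k PI) u (a + (lam - v) * s)%C v Rr (exp (Im k * PI)) B e1
  (exp_pos _) HB He1 HRB Hlam Hlow Hs Hu Hww); cbv zeta in Hquot.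
replace (a + (lam - v) * s - (lam - v) * s)%C with a in Hquot by ring.
assert (ED : D = (u * u / 4 + a * s)%C) by (apply (Delta_sqr V lam x CV Hper)).
rewrite <- ED in Hquot.
replace (- lam * ksin k PI)%C with (free_neumann lam) in Hquot
 by (rewrite <- Ek, free_neumann_eq by exact Hk0; reflexivity).
destruct Hquot as (Q1 & Q2 & Q3 & Q4 & Q5).
repeat split; try assumption.
eapply Rle_trans; [exact Q5|]; fold C0.
assert (HCR : C0 / (Rr * Rr) <= eps / 2).
{ apply (Rmult_le_reg_r (Rr * Rr)); [nra|]; unfold Rdiv at 1; rewrite Rmult_assoc, Rinv_l, Rmult_1_r by nra.
  apply (Rmult_le_compat_r (eps / 2)) in HRC; [|lra].
  replace (2 * C0 / eps * (eps / 2)) with C0 in HRC by (field; lra).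
  nra. }
lra.
Qed.

Lemma psum_1_map (E : nat -> C) (M : nat) : psum 1 (map E (seq 0 (S M))) = Csum E M.
Proof.
induction M as [|M IH]; [rewrite Csum_O; simpl; ring|].
rewrite seq_S, map_app, psum_app, IH, Csum_S; simpl; ring.
Qed.

(** The series index k stands for m = k + 1, so the partial sum up to n reaches nu_(n+1) and
    E_(2n+2), exactly the zeros inside the circle numbered n + 1. *)
Lemma Csum_trace (E nu : nat -> C) (n : nat) :
  Csum (fun k => 2 * nu (S k) - E (2 * k + 1)%nat - E (2 * k + 2)%nat)%C n =
  (2 * Csum nu (S n) - Csum E (2 * S n) - (2 * nu O - E O))%C.
Proof.
induction n as [|n IH].
- rewrite Csum_O; simpl; rewrite !Csum_S, !Csum_O; ring.
- replace (2 * S (S n))%nat with (S (S (2 * S n))) by lia.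
  rewrite Csum_S, IH, (Csum_S nu (S n)), 2!(Csum_S E).
  replace (2 * S n + 1)%nat with (S (2 * S n)) by lia.
  replace (2 * S n + 2)%nat with (S (S (2 * S n))) by lia; ring.
Qed.

Theorem theorem3p2 (V : R -> C) (HV : is_C1 V)
    (Hper : forall t : R, V (t + PI)%R = V t)
    (E : nat -> C) (HE : periodic_eigs V E)
    (x : R) (nu : nat -> C) (Hnu : neumann_eigs V x nu) :
  is_series (fun k : nat => (2 * nu (S k) - E (2 * k + 1)%nat - E (2 * k + 2)%nat)%C)
            (V x - (2 * nu O - E O))%C.
Proof.
destruct HV as [V' HV'].
assert (HV : forall t, is_derive V t (V' t)) by (intros t; apply HV').
assert (CV' : forall t, ccontinuous V' t) by (intros t; apply HV').
pose proof (is_derive_all_continuous V _ HV) as CV.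
apply is_Cseries_eps; intros eps Heps.
destruct (circle_asymptotics V V' x HV CV' Hper (eps / 2)) as [N0 HN0]; [lra|].
exists N0; intros n Hn.
(* The circle is numbered n + 1 to match the last term of the partial sum. *)
set (N := S n); specialize (HN0 N).
set (rho := (INR N + / 2) * (INR N + / 2)) in *.
assert (Hrho : 0 < rho) by (pose proof (pos_INR N); unfold rho; nra).
assert (Hcirc : forall t, Cmod (rho * circ 2 t) = rho).
{ intros t; apply Cmod_Rcirc; lra. }
assert (HNN : (N0 <= N)%nat) by (unfold N; lia).
set (A := fun lam => c_solD V lam x (x + PI)) in *.
set (D := fun lam => (Defs.Delta V lam * Defs.Delta V lam - 1)%C).
assert (HA : entp A) by (apply entp_ent, (ivp_sol_entire V x 1 0 (x + PI) CV)).
assert (HD : entp D) by (apply (entp_Delta V CV)).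
assert (Hrc : Cmod rho = rho) by (rewrite Cmod_R, Rabs_pos_eq; lra).
(* The point of the circle on the positive real axis also serves as the point where the function is
   known not to vanish. *)
destruct (enum_zeros_factored A nu rho rho HA) as [Ma FA]; auto.
{ apply (HN0 rho HNN Hrc). }
{ intros w Hw; apply (HN0 w HNN Hw). }
destruct (enum_zeros_factored D E rho rho HD) as [Md FD]; auto.
{ apply (HN0 rho HNN Hrc). }
{ intros w Hw; apply (HN0 w HNN Hw). }
destruct (factored_comparison A free_neumann rho _ _ FA (free_neumann_factored N)) as [LA _].
{ intros t; apply (HN0 _ HNN (Hcirc t)). }
rewrite !length_map, !length_seq in LA; subst Ma.
(* The factor -lam contributes the root 0. It completes the odd number of E's to twice the number of
   nu's and adds nothing to the sum of roots. *)
assert (Fneg : factored (fun w => - w)%C rho [RtoC 0]).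
{ exists (fun _ => (- 1)%C), (rho + 1); repeat split; [lra|lra| | | |].
  - apply entp_ent, ent_const.
  - intros w _ H; apply RtoC_inj in H; lra.
  - intros z [<-|[]]; rewrite Cmod_0; exact Hrho.
  - intros w; simpl; ring. }
destruct (factored_comparison (fun w => A w * A w)%C (fun w => - w * D w)%C rho _ _
  (factored_mult A A rho _ _ FA FA) (factored_mult _ D rho _ _ Fneg FD)) as [LD Hsum].
{ intros t; apply (HN0 _ HNN (Hcirc t)). }
rewrite !length_app, !length_map, !length_seq in LD; simpl in LD.
(* The circle holds N + 1 Neumann zeros, so 2 (N + 1) = 1 + Md. *)
assert (HMd : Md = S (2 * N)) by lia; subst Md.
specialize (Hsum (V x) (eps / 2)).
rewrite !psum_app, !psum_1_map in Hsum.
rewrite Csum_trace; fold N.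
replace (2 * Csum nu N - Csum E (2 * N) - (2 * nu O - E O) - (V x - (2 * nu O - E O)))%C
 with (Csum nu N + Csum nu N - (psum 1 [RtoC 0] + Csum E (2 * N)) - V x)%C by (simpl psum; ring).
eapply Rle_lt_trans; [apply Hsum|lra].
intros t; apply (HN0 _ HNN (Hcirc t)).
Qed.
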